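(* Let $0<\alpha,\beta<1$, let $\boldsymbol A_0$ be the self-adjoint Jacobi operator of the context with eigenvalues $\lambda_n=(-n-1)(-n+\alpha+\beta)$, $n\in\mathbb N_0$, and let $\mu$ be its $2\times2$ matrix-valued spectral measure. The eigenvector of $\boldsymbol A_0$ corresponding to the eigenvalue $\lambda_n$ takes (up to a nonzero scalar) the following form in the spectral representation: $$f_n(x)=\chi_{\{\lambda_n\}}(x)\begin{pmatrix}1\\c_4(n)\end{pmatrix}\in L^2(\mu),$$ where $\chi_{\{\lambda_n\}}$ is the characteristic function of $\{\lambda_n\}$. Moreover, $L^2(\mu)=\operatorname{clos}\operatorname{span}\{f_n:n\in\mathbb N_0\}$.
   Context: **Operator.** Let $p(x)=(1-x)^{\alpha+1}(1+x)^{\beta+1}$, $\ell_{\alpha,\beta}[f](x)=-\frac{1}{(1-x)^\alpha(1+x)^\beta}[p(x)f'(x)]'$ in $\mathcal H=L^2[(-1,1),(1-x)^\alpha(1+x)^\beta]$, and $\mathcal D_{\max}^{(\alpha,\beta)}=\{f\in\mathcal H: f,f'\in AC_{loc}(-1,1),\ \ell_{\alpha,\beta}[f]\in\mathcal H\}$. $\boldsymbol A_0$ is the self-adjoint operator acting by $\ell_{\alpha,\beta}$ on those $f\in\mathcal D_{\max}^{(\alpha,\beta)}$ with $\lim_{x\to1^-}(f(x)-\frac{(1-x)f'(x)}\alpha)=0$ and $\lim_{x\to-1^+}(f(x)+\frac{(1+x)f'(x)}\beta)=0$. Its spectrum is discrete. **Special functions** (with $1/\Gamma=0$ at poles of $\Gamma$):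 $$c_1(z)=\frac{-\Gamma(\alpha+1)\Gamma(-\beta)}{\Gamma(-z+\alpha)\Gamma(z-\beta+1)},\quad c_2(z)=\frac{\beta2^{\alpha+\beta+1}\Gamma(\alpha+1)\Gamma(\beta)}{\Gamma(z+1)\Gamma(-z+\alpha+\beta)},\quad c_4(z)=\frac{\beta\Gamma(1-\alpha)\Gamma(\beta)}{\alpha\Gamma(z-\alpha+1)\Gamma(-z+\beta)}.$$ **Weyl function and spectral measure.** With $\lambda=(-z-1)(-z+\alpha+\beta)$ put $M_\infty(\lambda)=\frac1{c_2(z)}\begin{pmatrix}-c_4(z)&1\\1&-c_1(z)\end{pmatrix}$ and $M_0(\lambda)=-M_\infty(\lambda)^{-1}$ for $\lambda\in\mathbb C\setminus\mathbb R$. $M_0$ is a matrix-valued Herglotz function, $M_0(\lambda)=C+D\lambda+\int_{\mathbb R}\big((w-\lambda)^{-1}-w(1+w^2)^{-1}\big)d\mu(w)$, and $\mu$ is the non-negative $2\times2$ matrix-valued measure in this representation. It is the spectral measure of $\boldsymbol A_0$ with respect to the ordered cyclic set $\{\widetilde\delta_1,\widetilde\delta_{-1}\}$, where $\widetilde\delta_{1},\widetilde\delta_{-1}$ are the functionals on the form domain of $\boldsymbol A_0$ that extend $f\mapsto\lim_{x\to1^-}p(x)f'(x)$ and $f\mapsto\lim_{x\to-1^+}-p(x)f'(x)$ from $\mathcal D_{\max}^{(\alpha,\beta)}$. **Spectral representation.** $L^2(\mu)$ is the Hilbert space of (classes of) $\mathbb C^2$-valued functions with inner product $\langle\varphi,\psi\rangle_{L^2(\mu)}=\int_{\mathbb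 R}\langle d\mu(x)\varphi(x),\psi(x)\rangle_{\mathbb C^2}$. $\boldsymbol A_0$ is unitarily equivalent to multiplication by the independent variable on $L^2(\mu)$, and the eigenvector ''in the spectral representation'' is the eigenvector of this multiplication operator. *)

(* Defs.v *)
From HB Require Import structures.
From mathcomp Require Import all_boot all_order all_algebra.
From mathcomp Require Import complex.
From mathcomp Require Import all_classical all_reals all_analysis.

Set Implicit Arguments.
Unset Strict Implicit.
Unset Printing Implicit Defensive.

Import Order.TTheory GRing.Theory Num.Theory numFieldNormedType.Exports.

Local Open Scope classical_set_scope.
Local Open Scope complex_scope.
Local Open Scope sesquilinear_scope.
Local Open Scope ring_scope.

(* R[i] carries no topology, differential or integration theory in the library:
   limits, derivatives, measurability and integrals of R[i]-valued functions
   are taken on the real and imaginary parts. *)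
Section ComplexValued.
Context {R : realType}.
Implicit Types f : R -> R[i].

Definition re (z : R[i]) : R := complex.Re z.
Definition im (z : R[i]) : R := complex.Im z.

Definition ccvg {T : Type} (F : set_system T) (f : T -> R[i]) (l : R[i]) :=
  (re (f x) @[x --> F] --> re l) /\ (im (f x) @[x --> F] --> im l).

Definition clim_seq (u : nat -> R[i]) : R[i] :=
  lim ((re (u n)) @[n --> \oo]) +i* lim ((im (u n)) @[n --> \oo]).

Definition cderivable f (x : R) :=
  derivable (fun t => re (f t)) x 1 /\ derivable (fun t => im (f t)) x 1.

Definition cderive f (x : R) : R[i] :=
  derive1 (fun t => re (f t)) x +i* derive1 (fun t => im (f t)) x.

Definition cmeasurable (D : set R) f :=
  measurable_fun D (fun x => re (f x)) /\ measurable_fun D (fun x => im (f x)).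

Definition cintegral (nu : {measure set (measurableTypeR R) -> \bar R})
    (D : set R) f : R[i] :=
  Rintegral nu D (fun x => re (f x)) +i* Rintegral nu D (fun x => im (f x)).

Definition normsq (z : R[i]) : R := re z ^+ 2 + im z ^+ 2.

Definition cexp (z : R[i]) : R[i] :=
  (expR (re z))%:C * (cos (im z) +i* sin (im z)).

(* Gauss' formula Gamma(z) = lim n! n^z / (z (z+1) ... (z+n)). At a pole of
   Gamma the quotient is eventually x / 0 = 0, so Gamma z = 0 there and hence
   (Gamma z)^-1 = 0, which is the convention for 1/Gamma. *)
Definition Gamma (z : R[i]) : R[i] :=
  clim_seq (fun n => (n`!)%:R * cexp (z * (ln (n%:R : R))%:C)
                     / \prod_(k < n.+1) (z + k%:R)).

Definition abs_cont_on f (a b : R) :=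
  forall e : R, 0 < e -> exists2 d : R, 0 < d &
    forall (n : nat) (u v : 'I_n -> R),
      (forall i, [/\ a <= u i, u i <= v i & v i <= b]) ->
      trivIset setT (fun i => `]u i, v i[%classic : set R) ->
      \sum_(i < n) (v i - u i) < d ->
      \sum_(i < n) `|f (v i) - f (u i)| < e%:C.

Definition AC_loc f :=
  forall a b : R, -1 < a -> a <= b -> b < 1 -> abs_cont_on f a b.

End ComplexValued.

Section JacobiOperator.
Context {R : realType}.
Variables al be : R.
Implicit Types f g h : R -> R[i].

Definition jac_I : set R := `]-1, 1[%classic.
Definition jac_w (x : R) : R := (1 - x) `^ al * (1 + x) `^ be.
Definition jac_p (x : R) : R := (1 - x) `^ (al + 1) * (1 + x) `^ (be + 1).

Definition jac_l f (x : R) : R[i] :=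
  - (((jac_w x)^-1)%:C * cderive (fun t => (jac_p t)%:C * cderive f t) x).

(* Elements of L^2[(-1,1), w dx] are represented by functions R -> R[i],
   of which only the values on (-1,1), up to a.e. equality, matter. *)
Definition inH f :=
  cmeasurable jac_I f /\
  (\int[lebesgue_measure]_(x in jac_I) (jac_w x * normsq (f x))%:E < +oo)%E.

Definition eqH f g := {ae lebesgue_measure, forall x : R, jac_I x -> f x = g x}.

Definition ipH f g : R[i] :=
  cintegral lebesgue_measure jac_I (fun x => (jac_w x)%:C * (f x * (g x)^*)).

Definition Dmax f :=
  [/\ inH f,
      AC_loc f,
      forall x, jac_I x -> cderivable f x,
      AC_loc (cderive f) &
      exists2 h, inH h & eqH (jac_l f) h].

Definition dom_A0 f :=
  [/\ Dmax f,
      ccvg 1^'- (fun x => f x - ((1 - x) / al)%:C * cderive f x) 0 &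
      ccvg (-1)^'+ (fun x => f x + ((1 + x) / be)%:C * cderive f x) 0].

(* The graph of A_0: the class of f has a representative g in the domain, and
   h represents l[g]. *)
Definition A0 f h :=
  [/\ inH f, inH h & exists g, [/\ dom_A0 g, eqH g f & eqH (jac_l g) h]].

Definition A0_eigenvector (l : R) f :=
  [/\ inH f, ~ eqH f (fun=> 0) & A0 f (fun x => l%:C * f x)].

Definition eigval (n : nat) : R := (- n%:R - 1) * (- n%:R + al + be).

End JacobiOperator.

Section MatrixMeasure.
Context {R : realType}.

Definition psd (A : 'M[R[i]]_2) :=
  forall v : 'cV[R[i]]_2, 0 <= (v^t* *m A *m v) 0 0.

(* Non-negative matrix-valued measure on the Borel sets of the line, finite on
   bounded sets; only its values on bounded Borel sets are meaningful. *)
Record matrix_measure := MatrixMeasure {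
  mm_fun :> set R -> 'M[R[i]]_2 ;
  mm_psd : forall B : set R, measurable B -> bounded_set B -> psd (mm_fun B) ;
  mm_sigma_additive : forall F : nat -> set R,
    (forall k, measurable (F k)) -> trivIset setT F ->
    bounded_set (\bigcup_k F k) ->
    forall i j, ccvg \oo (fun n => (\sum_(k < n) mm_fun (F k)) i j)
                         (mm_fun (\bigcup_k F k) i j)
}.

(* d mu = W d nu with nu the trace measure of mu. By Radon-Nikodym such a W
   exists and is nu-a.e. unique, and it can be chosen positive semidefinite of
   trace one everywhere. Integrals against mu are integrals against W d nu. *)
Record trace_density (mu : matrix_measure) := TraceDensity {
  td_tr : {measure set (measurableTypeR R) -> \bar R} ;
  td_W : R -> 'M[R[i]]_2 ;
  td_trE : forall B : set R, measurable B -> bounded_set B ->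
    td_tr B = (re (\tr (mu B)))%:E ;
  td_W_meas : forall i j, cmeasurable setT (fun x => td_W x i j) ;
  td_W_psd : forall x, psd (td_W x) ;
  td_W_tr : forall x, \tr (td_W x) = 1 ;
  td_WE : forall B : set R, measurable B -> bounded_set B ->
    forall i j, mu B i j = cintegral td_tr B (fun x => td_W x i j)
}.

Variables (mu : matrix_measure) (P : trace_density mu).
Notation nu := (td_tr P).
Notation W := (td_W P).
Implicit Types phi psi : R -> 'cV[R[i]]_2.

(* <d mu(x) phi(x), psi(x)> = ip_density phi psi x * d nu(x) *)
Definition ip_density phi psi (x : R) : R[i] :=
  ((psi x)^t* *m W x *m phi x) 0 0.

Definition ipL2 phi psi : R[i] := cintegral nu setT (ip_density phi psi).

Definition normsqL2 phi : \bar R :=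
  (\int[nu]_x (re (ip_density phi phi x))%:E)%E.

Definition inL2 phi :=
  (forall i, cmeasurable setT (fun x => phi x i 0)) /\ (normsqL2 phi < +oo)%E.

Definition eqL2 phi psi := normsqL2 (fun x => phi x - psi x) = 0%E.

(* the graph of multiplication by the independent variable *)
Definition mulx phi psi :=
  [/\ inL2 phi, inL2 psi & eqL2 psi (fun x => x%:C *: phi x)].

Definition mulx_eigenvector (l : R) phi :=
  [/\ inL2 phi, ~ eqL2 phi (fun=> 0) & mulx phi (fun x => l%:C *: phi x)].

Definition herglotz_representation (M : R[i] -> 'M[R[i]]_2) :=
  (\int[nu]_x ((1 + x ^+ 2)^-1)%:E < +oo)%E /\
  exists C D : 'M[R[i]]_2, [/\ C^t* = C, psd D &
    forall l : R[i], im l != 0 -> forall i j,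
      M l i j = C i j + D i j * l +
        cintegral nu setT
          (fun w => ((w%:C - l)^-1 - (w / (1 + w ^+ 2))%:C) * W w i j)].

End MatrixMeasure.

Section WeylFunction.
Context {R : realType}.
Variables al be : R.

Definition c1 (z : R[i]) : R[i] :=
  - (Gamma (al + 1)%:C) * Gamma (- be)%:C
  / (Gamma (- z + al%:C) * Gamma (z - be%:C + 1)).

Definition c2 (z : R[i]) : R[i] :=
  (be * 2 `^ (al + be + 1))%:C * Gamma (al + 1)%:C * Gamma be%:C
  / (Gamma (z + 1) * Gamma (- z + al%:C + be%:C)).

Definition c4 (z : R[i]) : R[i] :=
  be%:C * Gamma (1 - al)%:C * Gamma be%:C
  / (al%:C * Gamma (z - al%:C + 1) * Gamma (- z + be%:C)).

Definition mx22 (a b c d : R[i]) : 'M[R[i]]_2 :=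
  \matrix_(i, j) if i == 0 then (if j == 0 then a else b)
                 else (if j == 0 then c else d).

Definition lam (z : R[i]) : R[i] := (- z - 1) * (- z + al%:C + be%:C).

(* A value lam z is attained at z and al + be - 1 - z; c1, c2, c4 agree at
   these two points. *)
Definition is_Minfty (Minf : R[i] -> 'M[R[i]]_2) :=
  forall z : R[i], im (lam z) != 0 ->
    Minf (lam z) = (c2 z)^-1 *: mx22 (- c4 z) 1 1 (- c1 z).

Definition M0 (Minf : R[i] -> 'M[R[i]]_2) (l : R[i]) : 'M[R[i]]_2 :=
  - invmx (Minf l).

Definition fvec (n : nat) (x : R) : 'cV[R[i]]_2 :=
  if x == eigval al be n
  then \col_i (if i == 0 then 1 else c4 n%:R) else 0.

(* a unitary map U : H -> L^2(mu), given on representatives, carrying A_0 to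
   multiplication by the independent variable *)
Definition spectral_representation (mu : matrix_measure) (P : trace_density mu)
    (U : (R -> R[i]) -> (R -> 'cV[R[i]]_2)) :=
  [/\ forall f, inH al be f -> inL2 P (U f),
      forall (a : R[i]) f g, inH al be f -> inH al be g ->
        eqL2 P (U (fun x => a * f x + g x)) (fun x => a *: U f x + U g x),
      forall f g, inH al be f -> inH al be g ->
        ipL2 P (U f) (U g) = ipH al be f g,
      forall phi, inL2 P phi ->
        exists2 f, inH al be f & eqL2 P (U f) phi &
      forall f h, inH al be f -> inH al be h ->
        (A0 al be f h <-> mulx P (U f) (U h))].

End WeylFunction.

(* Main.v *)
Require Import Defs.
From HB Require Import structures.
From mathcomp Require Import all_boot all_order all_algebra.
From mathcomp Require Import complex ring lra zify.
From mathcomp Require Import all_classical all_reals all_analysis measurable_realfun.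
Set Implicit Arguments.
Unset Strict Implicit.
Unset Printing Implicit Defensive.
Import Order.TTheory GRing.Theory Num.Theory numFieldNormedType.Exports.
Import ComplexField.Normc.
Local Open Scope classical_set_scope.
Local Open Scope complex_scope.
Local Open Scope ring_scope.

(* With S(w) = 1 / (Gamma(w) Gamma(1-w)) = sin(pi w) / pi, the identity
   S(a-z) S(b-z) + S(a+b-z) S(z) = S(a) S(b) for a = alpha, b = beta computes the
   determinant of M_infty and yields, for a real constant kappa <> 0,
     M_0(lambda) = kappa Gamma(-z) Gamma(z+1-a-b) ((c1(z), 1), (1, c4(z))).
   The identity for S is obtained from the exponential polynomials
   (1 + i pi w / n)^n, whose odd parts factor over the roots n tan(k pi / n) / pi
   and converge to the Euler product of S by Tannery's theorem.
   Hence M_0 extends continuously to real lambda distinct from all lambda_n, with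
   real diagonal entries, and has a simple pole at lambda_n, whose residue is a real
   multiple of ((1/c4(n), 1), (1, c4(n))), since c1(n) c4(n) = 1.
   For real u the imaginary part of u^T M_0(x + i e) u is the Poisson integral of
   u^T mu u plus a nonnegative multiple of e. With u the unit vectors it gives
   nu[x-e, x+e] <= 2 e Im tr M_0(x + i e) for the trace measure nu, so that nu has
   zero density off {lambda_n} and is carried by that set; at lambda_n the vector
   u = (c4(n), -1) annihilates the residue, so the density of mu at lambda_n is
   proportional to v v^T with v = (1, c4(n)).
   Therefore phi |-> (phi_0 + c4(n) phi_1)(lambda_n) identifies L^2(mu) with a
   weighted l^2 space in which the f_n correspond to the unit vectors. *)

(** [Gamma] is given only as a limit, so everything is phrased through [rgam], the entire function 1
    / Gamma: poles become zeros, and continuity holds everywhere. The obstacle is the addition law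
    of S for complex arguments. The polynomials (1 + i u / n)^n are multiplicative up to O(1 / n),
    which carries the product-to-sum formula over to their limit S. The map z |-> lambda is
    two-to-one, with a branch point where the preimages z and alpha + beta - 1 - z coincide;
    boundary limits are therefore taken along a lifted path in the z-plane, where all factors are
    entire. The atoms must be shown to have positive mass before the density there can be found,
    because the Poisson bound controls only the product of the form of the density with the mass.
    Positivity is obtained by contradiction: without an atom at lambda_n a whole neighbourhood would
    be null, forcing Im tr M_0 = O(e), whereas the residue has nonzero trace kappa' (1 / c + c), for
    some real kappa' <> 0 and c = c4(n). Elements of both Hilbert spaces are representatives, so a
    unitary map respects scalars only up to null functions; the transfer of eigenvectors has to
    account for this. *)

(* R[i] carries the norm topology only when it is seen as a numFieldType. *)
Definition Cx (R : realType) : numFieldType := R[i].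

Definition ctends {R : realType} {T : Type} (F : set_system T)
  (f : T -> R[i]) (l : R[i]) := (f : T -> Cx R) @ F --> (l : Cx R).

(** * Limits of complex-valued functions *)

Section ComplexLimits.
Context {R : realType}.
Implicit Types (z w : R[i]).

Lemma normcC (x : R) : normc x%:C = `|x|.
Proof. by rewrite /normc /= expr0n addr0 sqrtr_sqr. Qed.

Lemma normc_ge0 z : 0 <= normc z.
Proof. by case: z => a b; rewrite /normc /= sqrtr_ge0. Qed.

Lemma normc_eq0 z : (normc z == 0) = (z == 0).
Proof.
apply/eqP/eqP => [|->]; first exact: eq0_normc.
exact: normc0.
Qed.

Lemma sqr_normcE z : normc z ^+ 2 = re z ^+ 2 + im z ^+ 2.
Proof. by case: z => a b; rewrite /normc /= sqr_sqrtr // addr_ge0 ?sqr_ge0. Qed.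

Lemma normc_re z : `|re z| <= normc z.
Proof.
rewrite -(ler_pXn2r (n:=2)) ?nnegrE ?normc_ge0 // sqr_normcE real_normK ?num_real //.
by rewrite lerDl sqr_ge0.
Qed.

Lemma normc_im z : `|im z| <= normc z.
Proof.
rewrite -(ler_pXn2r (n:=2)) ?nnegrE ?normc_ge0 // sqr_normcE real_normK ?num_real //.
by rewrite lerDr sqr_ge0.
Qed.

Lemma normc_le z : normc z <= `|re z| + `|im z|.
Proof.
rewrite -(ler_pXn2r (n:=2)) ?nnegrE ?normc_ge0 ?addr_ge0 //.
rewrite sqr_normcE sqrrD !real_normK ?num_real // lerD2r lerDl.
by rewrite mulrn_wge0 // mulr_ge0.
Qed.

Lemma normcX z n : normc (z ^+ n) = normc z ^+ n.
Proof.
elim: n => [|n IH]; first by rewrite !expr0 normc1.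
by rewrite !exprS normcM IH.
Qed.

Lemma normc_conj z : normc z^* = normc z.
Proof. by case: z => a b; rewrite /normc /= sqrrN. Qed.

Lemma le_normcB z w : normc (z - w) <= normc z + normc w.
Proof. by rewrite (le_trans (le_normcD _ _)) // normcN. Qed.

Section filters.
Context {T : Type} {F : set_system T} {FF : Filter F}.
Implicit Types (f g : T -> R[i]) (a b l : R[i]).

Lemma ctends_eps f l : ctends F f l <->
  forall e : R, 0 < e -> \forall t \near F, normc (f t - l) <= e.
Proof.
split=> [fl e e0|H].
  move/cvgrPdist_le : fl => /(_ e%:C); rewrite ltcR => /(_ e0).
  apply: filterS => t; rewrite distrC -lecR => h; exact: h.
apply/cvgrPdist_le => e e0.
(* The order of [R[i]] compares only numbers with equal imaginary parts, so a positive tolerance is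
   real. *)
have eE : e = (re e)%:C.
  by rewrite /re RRe_real //; exact: gtr0_real.
have e0' : 0 < re e by rewrite -ltcR -eE.
have := H _ e0'; apply: filterS => t.
rewrite -lecR -eE => h; rewrite distrC; exact: h.
Qed.

Lemma ctends_ext f g l : (forall t, f t = g t) -> ctends F f l -> ctends F g l.
Proof. by move=> /funext ->. Qed.

Lemma ctends_near f g l : (\forall t \near F, f t = g t) -> ctends F f l -> ctends F g l.
Proof.
move=> fg /ctends_eps H; apply/ctends_eps => e e0.
by have := H e e0; apply: filterS2 fg => t ->.
Qed.

Lemma ctends_cst l : ctends F (fun=> l) l.
Proof. exact: cvg_cst. Qed.

Lemma ctendsD f g a b : ctends F f a -> ctends F g b ->
  ctends F (fun t => f t + g t) (a + b).
Proof. exact: cvgD. Qed.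

Lemma ctendsN f a : ctends F f a -> ctends F (fun t => - f t) (- a).
Proof. exact: cvgN. Qed.

Lemma ctendsB f g a b : ctends F f a -> ctends F g b ->
  ctends F (fun t => f t - g t) (a - b).
Proof. exact: cvgB. Qed.

Lemma ctendsM f g a b : ctends F f a -> ctends F g b ->
  ctends F (fun t => f t * g t) (a * b).
Proof. exact: cvgM. Qed.

Lemma ctendsV f a : a != 0 -> ctends F f a -> ctends F (fun t => (f t)^-1) a^-1.
Proof. by move=> a0; exact: cvgV. Qed.

Lemma ctends_prod (I : Type) (r : seq I) (f : I -> T -> R[i]) (a : I -> R[i]) :
  (forall i, ctends F (f i) (a i)) ->
  ctends F (fun t => \prod_(i <- r) f i t) (\prod_(i <- r) a i).
Proof.
move=> H; elim: r => [|i r IH].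
  under eq_fun do rewrite big_nil.
  rewrite big_nil; exact: ctends_cst.
under eq_fun do rewrite big_cons.
rewrite big_cons; exact: (ctendsM (H i) IH).
Qed.

Lemma ctends_re f l : ctends F f l -> re (f t) @[t --> F] --> re l.
Proof.
move=> /ctends_eps H; apply/cvgrPdist_le => e /H; apply: filterS => t h.
rewrite distrC; apply: le_trans h; apply: le_trans (normc_re _).
by case: (f t) => ? ?; case: (l).
Qed.

Lemma ctends_im f l : ctends F f l -> im (f t) @[t --> F] --> im l.
Proof.
move=> /ctends_eps H; apply/cvgrPdist_le => e /H; apply: filterS => t h.
rewrite distrC; apply: le_trans h; apply: le_trans (normc_im _).
by case: (f t) => ? ?; case: (l).
Qed.

Lemma ctends_reim f l : re (f t) @[t --> F] --> re l -> im (f t) @[t --> F] --> im l ->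
  ctends F f l.
Proof.
move=> /cvgrPdist_le Hr /cvgrPdist_le Hi; apply/ctends_eps => e e0.
have e20 : 0 < e / 2 by rewrite divr_gt0.
have := Hr _ e20; have := Hi _ e20; apply: filterS2 => t hi hr.
rewrite (le_trans (normc_le _)) // [leRHS](splitr e); apply: lerD.
  by move: hr; rewrite distrC; case: (f t) => ? ?; case: (l).
by move: hi; rewrite distrC; case: (f t) => ? ?; case: (l).
Qed.

Lemma ctends_conj f l : ctends F f l -> ctends F (fun t => (f t)^*) l^*.
Proof.
move=> /ctends_eps H; apply/ctends_eps => e /H; apply: filterS => t.
by rewrite -rmorphB normc_conj.
Qed.

(** An epsilon / 3 exchange of limits. The neighbourhood may depend on [N], so the same lemma serves
    continuity of infinite products and Tannery's theorem. *)
Lemma ctends_approx (X : T -> R[i]) x (Y : nat -> T -> R[i]) (y : nat -> R[i]) :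
  (forall e : R, 0 < e -> exists N,
     (\forall t \near F, normc (X t - Y N t) <= e) /\ normc (y N - x) <= e) ->
  (forall N, ctends F (Y N) (y N)) -> ctends F X x.
Proof.
move=> H HY; apply/ctends_eps => e e0.
have e30 : 0 < e / 3 by rewrite divr_gt0.
have [N [h1 h2]] := H _ e30.
have /ctends_eps /(_ _ e30) := HY N.
apply: filterS2 h1 => t h1 h3.
have -> : X t - x = (X t - Y N t) + (Y N t - y N) + (y N - x) by ring.
rewrite (le_trans (le_normcD _ _)) //.
have := le_normcD (X t - Y N t) (Y N t - y N); lra.
Qed.

End filters.

Lemma ctends_le {T} {F : set_system T} {PF : ProperFilter F} (f : T -> R[i]) l (M : R) :
  ctends F f l ->
  (\forall t \near F, normc (f t) <= M) -> normc l <= M.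
Proof.
move=> /ctends_eps H fM; apply/ler_addgt0Pr => e e0.
have := filter_ex (filterI (H e e0) fM) => -[t [h1 h2]].
have -> : l = f t - (f t - l) by rewrite opprB addrC subrK.
by rewrite (le_trans (le_normcB _ _)) // lerD.
Qed.

Lemma ctends_unique {T} {F : set_system T} {PF : ProperFilter F} (f : T -> R[i]) l l' :
  ctends F f l -> ctends F f l' -> l = l'.
Proof.
move=> h1 h2; apply/eqP; rewrite -subr_eq0 -normc_eq0 eq_le normc_ge0 andbT.
apply: (ctends_le (ctendsB h1 h2)); near=> t.
by rewrite subrr normc0.
Unshelve. all: by end_near. Qed.

Lemma clim_seqE (u : nat -> R[i]) l : ctends \oo u l -> clim_seq u = l.
Proof.
move=> ul; rewrite /clim_seq.
have -> := cvg_lim (@Rhausdorff R) (ctends_re ul).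
have -> := cvg_lim (@Rhausdorff R) (ctends_im ul).
by case: l ul.
Qed.

Lemma ctends_cauchy (u : nat -> R[i]) :
  (forall e : R, 0 < e -> exists N, forall n, (N <= n)%N -> normc (u n - u N) <= e) ->
  exists l, ctends \oo u l.
Proof.
move=> H.
have aux (p : R[i] -> R) : (forall z w, `|p z - p w| <= normc (z - w)) ->
    cvgn (p \o u).
  move=> Hp; apply/cauchy_cvgP/cauchy_exP => e e0.
  have [N HN] := H (e / 2) ltac:(by rewrite divr_gt0).
  exists (p (u N)); exists N => // n /= /HN hn.
  suff : `|p (u N) - p (u n)| < e by [].
  rewrite distrC (le_lt_trans (Hp _ _)) // (le_lt_trans hn) //.
  by rewrite ltr_pdivrMr // ltr_pMr // ltr1n.
have hr : cvgn (re \o u).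
  apply: aux => z w; apply: le_trans (normc_re _).
  by case: z; case: w.
have hi : cvgn (im \o u).
  apply: aux => z w; apply: le_trans (normc_im _).
  by case: z; case: w.
exists (limn (re \o u) +i* limn (im \o u)).
by apply: ctends_reim; [exact: hr|exact: hi].
Qed.

End ComplexLimits.
Arguments ctends_cst {R T F FF} l.

(** * Infinite products with factors 1 + O(1 / k^2) *)

Section InfiniteProducts.
Context {R : realType}.
Implicit Types (a : nat -> R[i]) (K : R).

(** This form of an O(1 / k^2) bound telescopes, as K / (p (p + 1)) = K / p - K / (p + 1), so its
    tails have explicit sums. *)
Definition quad_bound K (k : nat) : R := K / (k.+1%:R * k.+2%:R).

Lemma sum_quad_bound K n m : 0 <= K ->
  \sum_(n <= k < m) quad_bound K k <= K / n.+1%:R.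
Proof.
move=> K0; have K0' : 0 <= K / n.+1%:R by rewrite divr_ge0.
have [nm|mn] := leqP n m; last by rewrite big_geq // ltnW.
rewrite (eq_bigr (fun k => (- (K / k.+2%:R)) - (- (K / k.+1%:R)))); last first.
  have aux (p q : R) : p != 0 -> q != 0 -> q - p = 1 ->
      K / (p * q) = - (K / q) - - (K / p).
    by move=> p0 q0 pq; rewrite -[K in LHS]mulr1 -pq; field; rewrite p0 q0.
  move=> k _; apply: aux; rewrite ?pnatr_eq0 //.
  by rewrite -natrB // subSnn.
rewrite telescope_sumr // opprK addrC lerBlDr lerDl divr_ge0 //.
Qed.

(** Expanding the product majorizes the left side by the product of the 1 + b k, minus 1, and 1 + t
    <= exp t. The induction runs on p (1 + a) - 1 = (p - 1) + (p - 1) a + a. *)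
Lemma prod_dist1 a (b : nat -> R) n m :
  (forall k, (n <= k < m)%N -> normc (a k) <= b k) ->
  normc (\prod_(n <= k < m) (1 + a k) - 1) <= expR (\sum_(n <= k < m) b k) - 1.
Proof.
have [nm|mn] := leqP n m; last first.
  by move=> _; rewrite !big_geq ?(ltnW mn) // expR0 !subrr normc0.
elim: m nm => [|m IH] nm H.
  by move: nm; rewrite leqn0 => /eqP ->; rewrite !big_geq // expR0 !subrr normc0.
move: nm; rewrite leq_eqVlt => /orP[/eqP <-|].
  by rewrite !big_geq // expR0 !subrr normc0.
rewrite ltnS => nm; rewrite !big_nat_recr //=.
have {}IH := IH nm (fun k hk => H k ltac:(lia)).
set p := \prod_(n <= k < m) _ in IH *; set s := \sum_(n <= k < m) _ in IH *.
have Hm := H m ltac:(lia).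
have a0 := normc_ge0 (a m).
have -> : p * (1 + a m) - 1 = (p - 1) + ((p - 1) * a m + a m) by ring.
rewrite (le_trans (le_normcD _ _)) // expRD.
have h1 : normc ((p - 1) * a m + a m) <= (expR s - 1) * b m + b m.
  rewrite (le_trans (le_normcD _ _)) // normcM lerD // ler_pM // normc_ge0 //.
have h2 := expR_ge1Dx (b m); have h3 := expR_gt0 s.
have : expR s * (1 + b m) <= expR s * expR (b m) by rewrite ler_pM2l.
by lra.
Qed.

Lemma prod_norm a (b : nat -> R) n m :
  (forall k, (n <= k < m)%N -> normc (a k) <= b k) ->
  normc (\prod_(n <= k < m) (1 + a k)) <= expR (\sum_(n <= k < m) b k).
Proof.
move=> /prod_dist1 H; set p := \prod_(n <= k < m) _ in H *.
have -> : p = (p - 1) + 1 by ring.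
rewrite (le_trans (le_normcD _ _)) // normc1; lra.
Qed.

(** Truncation error at [n]: the first factor bounds the head of the product, the second the
    distance of the tail from 1. It depends on the factors only through [K], which is what makes
    convergence uniform in parameters. *)
Definition prod_err K n : R := expR K * (expR (K / n.+1%:R) - 1).

Lemma prod_err_small K e : 0 < e -> exists N, prod_err K N <= e.
Proof.
move=> e0.
have : (fun n => prod_err K n) @ \oo --> expR K * (expR (K * 0) - 1).
  apply: cvgM; first exact: cvg_cst.
  apply: cvgB; last exact: cvg_cst.
  apply: continuous_cvg; first exact: continuous_expR.
  apply: cvgM; [exact: cvg_cst|exact: cvg_harmonic].
rewrite mulr0 expR0 subrr mulr0 => /cvgrPdist_le /(_ _ e0) [N _ HN].
exists N; have := HN N (leqnn _); rewrite sub0r normrN.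
exact: le_trans (ler_norm _).
Qed.

Lemma prod_dist a K n m : 0 <= K -> (n <= m)%N ->
  (forall k, (k < m)%N -> normc (a k) <= quad_bound K k) ->
  normc (\prod_(0 <= k < m) (1 + a k) - \prod_(0 <= k < n) (1 + a k)) <= prod_err K n.
Proof.
move=> K0 nm H; rewrite (@big_cat_nat _ _ _ n 0 m) //=.
set p := \prod_(0 <= k < n) _; set q := \prod_(n <= k < m) _.
have -> : p * q - p = p * (q - 1) by ring.
rewrite normcM ler_pM ?normc_ge0 //.
  apply: le_trans (prod_norm (b := quad_bound K) _) _; first by move=> k hk; apply: H; lia.
  rewrite ler_expR (le_trans (sum_quad_bound 0 n K0)) // divr1 //.
apply: le_trans (prod_dist1 (b := quad_bound K) _) _; first by move=> k hk; apply: H; lia.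
by rewrite lerD2r ler_expR sum_quad_bound.
Qed.

Lemma cprod_ex a K : 0 <= K -> (forall k, normc (a k) <= quad_bound K k) ->
  exists p, ctends \oo (fun n => \prod_(0 <= k < n) (1 + a k)) p.
Proof.
move=> K0 H; apply: ctends_cauchy => e /(prod_err_small K)[N HN].
by exists N => n Nn; rewrite (le_trans _ HN) // prod_dist.
Qed.

Lemma cprod_approx a K p n : 0 <= K -> (forall k, normc (a k) <= quad_bound K k) ->
  ctends \oo (fun n => \prod_(0 <= k < n) (1 + a k)) p ->
  normc (p - \prod_(0 <= k < n) (1 + a k)) <= prod_err K n.
Proof.
move=> K0 H Hp.
apply: (ctends_le (ctendsB Hp (ctends_cst (\prod_(0 <= k < n) (1 + a k))))).
by exists n => // m /= nm; apply: prod_dist.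
Qed.

(** Beyond a suitable [N] the tail stays within 1 / 2 of 1, so the limit stays within half the
    modulus of the nonzero head. *)
Lemma cprod_neq0 a K p : 0 <= K -> (forall k, normc (a k) <= quad_bound K k) ->
  (forall k, 1 + a k != 0) ->
  ctends \oo (fun n => \prod_(0 <= k < n) (1 + a k)) p -> p != 0.
Proof.
move=> K0 H a0 Hp; apply/negP => /eqP p0.
(* As [expR K] is at least 1, this tolerance on [prod_err] leaves at most 1 / 2 for its second
   factor. *)
have h0 : 0 < (expR K)^-1 / 2 by rewrite divr_gt0 // invr_gt0 expR_gt0.
have [N HN] := prod_err_small K h0.
have eK := expR_gt0 K.
have {}HN : expR (K / N.+1%:R) - 1 <= 1 / 2.
  move: HN; rewrite /prod_err => HN.
  rewrite -(ler_pM2l eK) (le_trans HN) //.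
  have e1 : 1 <= expR K by apply: le_trans (expR_ge1Dx K); rewrite lerDl.
  have e2 : (expR K)^-1 <= 1 by rewrite invf_le1.
  by lra.
have q0 : \prod_(0 <= k < N) (1 + a k) != 0.
  by rewrite big_seq prodf_seq_neq0; apply/allP => k _; rewrite a0 implybT.
set q := \prod_(0 <= k < N) _ in q0.
have nq : 0 < normc q by rewrite lt_neqAle normc_ge0 andbT eq_sym normc_eq0.
have : normc (p - q) <= normc q / 2.
  apply: (ctends_le (ctendsB Hp (ctends_cst q))).
  exists N => // m /= Nm; rewrite (@big_cat_nat _ _ _ N 0 m) //= -/q.
  set r := \prod_(N <= k < m) _.
  have -> : q * r - q = q * (r - 1) by ring.
  rewrite normcM ler_pM2l //.
  apply: le_trans (prod_dist1 (b := quad_bound K) _) _ => //.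
  apply: le_trans (_ : expR (K / N.+1%:R) - 1 <= _); last lra.
  by rewrite lerD2r ler_expR sum_quad_bound.
rewrite p0 sub0r normcN; lra.
Qed.

Lemma cprod_cont T (F : set_system T) {FF : Filter F} (a : T -> nat -> R[i]) a0 K X x :
  0 <= K -> (\forall t \near F, forall k, normc (a t k) <= quad_bound K k) ->
  (forall k, normc (a0 k) <= quad_bound K k) ->
  (forall t, ctends \oo (fun n => \prod_(0 <= k < n) (1 + a t k)) (X t)) ->
  ctends \oo (fun n => \prod_(0 <= k < n) (1 + a0 k)) x ->
  (forall k, ctends F (a^~ k) (a0 k)) ->
  ctends F X x.
Proof.
move=> K0 Ha Ha0 HX Hx Haa.
apply: (@ctends_approx _ _ _ _ X x (fun N t => \prod_(0 <= k < N) (1 + a t k))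
   (fun N => \prod_(0 <= k < N) (1 + a0 k))).
  move=> e /(prod_err_small K)[N HN]; exists N; split.
    apply: filterS Ha => t Ht; apply: le_trans HN.
    exact: (cprod_approx _ K0 Ht (HX t)).
  rewrite -normcN opprB; apply: le_trans HN.
  exact: (cprod_approx _ K0 Ha0 Hx).
move=> N; apply: ctends_prod => k; apply: ctendsD; [exact: ctends_cst|exact: Haa].
Qed.

(** Here the number of factors grows with [m] as well, so domination is required only for k < m, the
    range in which the factors occur. *)
Lemma tannery (a : nat -> nat -> R[i]) a0 K x :
  0 <= K -> (forall m k, (k < m)%N -> normc (a m k) <= quad_bound K k) ->
  (forall k, normc (a0 k) <= quad_bound K k) ->
  ctends \oo (fun n => \prod_(0 <= k < n) (1 + a0 k)) x ->
  (forall k, ctends \oo (a^~ k) (a0 k)) ->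
  ctends \oo (fun m => \prod_(0 <= k < m) (1 + a m k)) x.
Proof.
move=> K0 Ha Ha0 Hx Haa.
apply: (@ctends_approx _ _ _ _ _ x (fun N m => \prod_(0 <= k < N) (1 + a m k))
   (fun N => \prod_(0 <= k < N) (1 + a0 k))).
  move=> e /(prod_err_small K)[N HN]; exists N; split.
    by exists N => // m /= Nm; apply: le_trans HN; apply: prod_dist => // k; apply: Ha.
  rewrite -normcN opprB; apply: le_trans HN.
  exact: (cprod_approx _ K0 Ha0 Hx).
move=> N; apply: ctends_prod => k; apply: ctendsD; [exact: ctends_cst|exact: Haa].
Qed.

End InfiniteProducts.

(** * Taylor inequalities for sin, cos and exp on the real line *)

Section ElementaryEstimates.
Context {R : realType}.
Implicit Types x y : R.

(** Used to integrate inequalities: each Taylor bound below has as its derivative the bound proved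
    just before it, starting from cos <= 1. *)
Lemma le_of_derive_ge0 (f df : R -> R) x : 0 <= x ->
  (forall y, is_derive y 1 f (df y)) -> (forall y, 0 < y < x -> 0 <= df y) ->
  f 0 <= f x.
Proof.
rewrite le_eqVlt => /predU1P[<- //|x0] Hf Hdf.
have [|c /[!in_itv] /= c0x h] := MVT x0 (fun y _ => Hf y) _.
  apply: continuous_subspaceT => y; apply: differentiable_continuous.
  by apply/derivable1_diffP; have [] := Hf y.
by rewrite -subr_ge0 h mulr_ge0 ?Hdf // subr0 ltW.
Qed.

Lemma sin_le_id x : 0 <= x -> sin x <= x.
Proof.
move=> x0; rewrite -subr_ge0.
have := @le_of_derive_ge0 (fun t => t - sin t) (fun t => 1 - cos t) x x0.
rewrite sin0 subrr; by apply => y _; rewrite subr_ge0 cos_le1.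
Qed.

Lemma cos_ge x : 1 - x ^+ 2 / 2 <= cos x.
Proof.
wlog x0 : x / 0 <= x => [H|].
  have [/H//|/ltW x0] := leP 0 x.
  by rewrite -sqrrN -cosN H // oppr_ge0.
rewrite -subr_ge0.
have := @le_of_derive_ge0 (fun t => cos t - 1 + t ^+ 2 / 2) (fun t => - sin t + t) x x0.
rewrite cos0 expr0n mul0r addr0 subrr => h.
suff: 0 <= cos x - 1 + x ^+ 2 / 2 by move/le_trans; apply; lra.
apply: h => [y|y /andP[/ltW y0 _]]; last by rewrite addrC subr_ge0 sin_le_id.
apply: is_derive_eq; rewrite /GRing.scale /=; lra.
Qed.

Lemma sin_ge x : 0 <= x -> x - x ^+ 3 / 6 <= sin x.
Proof.
move=> x0; rewrite -subr_ge0.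
have := @le_of_derive_ge0 (fun t => sin t - t + t ^+ 3 / 6)
  (fun t => cos t - 1 + t ^+ 2 / 2) x x0.
rewrite sin0 expr0n mul0r addr0 subrr => h.
suff: 0 <= sin x - x + x ^+ 3 / 6 by move/le_trans; apply; lra.
apply: h => [y|y _]; last by have := cos_ge y; lra.
apply: is_derive_eq; rewrite /GRing.scale /=; lra.
Qed.

Lemma sin_dist x : `|x| <= 1 -> `|sin x - x| <= x ^+ 2.
Proof.
wlog x0 : x / 0 <= x => [H|].
  have [/H//|/ltW x0] := leP 0 x.
  have := H (- x); rewrite sinN normrN sqrrN -opprD normrN oppr_ge0; exact.
rewrite ger0_norm // => x1; rewrite ler_norml.
have := sin_le_id x0; have := sin_ge x0.
have h2 : 0 <= x ^+ 2 by exact: sqr_ge0.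
have : x ^+ 3 <= x ^+ 2 by rewrite exprS ler_piMl.
by move=> *; apply/andP; split; lra.
Qed.

(** Both sides come from exp t >= 1 + t: at t = x directly, and at t = -x in the form exp x (1 - x)
    <= 1, where 1 - (1 + x + 2 x^2) (1 - x) = - x^2 (1 - 2 x). *)
Lemma expR_dist x : `|x| <= 1 / 2 -> `|expR x - 1 - x| <= 2 * x ^+ 2.
Proof.
rewrite ler_norml => /andP[xl xu].
have h0 := expR_ge1Dx x; have h1 := expR_ge1Dx (- x).
have h2 : 0 <= x ^+ 2 by exact: sqr_ge0.
rewrite ler_norml; apply/andP; split; first lra.
have : expR x * (1 - x) <= expR x * expR (- x) by rewrite ler_pM2l ?expR_gt0.
rewrite -expRD subrr expR0 => h3.
suff : (expR x - 1 - x - 2 * x ^+ 2) * (1 - x) <= 0.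
  by rewrite pmulr_lle0; lra.
have : 0 <= x ^+ 2 * (1 - 2 * x) by rewrite mulr_ge0 //; lra.
lra.
Qed.

End ElementaryEstimates.

(** * The exponential of a complex argument *)

Section ComplexExponential.
Context {R : realType}.
Implicit Types z w : R[i].

Lemma cexpE (a b : R) : cexp (a +i* b) = (expR a * cos b) +i* (expR a * sin b).
Proof. by rewrite /cexp /=; simpc. Qed.

Lemma cexpD z w : cexp (z + w) = cexp z * cexp w.
Proof.
case: z => a b; case: w => c d.
have -> : (a +i* b) + (c +i* d) = (a + c) +i* (b + d) by [].
by rewrite !cexpE expRD cosD sinD; apply/eqP; rewrite eq_complex /=; apply/andP; split; apply/eqP; ring.
Qed.

Lemma cexp0 : cexp (0 : R[i]) = 1.
Proof. by rewrite cexpE cos0 sin0 expR0 mulr0 mulr1. Qed.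

Lemma cexp_real (x : R) : cexp x%:C = (expR x)%:C.
Proof. by rewrite cexpE cos0 sin0 mulr0 mulr1. Qed.

Lemma cexp_conj z : cexp z^* = (cexp z)^*.
Proof. by case: z => a b /=; rewrite !cexpE cosN sinN /= mulrN. Qed.

Lemma normc_cexp z : normc (cexp z) = expR (re z).
Proof.
case: z => a b; rewrite cexpE /normc /=.
have -> : (expR a * cos b) ^+ 2 + (expR a * sin b) ^+ 2 = expR a ^+ 2.
  by rewrite !exprMn -mulrDr cos2Dsin2 mulr1.
by rewrite sqrtr_sqr ger0_norm ?expR_ge0.
Qed.

Lemma cexp_neq0 z : cexp z != 0.
Proof. by rewrite -normc_eq0 normc_cexp expR_eq0. Qed.

Lemma cexpN z : cexp (- z) = (cexp z)^-1.
Proof.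
apply: (mulfI (cexp_neq0 z)); rewrite -cexpD subrr cexp0 mulfV //.
exact: cexp_neq0.
Qed.

Lemma ctends_cexp {T} {F : set_system T} {FF : Filter F} (f : T -> R[i]) l :
  ctends F f l -> ctends F (fun t => cexp (f t)) (cexp l).
Proof.
move=> fl; have hr := ctends_re fl; have hi := ctends_im fl.
have cexpE' z : cexp z = (expR (re z) * cos (im z)) +i* (expR (re z) * sin (im z)).
  by case: z => a b; rewrite cexpE.
have he : expR (re (f t)) @[t --> F] --> expR (re l).
  by apply: continuous_cvg; [exact: continuous_expR|exact: hr].
have hc : cos (im (f t)) @[t --> F] --> cos (im l).
  by apply: continuous_cvg; [exact: continuous_cos|exact: hi].
have hs : sin (im (f t)) @[t --> F] --> sin (im l).
  by apply: continuous_cvg; [exact: continuous_sin|exact: hi].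
apply: (@ctends_ext _ _ _ (fun t => (expR (re (f t)) * cos (im (f t))) +i*
    (expR (re (f t)) * sin (im (f t))))) => [t|]; first by rewrite cexpE'.
by rewrite cexpE'; apply: ctends_reim => /=; apply: cvgM.
Qed.

Lemma cexp_dist z : normc (cexp z - 1 - z) <= 8 * normc z ^+ 2 * expR (normc z).
Proof.
have n0 := normc_ge0 z.
have e1 : 1 <= expR (normc z) by rewrite (le_trans _ (expR_ge1Dx _)) // lerDl.
have [z1|z1] := leP (normc z) (1 / 2); last first.
  apply: le_trans (le_normcB _ _) _.
  have := le_normcB (cexp z) 1; rewrite normc_cexp normc1 => h1.
  have h2 : expR (re z) <= expR (normc z).
    by rewrite ler_expR (le_trans (ler_norm _)) // normc_re.
  have h3 := expR_ge1Dx (normc z).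
  have : 2 * expR (normc z) <= 8 * normc z ^+ 2 * expR (normc z).
    rewrite ler_pM2r ?expR_gt0 //.
    have : (1 / 2) ^+ 2 <= normc z ^+ 2 by rewrite ler_pXn2r ?nnegrE ?ltW //; lra.
    lra.
  lra.
suff : normc (cexp z - 1 - z) <= 8 * normc z ^+ 2.
  by move=> h; apply: le_trans h _; rewrite ler_peMr // mulr_ge0 // sqr_ge0.
have := normc_re z; have := normc_im z; have := sqr_normcE z.
case: z {e1} n0 z1 => a b; rewrite [re _]/= [im _]/=; move: (normc _) => r r0 r1 rE hb ha.
rewrite cexpE; apply: le_trans (normc_le _) _; rewrite [re _]/= [im _]/=.
have ha1 : `|a| <= 1 / 2 by lra.
have hb1 : `|b| <= 1 by lra.
have h1 := expR_dist ha1; have h2 := sin_dist hb1; have h3 := cos_ge b; have h4 := cos_le1 b.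
move: h1 h2; set ea := expR a; set sb := sin b; set cb := cos b => h1 h2.
(* Naming the Taylor remainders of exp, sin and cos leaves a polynomial estimate in [a], [b] and
   three small quantities. *)
have [x1 hx1] : exists x, ea = 1 + a + x by exists (ea - 1 - a); ring.
have [x2 hx2] : exists x, sb = b + x by exists (sb - b); ring.
have [x3 hx3] : exists x, cb = 1 - x by exists (1 - cb); ring.
have {}h1 : `|x1| <= 2 * a ^+ 2 by move: h1; rewrite hx1 (_ : _ - _ = x1) //; ring.
have {}h2 : `|x2| <= b ^+ 2 by move: h2; rewrite hx2 (_ : _ - _ = x2) //; ring.
have {}h3 : `|x3| <= b ^+ 2 / 2 by rewrite ger0_norm; move: h3 h4; rewrite -/cb hx3; lra.
have ea2 : `|ea| <= 2.
  rewrite ger0_norm ?expR_ge0 // hx1.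
  have := ler_norm x1; have := ler_norm a.
  have : a ^+ 2 <= 1 / 4.
    rewrite -real_normK ?num_real //.
    have -> : 1 / 4 = (1 / 2) ^+ 2 :> R by field.
    by rewrite ler_pXn2r ?nnegrE //; lra.
  lra.
have -> : ea * cb - 1 - a = x1 - ea * x3 by rewrite hx3 hx1; ring.
have -> : ea * sb - 0 - b = (a + x1) * b + ea * x2 by rewrite hx2 hx1; ring.
have k1 : `|x1 - ea * x3| <= 2 * a ^+ 2 + b ^+ 2.
  apply: le_trans (ler_normB _ _) _; rewrite normrM.
  have : `|ea| * `|x3| <= 2 * (b ^+ 2 / 2) by rewrite ler_pM.
  lra.
have k2 : `|(a + x1) * b + ea * x2| <= 2 * `|a| * `|b| + 2 * b ^+ 2.
  apply: le_trans (ler_normD _ _) _; rewrite !normrM; apply: lerD; last by rewrite ler_pM.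
  rewrite ler_wpM2r //; apply: le_trans (ler_normD _ _) _.
  have : 2 * a ^+ 2 <= `|a|.
    rewrite -real_normK ?num_real //.
    have : 0 <= `|a| * (1 - 2 * `|a|) by rewrite mulr_ge0 //; lra.
    lra.
  lra.
have : 0 <= (`|a| - `|b|) ^+ 2 by exact: sqr_ge0.
rewrite sqrrB !real_normK ?num_real // => k3.
rewrite rE; have := sqr_ge0 a; have := sqr_ge0 b; lra.
Qed.

End ComplexExponential.

(** * The function 1 / Gamma and the sine function *)

Section ReciprocalGamma.
Context {R : realType}.
Implicit Types (z w : R[i]) (r : R).

Definition rgam_seq (n : nat) z : R[i] :=
  (\prod_(k < n.+1) (z + k%:R)) / ((n`!)%:R * cexp (z * (ln (n%:R : R))%:C)).

(* Writing n^z as a telescoping product turns Gauss' quotient into an infinite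
   product whose factors are 1 + O(1 / k^2), see rgam_seqE. *)
Definition gam_factor z (k : nat) : R[i] :=
  (1 + z / k.+2%:R) * cexp (- (z * (ln (k.+2%:R : R) - ln (k.+1%:R : R))%:C)) - 1.

Lemma rgam_seqE z m :
  rgam_seq m.+1 z = z * (1 + z) * \prod_(0 <= k < m) (1 + gam_factor z k).
Proof.
elim: m => [|m IH].
  rewrite big_geq // /rgam_seq !big_ord_recl big_ord0 /= ln1 mulr0 cexp0 /bump /=.
  rewrite ?factE /= !mulr1 ?divr1 addr0; ring.
rewrite big_nat_recr //= mulrA -IH /rgam_seq big_ord_recr /=.
have -> : 1 + gam_factor z m =
    (1 + z / m.+2%:R) * cexp (- (z * (ln (m.+2%:R : R) - ln (m.+1%:R : R))%:C)).
  by rewrite /gam_factor; ring.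
rewrite (factS m.+1) natrM rmorphB /= mulrBr opprB cexpD cexpN.
have h1 := cexp_neq0 (z * (ln (m.+1%:R : R))%:C).
have h2 := cexp_neq0 (z * (ln (m.+2%:R : R))%:C).
move: h1 h2; set c1 := cexp _; set c2 := cexp _ => h1 h2.
have h3 : (m.+1)`!%:R != 0 :> R[i] by rewrite pnatr_eq0 -lt0n fact_gt0.
have h4 : m.+2%:R != 0 :> R[i] by rewrite pnatr_eq0.
move: h3 h4; set f := (m.+1)`!%:R; set q := m.+2%:R => h3 h4; clearbody c1 c2 f q.
by field; rewrite ?h1 ?h2 ?h3 ?h4.
Qed.

(** Both bounds are ln (1 + x) <= x, taken at x = -1 / (k + 2) and at x = 1 / (k + 1). *)
Lemma ln_step (k : nat) :
  k.+2%:R^-1 <= ln (k.+2%:R : R) - ln (k.+1%:R : R) <= k.+1%:R^-1.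
Proof.
have p0 : 0 < k.+1%:R :> R by rewrite ltr0n.
have q0 : 0 < k.+2%:R :> R by rewrite ltr0n.
have qp : k.+2%:R = k.+1%:R + 1 :> R by rewrite -natr1.
rewrite -ln_div ?posrE //.
move: (k.+1%:R : R) (k.+2%:R : R) p0 q0 qp => p q p0 q0 qp.
apply/andP; split.
  have := @le_ln1Dx R (- q^-1); rewrite ltrN2 invf_lt1 // => /(_ ltac:(lra)).
  have -> : 1 + - q^-1 = (q / p)^-1 by rewrite qp; field; apply/andP; split; lra.
  by rewrite lnV ?posrE ?divr_gt0 // lerN2.
have -> : q / p = 1 + p^-1 by rewrite qp; field; lra.
by apply: le_ln1Dx; rewrite (lt_trans _ (_ : 0 < _)) ?invr_gt0 // ltrN10.
Qed.

(** One summand for each term of the decomposition in [gam_factor_bound]. *)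
Definition gam_const r : R := r + r ^+ 2 + (1 + r) * (16 * r ^+ 2 * expR r).

Lemma gam_const_ge0 r : 0 <= r -> 0 <= gam_const r.
Proof.
move=> r0; rewrite /gam_const !addr_ge0 ?mulr_ge0 ?addr_ge0 ?sqr_ge0 ?expR_ge0 //.
Qed.

Lemma normc_nat n : normc (n%:R : R[i]) = n%:R.
Proof. by rewrite -[n%:R]/(n%:R) -(rmorph_nat (real_complex R)) normcC ger0_norm. Qed.

(** With p = k + 1, q = k + 2 and L = ln q - ln p, the first-order terms z / q and -z L almost
    cancel, because 1 / q <= L <= 1 / p and 1 / p - 1 / q = 1 / (p q). All remaining terms are
    quadratic in 1 / p. *)
Lemma gam_factor_bound r z k : normc z <= r ->
  normc (gam_factor z k) <= quad_bound (gam_const r) k.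
Proof.
move=> zr; have z0 := normc_ge0 z; have r0 := le_trans z0 zr.
rewrite /gam_factor /quad_bound.
have /andP[] := ln_step k; set L := _ - _ => L1 L2; clearbody L.
have p0 : 1 <= k.+1%:R :> R by rewrite ler1n.
have q0 : 1 <= k.+2%:R :> R by rewrite ler1n.
have qp : k.+2%:R = k.+1%:R + 1 :> R by rewrite -natr1.
have qE : k.+2%:R = (k.+2%:R : R)%:C by rewrite rmorph_nat.
rewrite qE.
move: (k.+1%:R : R) (k.+2%:R : R) p0 q0 qp L1 L2 => p q p1 q1 qp L1 L2.
have p0 : 0 < p by lra.
have q0 : 0 < q by lra.
have L0 : 0 <= L by apply: le_trans L1; rewrite invr_ge0; lra.
set E := cexp (- (z * L%:C)) - 1 - (- (z * L%:C)).
have -> : (1 + z / q%:C) * cexp (- (z * L%:C)) - 1 =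
    z * (q^-1 - L)%:C - z ^+ 2 * (L / q)%:C + (1 + z / q%:C) * E.
  rewrite /E !rmorphB !rmorphM /= fmorphV /=.
  have qn : q%:C != 0 :> R[i] by rewrite eq_complex /= eqxx andbT; lra.
  by field.
have pq0 : 0 < p * q by rewrite mulr_gt0.
have ipq : (p * q)^-1 = p^-1 - q^-1 by rewrite qp; field; apply/andP; split; lra.
have iq0 : 0 < q^-1 by rewrite invr_gt0.
have ip0 : 0 < p^-1 by rewrite invr_gt0.
have iq1 : q^-1 <= 1 by rewrite invf_le1.
have ip1 : p^-1 <= 1 by rewrite invf_le1.
have ip2 : p^-1 <= 2 * q^-1.
  rewrite -subr_ge0; have -> : 2 * q^-1 - p^-1 = (p - 1) / (p * q).
    by rewrite qp; field; apply/andP; split; lra.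
  by apply: divr_ge0; [lra|exact: ltW].
have ipq' : (p * q)^-1 = p^-1 * q^-1 by rewrite invfM.
have nE : normc E <= 16 * r ^+ 2 * expR r / (p * q).
  apply: le_trans (cexp_dist _) _; rewrite normcN normcM normcC ger0_norm //.
  have h1 : (normc z * L) ^+ 2 <= r ^+ 2 * (2 / (p * q)).
    rewrite exprMn ler_pM ?sqr_ge0 //.
      by rewrite ler_pXn2r ?nnegrE.
    have : L * L <= p^-1 * (2 * q^-1) by rewrite ler_pM //; lra.
    rewrite expr2 ipq'; lra.
  have h2 : expR (normc z * L) <= expR r.
    rewrite ler_expR; apply: le_trans (_ : r * 1 <= _); last by rewrite mulr1.
    by rewrite ler_pM //; lra.
  have : 8 * (normc z * L) ^+ 2 * expR (normc z * L) <=
     8 * (r ^+ 2 * (2 / (p * q))) * expR r.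
    rewrite ler_pM ?mulr_ge0 ?sqr_ge0 ?expR_ge0 // ler_wpM2l //.
  by move/le_trans; apply; lra.
have n1 : normc (1 + z / q%:C) <= 1 + r.
  apply: le_trans (le_normcD _ _) _; rewrite normc1 normcM normcV normcC gtr0_norm //.
  rewrite lerD2l -[r]mulr1 ler_pM //; lra.
have n2 : normc (z * (q^-1 - L)%:C) <= r / (p * q).
  rewrite normcM normcC ler_pM // distrC ger0_norm; lra.
have n3 : normc (z ^+ 2 * (L / q)%:C) <= r ^+ 2 / (p * q).
  have Lq0 : 0 <= L / q by apply: divr_ge0 => //; exact: ltW.
  rewrite normcM normcC normcX (ger0_norm Lq0) ler_pM ?sqr_ge0 //.
    by rewrite ler_pXn2r ?nnegrE.
  by rewrite ipq' ler_pM // ltW.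
apply: le_trans (le_normcD _ _) _.
have := le_normcB (z * (q^-1 - L)%:C) (z ^+ 2 * (L / q)%:C).
have : normc ((1 + z / q%:C) * E) <= (1 + r) * (16 * r ^+ 2 * expR r / (p * q)).
  by rewrite normcM ler_pM ?normc_ge0.
rewrite /gam_const; lra.
Qed.

Definition rgam_prod z : R[i] :=
  clim_seq (fun n => \prod_(0 <= k < n) (1 + gam_factor z k)).

Lemma ctends_rgam_prod z :
  ctends \oo (fun n => \prod_(0 <= k < n) (1 + gam_factor z k)) (rgam_prod z).
Proof.
have [p Hp] := cprod_ex (gam_const_ge0 (normc_ge0 z))
  (fun k => gam_factor_bound k (lexx (normc z))).
by rewrite /rgam_prod (clim_seqE Hp).
Qed.
Arguments ctends_rgam_prod : clear implicits.

(** The entire function 1 / Gamma. The factors z and 1 + z stand outside because the infinite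
    product starts at the root -2. *)
Definition rgam z : R[i] := z * (1 + z) * rgam_prod z.

Lemma ctends_shift (u : nat -> R[i]) l : ctends \oo (fun n => u n.+1) l -> ctends \oo u l.
Proof. by rewrite /ctends => h; rewrite -cvg_shiftS. Qed.

Lemma ctends_rgam z : ctends \oo (fun n => rgam_seq n z) (rgam z).
Proof.
apply: ctends_shift.
apply: (@ctends_ext _ _ _ (fun m => z * (1 + z) * \prod_(0 <= k < m) (1 + gam_factor z k))).
  by move=> m; rewrite rgam_seqE.
apply: ctendsM; [exact: ctends_cst|exact: ctends_rgam_prod].
Qed.
Arguments ctends_rgam : clear implicits.

Lemma rgam_neq0 z : (forall k : nat, z != - k%:R) -> rgam z != 0.
Proof.
move=> H; rewrite /rgam.
have z0 : z != 0 by have := H 0%N; rewrite oppr0.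
have z1 : 1 + z != 0 by have := H 1%N; rewrite addrC addr_eq0.
suff p0 : rgam_prod z != 0 by rewrite !mulf_neq0.
have Hb k : normc (gam_factor z k) <= quad_bound (gam_const (normc z)) k.
  exact: gam_factor_bound.
apply: (cprod_neq0 (gam_const_ge0 (normc_ge0 z)) Hb _ (ctends_rgam_prod z)) => k.
have -> : 1 + gam_factor z k =
    (1 + z / k.+2%:R) * cexp (- (z * (ln (k.+2%:R : R) - ln (k.+1%:R : R))%:C)).
  by rewrite /gam_factor; ring.
rewrite mulf_neq0 ?cexp_neq0 //.
have q0 : k.+2%:R != 0 :> R[i] by rewrite pnatr_eq0.
have -> : 1 + z / k.+2%:R = (z + k.+2%:R) / k.+2%:R by rewrite mulrDl mulfV // addrC.
by rewrite mulf_neq0 ?invr_eq0 // addr_eq0.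
Qed.

Lemma GammaE z : Gamma z = (rgam z)^-1.
Proof.
have seqE n : (n`!)%:R * cexp (z * (ln (n%:R : R))%:C) / \prod_(k < n.+1) (z + k%:R)
    = (rgam_seq n z)^-1.
  by rewrite /rgam_seq invf_div.
rewrite /Gamma; apply: clim_seqE.
have [rz0|r0] := eqVneq (rgam z) 0; last first.
  apply: (@ctends_ext _ _ _ (fun n => (rgam_seq n z)^-1)); first by move=> n; rewrite seqE.
  by apply: ctendsV => //; exact: ctends_rgam.
have [k zk] : exists k : nat, z = - k%:R.
  apply/not_existsP => H; move/eqP: rz0; apply/negP; apply: rgam_neq0 => k.
  by apply/eqP/H.
(* At a pole z = -k the denominator vanishes for all n >= k, so the sequence is eventually 0, which
   agrees with [0^-1]. *)
rewrite rz0 invr0; apply: (@ctends_near _ _ _ _ (fun=> 0)); last exact: ctends_cst.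
exists k => // n /= kn.
rewrite (bigD1 (Ordinal (kn : (k < n.+1)%N))) //= zk.
by rewrite addrC subrr mul0r invr0 mulr0.
Qed.

Lemma rgamE z : rgam z = (Gamma z)^-1.
Proof. by rewrite GammaE invrK. Qed.

Lemma gam_factor_conj z k : gam_factor z^* k = (gam_factor z k)^*.
Proof.
apply/esym; rewrite /gam_factor; set x : R := _ - _.
have xE : (x%:C)^* = x%:C :> R[i] by exact: conjc_real.
rewrite rmorphB rmorphM rmorphD rmorph1 /= -cexp_conj rmorphN !rmorphM fmorphV /=.
by rewrite xE rmorph_nat.
Qed.

Lemma rgam_conj z : rgam z^* = (rgam z)^*.
Proof.
rewrite /rgam !rmorphM rmorphD rmorph1; congr (_ * _).
apply: (ctends_unique (ctends_rgam_prod _)).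
apply: (ctends_ext _ (ctends_conj (ctends_rgam_prod z))) => n.
rewrite rmorph_prod; apply: eq_bigr => k _.
by rewrite rmorphD rmorph1 gam_factor_conj.
Qed.

Lemma ctends_inv_nat z : ctends \oo (fun n => z / n%:R) 0.
Proof.
rewrite -[0](mulr0 z); apply: ctendsM; first exact: ctends_cst.
apply: ctends_shift; apply: (@ctends_ext _ _ _ (fun n => (n.+1%:R^-1)%:C)).
  by move=> n; rewrite fmorphV rmorph_nat.
by apply: ctends_reim => /=; [exact: cvg_harmonic|exact: cvg_cst].
Qed.
Arguments ctends_inv_nat : clear implicits.

Lemma cexp_ln n : (0 < n)%N -> cexp ((ln (n%:R : R))%:C) = n%:R.
Proof. by move=> n0; rewrite cexp_real lnK ?posrE ?ltr0n // rmorph_nat. Qed.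

Lemma rgamS z : rgam z = z * rgam (z + 1).
Proof.
apply/esym.
have h : ctends \oo (fun n => rgam_seq n z * (1 + (z + 1) / n%:R)) (rgam z * (1 + 0)).
  apply: ctendsM; first exact: ctends_rgam.
  by apply: ctendsD; [exact: ctends_cst|exact: ctends_inv_nat].
rewrite addr0 mulr1 in h; apply: (ctends_unique _ h).
apply: ctends_near (ctendsM (ctends_cst z) (ctends_rgam (z + 1))).
exists 1%N => // n /= n0; rewrite /rgam_seq.
have -> : z * (\prod_(k < n.+1) (z + 1 + k%:R) /
    ((n`!)%:R * cexp ((z + 1) * (ln (n%:R : R))%:C))) =
   (z * \prod_(k < n.+1) (z + 1 + k%:R)) /
    ((n`!)%:R * cexp ((z + 1) * (ln (n%:R : R))%:C)) by rewrite mulrA.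
have -> : z * \prod_(k < n.+1) (z + 1 + k%:R) =
    \prod_(k < n.+1) (z + k%:R) * (z + 1 + n%:R).
  transitivity (\prod_(k < n.+2) (z + k%:R)).
    rewrite [RHS]big_ord_recl addr0; congr (_ * _); apply: eq_bigr => k _.
    by rewrite /bump /= natrD addrA.
  by rewrite big_ord_recr /= -natr1 addrAC addrA.
rewrite mulrDl mul1r cexpD cexp_ln //.
have h1 := cexp_neq0 (z * (ln (n%:R : R))%:C).
have h2 : n`!%:R != 0 :> R[i] by rewrite pnatr_eq0 -lt0n fact_gt0.
have h3 : n%:R != 0 :> R[i] by rewrite pnatr_eq0 -lt0n.
move: h1 h2 h3; set c := cexp _; set f := n`!%:R; set q := n%:R => h1 h2 h3; clearbody c f q.
by field; rewrite ?h1 ?h2 ?h3.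
Qed.

Definition sine_prod z n : R[i] := \prod_(0 <= k < n) (1 + - (z / k.+1%:R) ^+ 2).

(** The factor z + 0 of the first product and the factor n + 1 - z of the second are left over; all
    others pair as (j + z) (j - z) = j^2 (1 - (z / j)^2), 1 <= j <= n. *)
Lemma rgam_seq_reflect z n : (0 < n)%N ->
  rgam_seq n z * rgam_seq n (1 - z) = z * sine_prod z n * (1 + (1 - z) / n%:R).
Proof.
move=> n0; rewrite /rgam_seq.
have -> : \prod_(k < n.+1) (z + k%:R) = z * \prod_(0 <= k < n) (z + k.+1%:R).
  by rewrite big_ord_recl addr0 big_mkord.
have -> : \prod_(k < n.+1) (1 - z + k%:R) =
    (\prod_(0 <= k < n) (k.+1%:R - z)) * (n%:R + 1 - z).
  rewrite big_ord_recr big_mkord /=; congr (_ * _); last by ring.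
  by apply: eq_bigr => k _; rewrite -natr1; ring.
have hf : \prod_(0 <= k < n) (z + k.+1%:R) * \prod_(0 <= k < n) (k.+1%:R - z) =
    (n`!%:R) ^+ 2 * sine_prod z n.
  rewrite /sine_prod -big_split /= fact_prod natr_prod.
  rewrite big_add1 /= -prodrXl -big_split /=; apply: eq_bigr => k _.
  have : k.+1%:R != 0 :> R[i] by rewrite pnatr_eq0.
  move: k.+1%:R => p p0; by field.
have -> : cexp ((1 - z) * (ln (n%:R : R))%:C) = n%:R / cexp (z * (ln (n%:R : R))%:C).
  by rewrite mulrBl mul1r cexpD cexp_ln // cexpN.
have h1 := cexp_neq0 (z * (ln (n%:R : R))%:C).
have h2 : n`!%:R != 0 :> R[i] by rewrite pnatr_eq0 -lt0n fact_gt0.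
have h3 : n%:R != 0 :> R[i] by rewrite pnatr_eq0 -lt0n.
move: hf h1 h2 h3; set p1 := \prod_(_ <= _ < _) _; set p2 := \prod_(_ <= _ < _) _.
move: (sine_prod z n) => s.
set c := cexp _; set f := n`!%:R; set q := n%:R => hf h1 h2 h3; clearbody p1 p2 c f q.
transitivity (z * (p1 * p2) * (q + 1 - z) / (f ^+ 2 * q)).
  by field; rewrite ?h1 ?h2 ?h3.
by rewrite hf; field; rewrite ?h1 ?h2 ?h3.
Qed.

Definition sinpi_over_pi z : R[i] := rgam z * rgam (1 - z).

Lemma ctends_sine_prod z : ctends \oo (fun n => z * sine_prod z n) (sinpi_over_pi z).
Proof.
(* Dividing by the correction 1 + (1 - z) / n = (n + 1 - z) / n is safe unless z is a natural
   number; for natural z both sides are eventually 0. *)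
have [z1|z1] := pselect (exists k : nat, z = k%:R).
  have [k zk] := z1.
  have -> : sinpi_over_pi z = 0.
    apply: (ctends_unique (ctendsM (ctends_rgam z) (ctends_rgam (1 - z)))).
    apply: (@ctends_near _ _ _ _ (fun=> 0)); last exact: ctends_cst.
    exists k.+1 => // n /= kn; rewrite rgam_seq_reflect ?(leq_trans _ kn) //.
    case: k => [|k] in zk kn *; first by rewrite zk !mul0r.
    rewrite /sine_prod (big_cat_nat (n := k)) //=; last exact: ltnW (ltnW _).
    rewrite (big_ltn (m := k)) ?(leq_trans _ kn) //.
    rewrite zk divff ?pnatr_eq0 // expr1n subrr; ring.
  apply: (@ctends_near _ _ _ _ (fun=> 0)); last exact: ctends_cst.
  exists k.+1 => // n /= kn.
  case: k => [|k] in zk kn *; first by rewrite zk !mul0r.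
  rewrite /sine_prod (big_cat_nat (n := k)) //=; last exact: ltnW (ltnW _).
  rewrite (big_ltn (m := k)) ?(leq_trans _ kn) //.
  rewrite zk divff ?pnatr_eq0 // expr1n subrr; ring.
have h1 : ctends \oo (fun n => (1 + (1 - z) / n%:R)^-1) (1 + 0)^-1.
  apply: ctendsV; first by rewrite addr0 oner_neq0.
  by apply: ctendsD; [exact: ctends_cst|exact: ctends_inv_nat].
have h2 : ctends \oo (fun n => rgam_seq n z * rgam_seq n (1 - z) *
    (1 + (1 - z) / n%:R)^-1) (rgam z * rgam (1 - z) * (1 + 0)^-1).
  exact: (ctendsM (ctendsM (ctends_rgam z) (ctends_rgam (1 - z))) h1).
rewrite addr0 invr1 mulr1 in h2.
apply: ctends_near h2; exists 1%N => // n /= n0.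
rewrite rgam_seq_reflect // mulfK //.
have q0 : n%:R != 0 :> R[i] by rewrite pnatr_eq0 -lt0n.
have -> : 1 + (1 - z) / n%:R = (n.+1%:R - z) / n%:R by rewrite -natr1; field.
rewrite mulf_neq0 ?invr_eq0 // subr_eq0 eq_sym; apply/eqP => zn.
by apply: z1; exists n.+1.
Qed.
Arguments ctends_sine_prod : clear implicits.

(** Near [l] the arguments have modulus at most |l| + 1, so a single constant dominates all
    factors. *)
Lemma ctends_rgam_comp {T} {F : set_system T} {FF : Filter F} (f : T -> R[i]) l :
  ctends F f l -> ctends F (fun t => rgam (f t)) (rgam l).
Proof.
move=> fl; rewrite /rgam.
apply: ctendsM.
  exact: (ctendsM fl (ctendsD (ctends_cst 1) fl)).
have r0 : 0 <= normc l + 1 by rewrite addr_ge0 // normc_ge0.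
apply: (@cprod_cont _ _ _ _ (fun t => gam_factor (f t)) (gam_factor l)
   (gam_const (normc l + 1))).
- exact: gam_const_ge0.
- have /ctends_eps /(_ 1 ltr01) := fl; apply: filterS => t ht k.
  apply: gam_factor_bound.
  have -> : f t = l + (f t - l) by ring.
  by rewrite (le_trans (le_normcD _ _)) // lerD2l.
- by move=> k; apply: gam_factor_bound; rewrite lerDl.
- by move=> t; exact: ctends_rgam_prod.
- exact: ctends_rgam_prod.
move=> k; apply: ctendsB; last exact: ctends_cst.
apply: ctendsM.
  apply: ctendsD; first exact: ctends_cst.
  exact: (ctendsM fl (ctends_cst _)).
exact: (ctends_cexp (ctendsN (ctendsM fl (ctends_cst _)))).
Qed.

End ReciprocalGamma.
Arguments ctends_rgam_prod {R} z.
Arguments ctends_rgam {R} z.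
Arguments ctends_inv_nat {R} z.
Arguments ctends_sine_prod {R} z.

(** * Euler's sine product and the addition law of S *)

Section SineProduct.
Context {R : realType}.
Implicit Types (z w : R[i]).

Definition exp_approx (n : nat) z : R[i] := (1 + 'i%C * z / n%:R) ^+ n.

Lemma cexp_natM n z : cexp (z *+ n) = cexp z ^+ n.
Proof.
elim: n => [|n IH]; first by rewrite mulr0n expr0 cexp0.
by rewrite mulrS exprS cexpD IH.
Qed.

Lemma sin_natMpi k : sin (pi *+ k) = 0 :> R.
Proof.
elim: k => [|k IH]; first by rewrite mulr0n sin0.
by rewrite mulrSr sinDpi IH oppr0.
Qed.

(** 1 + i tan y = exp (i y) / cos y and 1 - i tan y = exp (- i y) / cos y, and exp (i n y) = exp (-
    i n y) when n y is a multiple of pi. *)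
Lemma tan_root (n k : nat) (y : R) : (0 < n)%N -> y *+ n = pi *+ k -> cos y != 0 ->
  (1 + 'i%C * (tan y)%:C) ^+ n = (1 - 'i%C * (tan y)%:C) ^+ n :> R[i].
Proof.
move=> n0 yn cy.
have cy' : (cos y)%:C != 0 :> R[i] by rewrite eq_complex /= eqxx andbT.
(* The sign [s] treats the two linear factors together. *)
have aux (s : R) : s ^+ 2 = 1 -> 1 + 'i%C * (tan (s * y))%:C = cexp (0 +i* (s * y)) / (cos y)%:C.
  move=> s2; apply: (mulIf cy'); rewrite divfK // cexpE expR0 !mul1r.
  have ce : cos (s * y) = cos y.
    have : (s - 1) * (s + 1) = 0 by rewrite -subr_sqr s2 expr1n subrr.
    by move/eqP; rewrite mulf_eq0 subr_eq0 addr_eq0 => /orP[] /eqP ->; rewrite ?mul1r ?mulN1r ?cosN.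
  rewrite /tan ce; apply/eqP; rewrite eq_complex /=; apply/andP; split; apply/eqP; first by ring.
  by field.
have := aux 1; rewrite expr1n mul1r => -> //.
have := aux (-1); rewrite sqrrN expr1n mulN1r tanN => /(_ erefl).
rewrite rmorphN mulrN => ->.
rewrite !expr_div_n; congr (_ / _).
rewrite -!cexp_natM.
have h (t : R) : (0 +i* t) *+ n = 0 +i* (t *+ n) :> R[i].
  elim: n {n0 yn} => [|n IH]; first by rewrite !mulr0n.
  by rewrite !mulrS IH; apply/eqP; rewrite eq_complex /= addr0 !eqxx.
rewrite !h mulNrn yn !cexpE cosN sinN sin_natMpi oppr0 //.
Qed.

(** For odd n = 2 m + 1 the numbers 0 and +- tan (pi j / n), 1 <= j <= m, are n distinct roots, as
    many as the degree allows. The constant is read off from the derivative at 0. *)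
Lemma exp_approx_factor (m : nat) (x : R[i]) : let n := m.*2.+1 in
  (1 + 'i%C * x) ^+ n - (1 - 'i%C * x) ^+ n =
  2 * 'i%C * n%:R * x *
  \prod_(0 <= k < m) (1 + - (x / (tan (pi *+ k.+1 / n%:R))%:C) ^+ 2).
Proof.
move=> n.
pose y k : R := pi *+ k.+1 / n%:R.
pose t k : R[i] := (tan (y k))%:C.
have n0 : (0 : R) < n%:R by rewrite ltr0n.
have yn k : y k *+ n = pi *+ k.+1 by rewrite /y -[LHS]mulr_natr divfK // gt_eqF.
have ybd k : (k < m)%N -> 0 < y k < pi / 2.
  move=> km; apply/andP; split.
    by apply: divr_gt0 => //; rewrite pmulrn_lgt0 // pi_gt0.
  rewrite /y ltr_pdivrMr // -[ltLHS]mulr_natr -[pi / 2 * _]mulrA ltr_pM2l ?pi_gt0 // mulrC.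
  by rewrite ltr_pdivlMr // -natrM ltr_nat /n; lia.

have tpos k : (k < m)%N -> 0 < tan (y k).
  move=> /ybd/andP[h1 h2]; rewrite /tan divr_gt0 //.
    by apply: sin_gt0_pihalf; rewrite h1.
  by apply: cos_gt0_pihalf; rewrite h2 (lt_trans _ h1) // oppr_lt0 divr_gt0 ?pi_gt0.
have tn0 k : (k < m)%N -> t k != 0.
  by move=> /tpos h; rewrite /t eq_complex /= eqxx andbT gt_eqF.
pose l1 : {poly R[i]} := 1 + 'i%C *: 'X.
pose l2 : {poly R[i]} := 1 - 'i%C *: 'X.
pose p := l1 ^+ n - l2 ^+ n.
have pE u : p.[u] = (1 + 'i%C * u) ^+ n - (1 - 'i%C * u) ^+ n.
  by rewrite /p /l1 /l2 !hornerE.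
have s1 : (size l1 <= 2)%N.
  by rewrite (leq_trans (size_polyD _ _)) // size_poly1 geq_max (leq_trans (size_scale_leq _ _)) // size_polyX.
have s2 : (size l2 <= 2)%N.
  rewrite (leq_trans (size_polyD _ _)) // size_poly1 geq_max size_polyN.
  by rewrite (leq_trans (size_scale_leq _ _)) // size_polyX.
have sp : (size p <= n.+1)%N.
  have aux (l : {poly R[i]}) : (size l <= 2)%N -> (size (l ^+ n) <= n.+1)%N.
    move=> sl; rewrite (leq_trans (size_poly_exp_leq _ _)) // ltnS.
    by rewrite -[leqRHS]mul1n leq_mul2r; apply/orP; right; lia.
  by rewrite (leq_trans (size_polyD _ _)) // size_polyN geq_max !aux.
have dp : (p^`()).[0] = 2 * 'i%C * n%:R.
  have d1 : (l1^`()).[0] = 'i%C by rewrite /l1 derivD derivZ derivX -[1]/(1%:P) derivC !hornerE.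
  have d2 : (l2^`()).[0] = - 'i%C by rewrite /l2 derivB derivZ derivX -[1]/(1%:P) derivC !hornerE.
  have e1 : l1.[0] = 1 by rewrite /l1 hornerD hornerZ hornerX hornerC mulr0 addr0.
  have e2 : l2.[0] = 1 by rewrite /l2 hornerD hornerN hornerZ hornerX hornerC mulr0 subr0.
  rewrite /p derivB !deriv_exp hornerD hornerN !hornerMn !hornerM !horner_exp d1 d2 e1 e2 !expr1n.
  rewrite !mulr1 mulNrn opprK -(mulr_natr 'i%C n); move: (n%:R : R[i]) => q; ring.
have i0 : 'i%C != 0 :> R[i] by rewrite eq_complex /= oner_eq0 andbF.
have dp0 : 2 * 'i%C * n%:R != 0 :> R[i] by rewrite !mulf_neq0 ?pnatr_eq0.
have p0 : p != 0.
  by apply/eqP => h; move: dp0; rewrite -dp h deriv0 horner0 eqxx.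
pose rs := 0 :: (map t (iota 0 m) ++ map (fun k => - t k) (iota 0 m)).
have srs : size rs = n by rewrite /rs /= size_cat !size_map !size_iota addnn.
have tinj : {in iota 0 m &, injective t}.
  move=> j k; rewrite !mem_iota !add0n /= => jm km /complexI.
  have in_itv_y i : (i < m)%N -> y i \in `](- (pi / 2)), (pi / 2)[.
    move=> /ybd/andP[h1 h2]; rewrite in_itv /= h2 andbT (lt_trans _ h1) //.
    by rewrite oppr_lt0 divr_gt0 ?pi_gt0.
  move=> /tan_inj -/(_ (in_itv_y _ jm) (in_itv_y _ km)) /(congr1 (fun u => u *+ n)).
  rewrite !yn -!(mulr_natr pi) => /(mulfI (lt0r_neq0 (pi_gt0 R))) /eqP.
  by rewrite eqr_nat => /eqP [].
have urs : uniq rs.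
  rewrite /= mem_cat negb_or cat_uniq !map_inj_in_uniq ?iota_uniq //=; last first.
    by move=> j k hj hk /oppr_inj; exact: tinj.
  rewrite ?andbT; apply/andP; split; [apply/andP; split|].
  - apply/negP => /mapP[k]; rewrite mem_iota /= => /tn0 h /esym/eqP; apply/negP.
    exact: h.
  - apply/negP => /mapP[k]; rewrite mem_iota /= => /tn0 h /esym/eqP; apply/negP.
    by rewrite oppr_eq0; exact: h.
  - apply/hasPn => u /mapP[k]; rewrite mem_iota /= => km ->; apply/negP => /mapP[j].
  rewrite mem_iota /= => jm /eqP; rewrite eq_sym -subr_eq0 opprK => /eqP.
  move=> /(congr1 (@complex.Re R)) /=; have := tpos _ km; have := tpos _ jm; lra.
have proot k : (k < m)%N -> (1 + 'i%C * t k) ^+ n = (1 - 'i%C * t k) ^+ n.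
  move=> km; apply: (@tan_root _ k.+1) => //.
  have /andP[h1 h2] := ybd _ km; apply: lt0r_neq0; apply: cos_gt0_pihalf.
  by rewrite h2 (lt_trans _ h1) // oppr_lt0 divr_gt0 ?pi_gt0.
have ars : all (root p) rs.
  rewrite /rs /= all_cat; apply/and3P; split.
  - by rewrite /root pE !mulr0 addr0 subr0 subrr.
  - apply/allP => u /mapP[k]; rewrite mem_iota /= => km ->.
    by rewrite /root pE proot // subrr.
  - apply/allP => u /mapP[k]; rewrite mem_iota /= => km ->.
    by rewrite /root pE mulrN opprK proot // subrr.
(* The coefficient bound gives size at most n + 1; n distinct roots of a nonzero polynomial force
   equality. *)
have sp' : size p = (size rs).+1.
  apply/eqP; rewrite eqn_leq srs sp /= -srs.
  exact: max_poly_roots.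
have := all_roots_prod_XsubC sp' ars; rewrite uniq_rootsE => /(_ urs).
rewrite /rs big_cons big_cat /= !big_map subr0.
set c := lead_coef p => pfac.
have pu u : p.[u] = c * u * \prod_(0 <= k < m) ((- (t k ^+ 2)) * (1 + - (u / t k) ^+ 2)).
  rewrite pfac hornerZ hornerM hornerX -mulrA; congr (_ * (_ * _)).
  rewrite hornerM !horner_prod -big_split /= /index_iota subn0.
  rewrite !big_seq; apply: eq_bigr => k; rewrite mem_iota /= => km.
  rewrite !hornerE; have := tn0 _ km; move: (t k) => q q0; by field.
(* Differentiating the factorization at its root 0 leaves the product of the other factors evaluated
   at 0. *)
have cE : c * \prod_(0 <= k < m) (- (t k ^+ 2)) = 2 * 'i%C * n%:R.
  rewrite -dp pfac derivZ hornerZ; congr (_ * _).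
  rewrite derivM derivX mul1r hornerD !hornerM hornerX mul0r addr0.
  rewrite !horner_prod -big_split /= /index_iota subn0.
  by apply: eq_bigr => k _; rewrite !hornerE; ring.
rewrite -pE pu big_split /= -cE; ring.
Qed.

Lemma tan_ge_id (y : R) : 0 < y < pi / 2 -> y * cos y <= sin y.
Proof.
move=> /andP[y0 y1]; rewrite -subr_ge0.
have := @le_of_derive_ge0 _ (fun t => sin t - t * cos t) (fun t => t * sin t) y (ltW y0).
rewrite sin0 mul0r subrr; apply => [u|u /andP[u0 uy]].
  by apply: is_derive_eq; rewrite /GRing.scale /=; ring.
rewrite mulr_ge0 ?ltW //; apply: sin_gt0_pihalf; rewrite u0 /=; lra.
Qed.

(** The upper bound dominates the finite products by Euler's product; the lower one squeezes y / tan
    y to 1 as y tends to 0. *)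
Lemma id_over_tan (y : R) : 0 < y < pi / 2 -> 1 - y ^+ 2 / 2 <= y / tan y <= 1.
Proof.
move=> yb; have /andP[y0 y1] := yb.
have s0 := sin_gt0_pihalf yb.
have c0 : 0 < cos y.
  by apply: cos_gt0_pihalf; rewrite y1 (lt_trans _ y0) // oppr_lt0 divr_gt0 ?pi_gt0.
have -> : y / tan y = y * cos y / sin y by rewrite /tan invf_div mulrA.
rewrite ler_pdivrMr // mul1r tan_ge_id // andbT ler_pdivlMr //.
apply: le_trans (_ : cos y * sin y <= _).
  by rewrite ler_pM2r // cos_ge.
by rewrite mulrC ler_pM2r // sin_le_id // ltW.
Qed.

Lemma ctends_exp_approx w : ctends \oo (fun m =>
  (exp_approx m.*2.+1 (pi%:C * w) - exp_approx m.*2.+1 (- (pi%:C * w))) /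
    (2 * 'i%C * pi%:C)) (sinpi_over_pi w).
Proof.
pose y m k : R := pi *+ k.+1 / m.*2.+1%:R.
(* This is -(x / tan y)^2 of [exp_approx_factor] at x = pi w / n, rewritten with y = pi (k + 1) / n
   to show its limit. *)
pose a m k : R[i] := - ((w / k.+1%:R) * (y m k / tan (y m k))%:C) ^+ 2.
pose a0 k : R[i] := - (w / k.+1%:R) ^+ 2.
(* The 2 accounts for 1 / (k + 1)^2 <= 2 / ((k + 1) (k + 2)). *)
pose K : R := 2 * normc w ^+ 2.
have K0 : 0 <= K by rewrite mulr_ge0 // sqr_ge0.
have ybd m k : (k < m)%N -> 0 < y m k < pi / 2.
  move=> km; apply/andP; split.
    by apply: divr_gt0; [rewrite pmulrn_lgt0 // pi_gt0|rewrite ltr0n].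
  rewrite /y ltr_pdivrMr ?ltr0n // -[ltLHS]mulr_natr -[pi / 2 * _]mulrA ltr_pM2l ?pi_gt0 // mulrC.
  by rewrite ltr_pdivlMr // -natrM ltr_nat; lia.
have Ha0 k : normc (a0 k) <= quad_bound K k.
  rewrite /a0 normcN normcX normcM normcV normc_nat /quad_bound /K exprMn.
  have -> (N c : R) : 2 * N / c = N * (2 / c) by ring.
  rewrite ler_wpM2l ?sqr_ge0 //.
  have p0 : 1 <= k.+1%:R :> R by rewrite ler1n.
  have -> : k.+2%:R = k.+1%:R + 1 :> R by rewrite -natr1.
  move: (k.+1%:R : R) p0 => p p1.
  have -> : p^-1 ^+ 2 = 1 / (p * p) by field; lra.
  rewrite ler_pdivrMr ?mulr_gt0 //; try lra.
  have -> : 2 / (p * (p + 1)) * (p * p) = 2 * p / (p + 1) by field; apply/andP; split; lra.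
  rewrite ler_pdivlMr; lra.
have Ha m k : (k < m)%N -> normc (a m k) <= quad_bound K k.
  move=> km; apply: le_trans (Ha0 k).
  rewrite /a /a0 !normcN !normcX normcM ler_pXn2r ?nnegrE ?mulr_ge0 ?normc_ge0 //.
  rewrite ler_piMr ?normc_ge0 // normcC.
  have /andP[h1 h2] := ybd _ _ km.
  have /andP[h3 h4] := id_over_tan (ybd _ _ km).
  rewrite ger0_norm // divr_ge0 ?ltW // /tan divr_gt0 //.
    by apply: sin_gt0_pihalf; rewrite h1.
  by apply: cos_gt0_pihalf; rewrite h2 (lt_trans _ h1) // oppr_lt0 divr_gt0 ?pi_gt0.
have [p Hp] := cprod_ex K0 Ha0.
have Sp : sinpi_over_pi w = w * p.
  apply: (ctends_unique (ctends_sine_prod w)).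
  exact: (ctendsM (ctends_cst w) Hp).
have y_lim k : (fun m => y m k) @ \oo --> (0 : R).
  rewrite -[0 : R](mulr0 (pi *+ k.+1)); apply: cvgM; first exact: cvg_cst.
  apply/cvgrPdist_le => e e0.
  have /cvgrPdist_le /(_ _ e0) [N _ HN] := @cvg_harmonic R.
  exists N => // m /= Nm; have := HN m Nm; apply: le_trans.
  rewrite !sub0r !normrN !ger0_norm ?invr_ge0 // lef_pV2 ?posrE ?ltr0n // ler_nat; lia.
have Haa k : ctends \oo (a^~ k) (a0 k).
  rewrite /a /a0; apply: ctendsN.
  have h : ctends \oo (fun m => w / k.+1%:R * (y m k / tan (y m k))%:C) (w / k.+1%:R * 1).
    apply: ctendsM; first exact: ctends_cst.
    apply: ctends_reim => /=; last exact: cvg_cst.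
    apply: (@squeeze_cvgr _ _ _ _ (fun m => 1 - (y m k) ^+ 2 / 2) (fun=> 1)).
    - exists k.+1 => // m /= km; exact: (id_over_tan (ybd _ _ km)).
    - have h0 : (fun m => 1 - y m k * y m k * 2^-1) @ \oo --> (1 - 0 * 0 * 2^-1 : R).
        exact: (cvgB (cvg_cst _) (cvgM (cvgM (y_lim k) (y_lim k)) (cvg_cst _))).
      rewrite !mul0r subr0 in h0; exact: h0.
    - exact: cvg_cst.
  rewrite mulr1 in h; exact: (ctendsM h h).
have := tannery K0 Ha Ha0 Hp Haa => HT.
rewrite Sp.
apply: ctends_ext (ctendsM (ctends_cst w) HT) => m.
set n := m.*2.+1.
have i0 : 'i%C != 0 :> R[i] by rewrite eq_complex /= oner_eq0 andbF.
have pi0 : pi%:C != 0 :> R[i] by rewrite eq_complex /= eqxx andbT lt0r_neq0 // pi_gt0.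
have n0 : n%:R != 0 :> R[i] by rewrite pnatr_eq0.
have -> : exp_approx n (pi%:C * w) - exp_approx n (- (pi%:C * w)) =
   (1 + 'i%C * (pi%:C * w / n%:R)) ^+ n - (1 - 'i%C * (pi%:C * w / n%:R)) ^+ n.
  by rewrite /exp_approx mulrN mulNr !mulrA.
rewrite exp_approx_factor.
have -> : \prod_(0 <= k < m) (1 + - (pi%:C * w / n%:R / (tan (pi *+ k.+1 / n%:R))%:C) ^+ 2)
   = \prod_(0 <= k < m) (1 + a m k).
  rewrite /index_iota subn0 !big_seq; apply: eq_bigr => k; rewrite mem_iota /= => km.
  rewrite /a -[pi *+ k.+1 / n%:R]/(y m k); move: (tan (y m k)) => T.
  congr (1 + - _ ^+ 2); rewrite /y -/n -(mulr_natr pi k.+1) !rmorphM /= !fmorphV /= !rmorph_nat.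
  have k0 : k.+1%:R != 0 :> R[i] by rewrite pnatr_eq0.
  move: (T%:C^-1) => u.
  move: k0 n0; move: (k.+1%:R : R[i]) (n%:R : R[i]) => q r q0 r0.
  by field; rewrite ?q0 ?r0.
rewrite -/n; move: (\prod_(_ <= _ < _) _) => P.
move: n0 i0 pi0; move: (n%:R : R[i]) ('i%C : R[i]) (pi%:C : R[i]) => r j c r0 j0 c0.
by field; rewrite ?r0 ?j0 ?c0.
Qed.

Arguments ctends_exp_approx : clear implicits.

Lemma normc_subX (a b : R[i]) (M : R) n : 1 <= M -> normc a <= M -> normc b <= M ->
  normc (a ^+ n - b ^+ n) <= n%:R * normc (a - b) * M ^+ n.
Proof.
move=> M1 aM bM; have d0 := normc_ge0 (a - b).
elim: n => [|n IH]; first by rewrite !expr0 subrr normc0 !mul0r.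
have -> : a ^+ n.+1 - b ^+ n.+1 = a * (a ^+ n - b ^+ n) + (a - b) * b ^+ n.
  by rewrite !exprS; ring.
apply: le_trans (le_normcD _ _) _; rewrite !normcM normcX.
have Mn0 : 0 <= M ^+ n by rewrite exprn_ge0 // (le_trans _ M1).
have h1 : normc a * normc (a ^+ n - b ^+ n) <= M * (n%:R * normc (a - b) * M ^+ n).
  by rewrite ler_pM ?normc_ge0.
have h2 : normc (a - b) * normc b ^+ n <= normc (a - b) * M ^+ n.
  by rewrite ler_wpM2l // lerXn2r ?nnegrE ?normc_ge0 // (le_trans _ M1).
have h3 : normc (a - b) * M ^+ n <= normc (a - b) * M ^+ n.+1.
  by rewrite ler_wpM2l // exprS ler_peMl.
rewrite -natr1 exprS in h3 *; lra.
Qed.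

(** The bases (1 + i u / n) (1 + i v / n) and 1 + i (u + v) / n differ by -u v / n^2; raising to the
    power n costs a factor n and a bounded exponential, so the error is O(1 / n). *)
Lemma exp_approx_mul u v :
  ctends \oo (fun m => exp_approx m.*2.+1 u * exp_approx m.*2.+1 v -
    exp_approx m.*2.+1 (u + v)) 0.
Proof.
pose c := normc u + normc v.
have c0 : 0 <= c by rewrite addr_ge0 ?normc_ge0.
pose K := normc u * normc v * expR c.
have K0 : 0 <= K by rewrite !mulr_ge0 ?normc_ge0 ?expR_ge0.
apply/ctends_eps => e e0.
have eK0 : 0 < e / (K + 1) by apply: divr_gt0 => //; lra.
have /cvgrPdist_le /(_ _ eK0) [N _ HN] := @cvg_harmonic R.
exists N => // m /= Nm; rewrite subr0 /exp_approx -exprMn.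
set n := m.*2.+1.
have n0 : 0 < n%:R :> R by rewrite ltr0n.
have n0' : n%:R != 0 :> R[i] by rewrite pnatr_eq0.
have i1 : normc ('i%C : R[i]) = 1 by rewrite /normc /= expr0n expr1n add0r sqrtr1.
have bd (z : R[i]) : normc (1 + 'i%C * z / n%:R) <= expR (normc z / n%:R).
  apply: le_trans (le_normcD _ _) _.
  rewrite normc1 !normcM normcV normc_nat i1 mul1r.
  exact: expR_ge1Dx.
have M1 : 1 <= expR (c / n%:R).
  by rewrite (le_trans _ (expR_ge1Dx _)) // lerDl divr_ge0 // ltW.
apply: le_trans (normc_subX (M := expR (c / n%:R)) _ M1 _ _) _.
- rewrite normcM /c mulrDl expRD ler_pM ?normc_ge0 //; exact: bd.
- apply: le_trans (bd _) _; rewrite ler_expR ler_pM2r ?invr_gt0 //; exact: le_normcD.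
have -> : (1 + 'i%C * u / n%:R) * (1 + 'i%C * v / n%:R) - (1 + 'i%C * (u + v) / n%:R) =
   'i%C * 'i%C * u * v / n%:R ^+ 2.
  by move: n0'; move: (n%:R : R[i]) => q q0; field.
rewrite -expRM_natr divfK ?gt_eqF // !normcM normcV normcX normc_nat i1 !mul1r.
have -> : n%:R * (normc u * normc v / n%:R ^+ 2) * expR c = K * n%:R^-1.
  by rewrite /K; move: n0; move: (n%:R : R) => q q0; field; lra.
apply: le_trans (_ : K * (e / (K + 1)) <= _); last first.
  rewrite mulrA ler_pdivrMr; last by lra.
  by rewrite mulrC ler_wpM2l ?ltW //; lra.
rewrite ler_wpM2l //.
have := HN m Nm; rewrite sub0r normrN ger0_norm ?invr_ge0 //.
apply: le_trans; rewrite lef_pV2 ?posrE ?ltr0n // ler_nat /n; lia.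
Qed.

Arguments exp_approx_mul : clear implicits.

(** By the product-to-sum formula each product is a difference of even functions at the sum and at
    the difference of its arguments. Up to sign only a + b - 2 z, a - b and a + b occur, each twice
    and with opposite signs. *)
Lemma sinpi_three_term (a b z : R[i]) :
  sinpi_over_pi (a - z) * sinpi_over_pi (b - z) - sinpi_over_pi a * sinpi_over_pi b
  + sinpi_over_pi (a + b - z) * sinpi_over_pi z = 0.
Proof.
pose e m w := exp_approx m.*2.+1 (pi%:C * w).
pose k : R[i] := 2 * 'i%C * pi%:C.
pose T m w := (e m w - e m (- w)) / k.
have HT w : ctends \oo (T^~ w) (sinpi_over_pi w).
  apply: ctends_ext (ctends_exp_approx w) => m.
  by rewrite /T /e mulrN.
have He u v : ctends \oo (fun m => e m u * e m v - e m (u + v)) 0.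
  apply: ctends_ext (exp_approx_mul (pi%:C * u) (pi%:C * v)) => m.
  by rewrite /e mulrDr.
(* The defect of the product-to-sum formula at stage [m], which vanishes in the limit. *)
pose d m A B := T m A * T m B - (e m (A + B) - e m (A - B) - e m (- A + B) + e m (- A - B)) / k ^+ 2.
have Hd A B : ctends \oo (fun m => d m A B) 0.
  have h : ctends \oo (fun m =>
     ((e m A * e m B - e m (A + B)) - (e m A * e m (- B) - e m (A - B)) -
     (e m (- A) * e m B - e m (- A + B)) + (e m (- A) * e m (- B) - e m (- A - B))) * (k ^+ 2)^-1)
     ((0 - 0 - 0 + 0) * (k ^+ 2)^-1).
    apply: ctendsM; last exact: ctends_cst.
    apply: ctendsD; last exact: He.
    apply: ctendsB; last exact: He.
    apply: ctendsB; exact: He.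
  rewrite !subr0 addr0 mul0r in h.
  apply: ctends_ext h => m; rewrite /d /T -!exprVn; move: (k^-1) => ki; ring.
have h : ctends \oo (fun m => d m (a - z) (b - z) - d m a b + d m (a + b - z) z) (0 - 0 + 0).
  by apply: ctendsD; [apply: ctendsB; exact: Hd|exact: Hd].
rewrite subr0 addr0 in h.
apply: (ctends_unique _ h).
have h2 : ctends \oo (fun m => T m (a - z) * T m (b - z) - T m a * T m b
   + T m (a + b - z) * T m z) (sinpi_over_pi (a - z) * sinpi_over_pi (b - z) -
    sinpi_over_pi a * sinpi_over_pi b + sinpi_over_pi (a + b - z) * sinpi_over_pi z).
  by apply: ctendsD; [apply: ctendsB; apply: ctendsM; exact: HT|apply: ctendsM; exact: HT].
apply: ctends_ext h2 => m; rewrite /d.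
have -> : (a - z) + (b - z) = (a + b - z) - z by ring.
have -> : (a - z) - (b - z) = a - b by ring.
have -> : - (a - z) + (b - z) = - a + b by ring.
have -> : - (a - z) - (b - z) = - (a + b - z) + z by ring.
have -> : a + b - z + z = a + b by ring.
have -> : - (a + b - z) - z = - a - b by ring.
ring.
Qed.

End SineProduct.

Lemma rgam_iter (R : realType) n (z : R[i]) : rgam z = (\prod_(k < n) (z + k%:R)) * rgam (z + n%:R).
Proof.
elim: n => [|n IH]; first by rewrite big_ord0 mul1r addr0.
by rewrite IH (rgamS (z + n%:R)) mulrA big_ord_recr /= -(natr1 n) (addrA z).
Qed.

(** * The Weyl function on the real axis *)

Section WeylLimits.
Context {R : realType}.
Variables al be : R.
Hypotheses (al0 : 0 < al) (al1 : al < 1) (be0 : 0 < be) (be1 : be < 1).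
Implicit Types z : R[i].

Lemma rgam_gt0_neq0 (x : R) : 0 < x -> rgam x%:C != 0.
Proof.
move=> x0; apply: rgam_neq0 => k; apply/eqP.
rewrite -(rmorph_nat (real_complex R)) -rmorphN => /complexI xk.
by have : 0 <= k%:R :> R by []; lra.
Qed.

Let s : R[i] := al%:C + be%:C.
Let sp (x : R) : R[i] := sinpi_over_pi x%:C.
Let kap1 : R[i] := - Gamma (al + 1)%:C * Gamma (- be)%:C.
Let kap2 : R[i] := (be * 2 `^ (al + be + 1))%:C * Gamma (al + 1)%:C * Gamma be%:C.
Let kap4 : R[i] := be%:C * Gamma (1 - al)%:C * Gamma be%:C / al%:C.

Lemma c1E z : c1 al be z = kap1 * (rgam (- z + al%:C) * rgam (z - be%:C + 1)).
Proof. by rewrite /c1 /kap1 !rgamE -invfM. Qed.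

Lemma c2E z : c2 al be z = kap2 * (rgam (z + 1) * rgam (- z + al%:C + be%:C)).
Proof. by rewrite /c2 /kap2 !rgamE -invfM. Qed.

Lemma c4E z : c4 al be z = kap4 * (rgam (z - al%:C + 1) * rgam (- z + be%:C)).
Proof. by rewrite /c4 /kap4 !rgamE !invfM; ring. Qed.

Lemma sp_neq0 (x : R) : 0 < x < 1 -> sp x != 0.
Proof.
move=> /andP[x0 x1]; rewrite /sp /sinpi_over_pi mulf_neq0 ?rgam_gt0_neq0 //.
have -> : 1 - x%:C = (1 - x)%:C by rewrite rmorphB.
by rewrite rgam_gt0_neq0 // subr_gt0.
Qed.

(** The normalization that makes c1 c4 equal to S(alpha - z) S(beta - z) / (S(alpha) S(beta)). After
    Gamma(x + 1) = x Gamma(x) at x = alpha and x = -beta all Gamma values cancel. *)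
Lemma kap14 : kap1 * kap4 * (sp al * sp be) = 1.
Proof.
rewrite /kap1 /kap4 /sp /sinpi_over_pi !GammaE.
have e1 : rgam al%:C = al%:C * rgam (al + 1)%:C by rewrite rgamS rmorphD.
have e2 : rgam (- be)%:C = - be%:C * rgam (1 - be%:C).
  by rewrite rgamS rmorphN; congr (_ * rgam _); ring.
have n1 : rgam (al + 1)%:C != 0 by rewrite rgam_gt0_neq0 // addr_gt0.
have n2 : rgam (1 - be%:C) != 0.
  by have -> : 1 - be%:C = (1 - be)%:C by [rewrite rmorphB]; rewrite rgam_gt0_neq0 // subr_gt0.
have n3 : rgam (1 - al)%:C != 0 by rewrite rgam_gt0_neq0 // subr_gt0.
have n4 : rgam be%:C != 0 by rewrite rgam_gt0_neq0.
have n5 : al%:C != 0 by rewrite eq_complex /= eqxx andbT gt_eqF.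
have n6 : be%:C != 0 by rewrite eq_complex /= eqxx andbT gt_eqF.
have -> : 1 - al%:C = (1 - al)%:C by rewrite rmorphB.
rewrite e2 e1.
move: n1 n2 n3 n4 n5 n6; move: (rgam (al + 1)%:C) (rgam (1 - be%:C)) (rgam (1 - al)%:C)
  (rgam be%:C) (al%:C) (be%:C) => a b c d e f a0 b0 c0 d0 e0 f0.
by field; rewrite ?a0 ?b0 ?c0 ?d0 ?e0 ?f0.
Qed.

(** The denominator of [M0] in the z-plane, as an entire function. *)
Definition weyl_den z : R[i] := rgam (- z) * rgam (z + 1 - s).

Let kap : R[i] := kap2 * (sp al * sp be).

Lemma kap_neq0 : kap != 0.
Proof.
have h1 : sp al != 0 by apply: sp_neq0; rewrite al0.
have h2 : sp be != 0 by apply: sp_neq0; rewrite be0.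
have h3 : (be * 2 `^ (al + be + 1))%:C != 0 :> R[i].
  by rewrite eq_complex /= eqxx andbT gt_eqF // mulr_gt0 // powR_gt0.
have h4 : rgam (al + 1)%:C != 0 by rewrite rgam_gt0_neq0 // addr_gt0.
have h5 : rgam be%:C != 0 by rewrite rgam_gt0_neq0.
have h4' : Gamma (al + 1)%:C != 0 by rewrite GammaE invr_eq0.
have h5' : Gamma be%:C != 0 by rewrite GammaE invr_eq0.
exact: (mulf_neq0 (mulf_neq0 (mulf_neq0 h3 h4') h5') (mulf_neq0 h1 h2)).
Qed.

(** The three-term identity turns S(alpha - z) S(beta - z) - S(alpha) S(beta) into -S(alpha + beta -
    z) S(z). Of the four reciprocal Gamma factors of the latter, two make up [c2] and two
    [weyl_den]. *)
Lemma c14E z : (c1 al be z * c4 al be z - 1) * kap = c2 al be z * weyl_den z.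
Proof.
have tt := sinpi_three_term al%:C be%:C z.
have S1 : sinpi_over_pi z = - (rgam (z + 1) * rgam (- z)).
  by rewrite /sinpi_over_pi (rgamS z) (rgamS (- z)) (addrC (- z)); ring.
have e : c1 al be z * c4 al be z * (sp al * sp be) =
    sinpi_over_pi (al%:C - z) * sinpi_over_pi (be%:C - z).
  rewrite c1E c4E /sinpi_over_pi.
  have -> : 1 - (al%:C - z) = z - al%:C + 1 by ring.
  have -> : 1 - (be%:C - z) = z - be%:C + 1 by ring.
  rewrite (addrC al%:C) (addrC be%:C).
  rewrite -[RHS]mul1r -kap14.
  move: (kap1) (kap4) (sp al) (sp be) => k1 k4 p q.
  by move: (rgam _) (rgam _) (rgam _) (rgam _) => *; ring.
have e3 : kap * (c1 al be z * c4 al be z - 1) =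
    kap2 * (sinpi_over_pi (al%:C - z) * sinpi_over_pi (be%:C - z) - sp al * sp be).
  by rewrite -e /kap; move: (c1 _ _ _) (c4 _ _ _) (kap2) (sp al) (sp be) => *; ring.
rewrite mulrC e3 c2E /weyl_den.
have -> : sinpi_over_pi (al%:C - z) * sinpi_over_pi (be%:C - z) - sp al * sp be
  = - (sinpi_over_pi (al%:C + be%:C - z) * sinpi_over_pi z).
  by apply/eqP; rewrite -subr_eq0 opprK; apply/eqP.
rewrite S1 /sinpi_over_pi.
have -> : 1 - (al%:C + be%:C - z) = z + 1 - s by rewrite /s; ring.
have -> : al%:C + be%:C - z = - z + al%:C + be%:C by ring.
ring.
Qed.

Lemma real_conj (x : R) : (x%:C)^* = x%:C :> R[i].
Proof. exact: conjc_real. Qed.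

Lemma rgam_real (x : R) : (rgam x%:C)^* = rgam x%:C.
Proof. by rewrite -rgam_conj real_conj. Qed.

Lemma Gamma_real (x : R) : (Gamma x%:C)^* = Gamma x%:C.
Proof. by rewrite GammaE fmorphV /= rgam_real. Qed.

Lemma mul_real (a b : R[i]) : a^* = a -> b^* = b -> (a * b)^* = a * b.
Proof. by move=> ha hb; rewrite rmorphM /= ha hb. Qed.

Lemma kap_real : kap^* = kap.
Proof.
have h x : (sp x)^* = sp x.
  rewrite /sp /sinpi_over_pi rmorphM /= rgam_real; congr (_ * _).
  by rewrite -rgam_conj rmorphB rmorph1 /= real_conj.
apply: (@mul_real kap2 (sp al * sp be)); last exact: (mul_real (h al) (h be)).
exact: (mul_real (mul_real (real_conj _) (Gamma_real _)) (Gamma_real _)).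
Qed.

Lemma kap1_real : kap1^* = kap1.
Proof. by apply: mul_real (Gamma_real _); rewrite rmorphN /= Gamma_real. Qed.

Lemma kap4_real : kap4^* = kap4.
Proof.
have h : (al%:C^-1)^* = al%:C^-1 by rewrite fmorphV /= real_conj.
exact: (mul_real (mul_real (mul_real (real_conj _) (Gamma_real _)) (Gamma_real _)) h).
Qed.

Lemma weyl_den_conj z : (weyl_den z)^* = weyl_den z^*.
Proof.
by rewrite /weyl_den /s rmorphM /= -!rgam_conj !rmorphB !rmorphD rmorph1 rmorphN /= !real_conj.
Qed.

Lemma c1_conj z : (c1 al be z)^* = c1 al be z^*.
Proof.
rewrite !c1E [LHS]rmorphM [X in _ * X]rmorphM /= kap1_real -!rgam_conj.
by rewrite !rmorphD !rmorphN rmorph1 /= !real_conj.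
Qed.

Lemma c4_conj z : (c4 al be z)^* = c4 al be z^*.
Proof.
rewrite !c4E [LHS]rmorphM [X in _ * X]rmorphM /= kap4_real -!rgam_conj.
by rewrite !rmorphD !rmorphN rmorph1 /= !real_conj.
Qed.

(** The deck transformation of [lam], exchanging the two points with the same value. *)
Let refl z := s - 1 - z.

Lemma weyl_den_refl z : weyl_den (refl z) = weyl_den z.
Proof.
rewrite /weyl_den /refl mulrC.
have -> : s - 1 - z + 1 - s = - z by ring.
by have -> : - (s - 1 - z) = z + 1 - s by ring.
Qed.

Lemma c1_refl z : c1 al be (refl z) = c1 al be z.
Proof.
rewrite !c1E /refl /s.
have -> : - (al%:C + be%:C - 1 - z) + al%:C = z - be%:C + 1 by ring.
have -> : al%:C + be%:C - 1 - z - be%:C + 1 = - z + al%:C by ring.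
by rewrite (mulrC (rgam (z - _ + _))).
Qed.

Lemma c4_refl z : c4 al be (refl z) = c4 al be z.
Proof.
rewrite !c4E /refl /s.
have -> : - (al%:C + be%:C - 1 - z) + be%:C = z - al%:C + 1 by ring.
have -> : al%:C + be%:C - 1 - z - al%:C + 1 = - z + be%:C by ring.
by rewrite (mulrC (rgam (- z + _))).
Qed.

Lemma lamB z w : lam al be z - lam al be w = (z - w) * (z + w + 1 - s).
Proof. by rewrite /lam /s; ring. Qed.

Lemma lam_refl z : lam al be (refl z) = lam al be z.
Proof. by apply/eqP; rewrite -subr_eq0 lamB /refl; apply/eqP; ring. Qed.

Lemma lam_conj z : (lam al be z)^* = lam al be z^*.
Proof. by rewrite /lam rmorphM !rmorphD !rmorphN rmorph1 /= !real_conj. Qed.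

Lemma real_of_conj z : z^* = z -> z = (re z)%:C.
Proof.
case: z => a b /eqP; rewrite eq_complex /= => /andP[_ /eqP bb].
by apply/eqP; rewrite eq_complex /= eqxx /=; apply/eqP; lra.
Qed.

(* A real value of lam is attained only at points z with z^* = z or
   z^* = al + be - 1 - z; functions invariant under both symmetries are real there. *)
Lemma real_at (h : R[i] -> R[i]) z (x : R) : lam al be z = x%:C ->
  (forall z, (h z)^* = h z^*) -> (forall z, h (refl z) = h z) ->
  (h z)^* = h z.
Proof.
move=> zx hc hr; rewrite hc.
have : (z^* - z) * (z^* + z + 1 - s) = 0.
  by rewrite -lamB -lam_conj zx real_conj subrr.
move/eqP; rewrite mulf_eq0 subr_eq0 => /orP[/eqP -> //|/eqP h0].
have -> : z^* = refl z by rewrite /refl; apply/eqP; rewrite -subr_eq0 -h0; apply/eqP; ring.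
by rewrite hr.
Qed.

(** Completing the square: lam z = (z - (s - 1) / 2)^2 - ((s + 1) / 2)^2. *)
Lemma lam_root (l : R[i]) : exists z, lam al be z = l.
Proof.
have [y hy] : exists y : R[i], y ^+ 2 = ((s + 1) / 2) ^+ 2 + l.
  by exists (sqrtc (((s + 1) / 2) ^+ 2 + l)); rewrite sqr_sqrtc.
exists (y + (s - 1) / 2).
have -> : lam al be (y + (s - 1) / 2) = y ^+ 2 - ((s + 1) / 2) ^+ 2.
  by rewrite /lam /s; field.
by rewrite hy addrC addKr.
Qed.

(** For a preimage w the product (w - z0) (refl w - z0) is lam z0 - lam w, of modulus e, so one of
    the two preimages lies within sqrt e of z0. The square root is the true rate at the branch
    point. *)
Lemma lam_root_near z0 (x e : R) : 0 < e -> lam al be z0 = x%:C ->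
  exists z, lam al be z = x +i* e /\ normc (z - z0) ^+ 2 <= e.
Proof.
move=> e0 z0x.
have [w hw] := lam_root (x +i* e).
have h : (w - z0) * (refl w - z0) = - (0 +i* e).
  have -> : (w - z0) * (refl w - z0) = - (lam al be w - lam al be z0).
    by rewrite lamB /refl; ring.
  by rewrite hw z0x; congr (- _); apply/eqP; rewrite eq_complex /= subrr subr0 !eqxx.
have {h} : normc (w - z0) * normc (refl w - z0) = e.
  by rewrite -normcM h normcN /normc /= expr0n add0r sqrtr_sqr gtr0_norm.
have n1 := normc_ge0 (w - z0); have n2 := normc_ge0 (refl w - z0).
have [ab|/ltW ab] := leP (normc (w - z0)) (normc (refl w - z0)) => h.
  exists w; split => //; rewrite -h expr2; exact: ler_wpM2l.
exists (refl w); split; first by rewrite lam_refl.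
by rewrite -h expr2; exact: ler_wpM2r.
Qed.

Variables (Minf : R[i] -> 'M[R[i]]_2) (hM : is_Minfty al be Minf).

Let cm z := mx22 (c1 al be z) 1 1 (c4 al be z).

Lemma mx22E (a b c d : R[i]) (i j : 'I_2) : mx22 a b c d i j =
  if i == 0 then (if j == 0 then a else b) else (if j == 0 then c else d).
Proof. by rewrite mxE. Qed.

Lemma lam_nonreal z (x : R) : im (lam al be z) != 0 -> z != x%:C.
Proof.
move=> h; apply/eqP => zx; move: h; rewrite zx.
suff -> : lam al be x%:C = ((- x - 1) * (- x + al + be))%:C by rewrite /= eqxx.
by rewrite /lam !(rmorphM, rmorphD, rmorphN, rmorphB, rmorph1).
Qed.

(** The determinant of [Minf] is (c1 c4 - 1) / c2^2, so -Minf^-1 is c2 / (c1 c4 - 1) times [cm], and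
    [c14E] cancels [c2]. A nonreal value of lam forces z to be nonreal, hence away from all zeros of
    the [rgam] factors. *)
Lemma M0E z : im (lam al be z) != 0 ->
  M0 Minf (lam al be z) = (kap / weyl_den z) *: cm z.
Proof.
move=> hz; rewrite /M0 (hM hz).
have nr x : z <> x%:C by exact/eqP/(lam_nonreal x hz).
have natC k : k%:R = (k%:R : R)%:C :> R[i] by rewrite rmorph_nat.
have r1 : rgam (z + 1) != 0.
  apply: rgam_neq0 => k; apply/eqP => h; apply: (nr (- k%:R - 1)).
  by rewrite rmorphB rmorphN rmorph_nat rmorph1 -h addrK.
have r2 : rgam (- z + al%:C + be%:C) != 0.
  apply: rgam_neq0 => k; apply/eqP => h; apply: (nr (k%:R + al + be)).
  by rewrite !rmorphD rmorph_nat /=; rewrite -[k%:R]opprK -h; ring.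
have r3 : rgam (- z) != 0.
  by apply: rgam_neq0 => k; rewrite eqr_opp natC; apply/eqP.
have r4 : rgam (z + 1 - s) != 0.
  apply: rgam_neq0 => k; apply/eqP => h; apply: (nr (- k%:R - 1 + al + be)).
  by rewrite !(rmorphD, rmorphN) rmorph_nat rmorph1 /= -h /s; ring.
have c20 : c2 al be z != 0.
  have k2 : kap2 != 0 by apply/eqP => h; move/eqP: kap_neq0; apply; rewrite /kap h mul0r.
  by rewrite c2E; exact: (mulf_neq0 k2 (mulf_neq0 r1 r2)).
have d0 : weyl_den z != 0 by exact: (mulf_neq0 r3 r4).
have k0 := kap_neq0.
have e := c14E z.
have det0 : c1 al be z * c4 al be z - 1 != 0.
  by apply/eqP => h; move: e; rewrite h mul0r => /esym/eqP; rewrite mulf_eq0 (negPf c20) (negPf d0).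
set A := _ *: mx22 _ _ _ _.
set B := (- (kap / weyl_den z)) *: cm z.
have AB : A *m B = 1%:M.
  rewrite /A /B -scalemxAl -scalemxAr scalerA.
  have -> : mx22 (- c4 al be z) 1 1 (- c1 al be z) *m cm z =
      (1 - c1 al be z * c4 al be z)%:M.
    apply/matrixP => i j; rewrite !mxE !big_ord_recl big_ord0 !mxE /=.
    by case: i => [[|[|//]] ?]; case: j => [[|[|//]] ?]; rewrite /= ?mulr1n ?mulr0n; ring.
  rewrite -scalemx1 scalerA -[RHS]scale1r; congr (_ *: _).
  have -> : 1 - c1 al be z * c4 al be z = - (c2 al be z * weyl_den z / kap).
    by rewrite -e; field.
  by move: c20 d0 k0; move: (c2 al be z) (weyl_den z) kap => a b c a0 b0 c0; field; rewrite ?a0 ?b0 ?c0.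
have uA : A \in unitmx by have [] := mulmx1_unit AB.
have -> : invmx A = B by rewrite -[LHS]mulmx1 -AB mulmxA mulVmx // mul1mx.
by rewrite /B scaleNr opprK.
Qed.

Lemma ctends_weyl {T} {F : set_system T} {FF : Filter F} (f : T -> R[i]) z0 :
  ctends F f z0 -> [/\ ctends F (weyl_den \o f) (weyl_den z0),
   ctends F (c1 al be \o f) (c1 al be z0) & ctends F (c4 al be \o f) (c4 al be z0)].
Proof.
move=> fz; pose proof (ctendsN fz) as fN.
pose proof (ctends_rgam_comp fN) as h1.
pose proof (ctends_rgam_comp (ctendsB (ctendsD fz (ctends_cst 1)) (ctends_cst s))) as h2.
pose proof (ctends_rgam_comp (ctendsD fN (ctends_cst al%:C))) as h3.
pose proof (ctends_rgam_comp (ctendsD (ctendsB fz (ctends_cst be%:C)) (ctends_cst 1))) as h4.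
pose proof (ctends_rgam_comp (ctendsD (ctendsB fz (ctends_cst al%:C)) (ctends_cst 1))) as h5.
pose proof (ctends_rgam_comp (ctendsD fN (ctends_cst be%:C))) as h6.
split; first exact: (ctendsM h1 h2).
  rewrite c1E; apply: (ctends_ext _ (ctendsM (ctends_cst kap1) (ctendsM h3 h4))) => t.
  by rewrite /= c1E.
rewrite c4E; apply: (ctends_ext _ (ctendsM (ctends_cst kap4) (ctendsM h5 h6))) => t.
by rewrite /= c4E.
Qed.

(** Lifts the vertical approach x + i e through [lam], so that boundary limits of [M0] become limits
    of entire functions at [z0]. *)
Lemma root_path z0 (x : R) : lam al be z0 = x%:C -> exists f : R -> R[i],
  (forall e, 0 < e -> lam al be (f e) = x +i* e) /\ ctends 0^'+ f z0.
Proof.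
move=> z0x.
have /choice [f Hf] : forall e : R, exists z, 0 < e ->
    lam al be z = x +i* e /\ normc (z - z0) ^+ 2 <= e.
  move=> e; have [e0|e0] := ltP 0 e; last by exists 0.
  by have [z hz] := lam_root_near e0 z0x; exists z.
exists f; split => [e /Hf []//|].
apply/ctends_eps => e e0; near=> t.
have t0 : 0 < t by [].
have [_ h] := Hf t t0.
rewrite -(ler_pXn2r (n := 2)) ?nnegrE ?normc_ge0 ?(ltW e0) // (le_trans h) //.
near: t; apply: nbhs_right_le; exact: exprn_gt0.
Unshelve. all: by end_near. Qed.

Lemma cm_path {T} {F : set_system T} {FF : Filter F} (f : T -> R[i]) z0 i j :
  ctends F f z0 -> ctends F (fun e => cm (f e) i j) (cm z0 i j).
Proof.
move=> /ctends_weyl[_ h1 h4]; rewrite /cm mx22E.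
case: ifP => hi; case: ifP => hj.
- by apply: (ctends_ext _ h1) => t; rewrite mx22E hi hj.
- by apply: (ctends_ext _ (ctends_cst 1)) => t; rewrite mx22E hi hj.
- by apply: (ctends_ext _ (ctends_cst 1)) => t; rewrite mx22E hi hj.
- by apply: (ctends_ext _ h4) => t; rewrite mx22E hi hj.
Qed.

Lemma eigvalE n : (eigval al be n)%:C = lam al be n%:R.
Proof. by rewrite /eigval /lam rmorphM !rmorphD !rmorphN rmorph_nat rmorph1. Qed.

Lemma weyl_den_eq0 z : weyl_den z = 0 -> exists n, lam al be z = (eigval al be n)%:C.
Proof.
have rg0 w : rgam w = 0 -> exists n : nat, w = - n%:R.
  move=> w0; apply/not_existsP => H; move/eqP: w0; apply/negP; apply: rgam_neq0 => k.
  exact/eqP/H.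
move/eqP; rewrite mulf_eq0 => /orP[] /eqP /rg0 [n hn]; exists n; rewrite eigvalE.
  by congr (lam _ _ _); rewrite -[z]opprK hn opprK.
have -> : z = refl n%:R; last by rewrite lam_refl.
by rewrite /refl -[n%:R]opprK -hn; ring.
Qed.

Lemma M0_limit_regular (x : R) i : (forall n, x <> eigval al be n) ->
  exists l : R, ctends 0^'+ (fun e => M0 Minf (x +i* e) i i) l%:C.
Proof.
move=> hx; have [z0 z0x] := lam_root x%:C.
have [f [fx fz]] := root_path z0x.
have d0 : weyl_den z0 != 0.
  by apply/eqP => /weyl_den_eq0[n]; rewrite z0x => /complexI; exact: hx.
have rD := real_at z0x weyl_den_conj weyl_den_refl.
have r1 := real_at z0x c1_conj c1_refl.
have r4 := real_at z0x c4_conj c4_refl.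
have rcm : (cm z0 i i)^* = cm z0 i i by rewrite /cm mx22E; case: (i == 0); [exact: r1|exact: r4].
exists (re (kap / weyl_den z0 * cm z0 i i)).
rewrite -real_of_conj; last by rewrite rmorphM rmorphM fmorphV /= kap_real rD rcm.
pose proof (ctends_weyl fz) as [hD _ _].
pose proof (ctendsM (ctendsM (ctends_cst kap) (ctendsV d0 hD)) (cm_path (i := i) (j := i) fz)) as h.
apply: (ctends_near _ h); near=> e.
have e0 : 0 < e by [].
by rewrite -(fx e e0) M0E ?mxE //= fx //= gt_eqF.
Unshelve. all: by end_near. Qed.

(* weyl_den has a simple zero in lam at eigval n; this is the cofactor, written
   so that it does not vanish at z = n. *)
Definition weyl_codiv n z : R[i] := (\prod_(k < n) (- z + k%:R)) *
  (\prod_(k < n) (z + 1 - s + k%:R)) * (rgam (- z + n.+1%:R) * rgam (z + 1 - s + n.+1%:R)).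

(** Extracting n + 1 factors from each [rgam] exposes n - z and z + n + 1 - s, whose product is
    -(lam z - lam n). *)
Lemma weyl_den_div n z :
  weyl_den z = - (lam al be z - (eigval al be n)%:C) * weyl_codiv n z.
Proof.
rewrite /weyl_den (rgam_iter n.+1 (- z)) (rgam_iter n.+1 (z + 1 - s)) eigvalE lamB.
by rewrite !big_ord_recr /= /weyl_codiv; ring.
Qed.

Lemma weyl_codiv_neq0 n : weyl_codiv n n%:R != 0.
Proof.
have natC k : k%:R = (k%:R : R)%:C :> R[i] by rewrite rmorph_nat.
rewrite /weyl_codiv; apply: mulf_neq0; apply: mulf_neq0.
- apply/prodf_neq0 => k _; by rewrite addrC subr_eq0 eqr_nat ltn_eqF.
- apply/prodf_neq0 => k _.
  have -> : n%:R + 1 - s + k%:R = (n%:R + 1 - (al + be) + k%:R)%:C.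
    by rewrite !natC /s !rmorphD rmorphN rmorphD rmorph1.
  (* An index k < n exists only if n >= 1, and then n + 1 > s because s < 2. *)
  have n1 : (1 : R) <= n%:R by rewrite ler1n (leq_ltn_trans _ (ltn_ord k)).
  have k0 : (0 : R) <= k%:R by [].
  have p : (0 : R) < n%:R + 1 - (al + be) + k%:R.
    by have h1 := al1; have h2 := be1; lra.
  by rewrite eq_complex /= eqxx andbT; exact: lt0r_neq0 p.
- have -> : - n%:R + n.+1%:R = (1 : R)%:C by rewrite -natr1 addKr.
  exact: rgam_gt0_neq0.
have -> : n%:R + 1 - s + n.+1%:R = (n%:R + 1 - (al + be) + n.+1%:R)%:C.
  by rewrite !natC /s !rmorphD rmorphN rmorphD rmorph1.
apply: rgam_gt0_neq0; rewrite -natr1.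
have h1 := al1; have h2 := be1; have : (0 : R) <= n%:R by [].
lra.
Qed.

Lemma ctends_weyl_codiv {T} {F : set_system T} {FF : Filter F} (f : T -> R[i]) z0 n :
  ctends F f z0 -> ctends F (weyl_codiv n \o f) (weyl_codiv n z0).
Proof.
move=> fz; pose proof (ctendsN fz) as fN.
pose proof (ctendsB (ctendsD fz (ctends_cst 1)) (ctends_cst s)) as fs.
pose proof (ctends_rgam_comp (ctendsD fN (ctends_cst n.+1%:R))) as h1.
pose proof (ctends_rgam_comp (ctendsD fs (ctends_cst n.+1%:R))) as h2.
have p1 : ctends F (fun t => \prod_(k < n) (- f t + k%:R)) (\prod_(k < n) (- z0 + k%:R)).
  by apply: ctends_prod => k; exact: (ctendsD fN (ctends_cst k%:R)).
have p2 : ctends F (fun t => \prod_(k < n) (f t + 1 - s + k%:R))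
    (\prod_(k < n) (z0 + 1 - s + k%:R)).
  by apply: ctends_prod => k; exact: (ctendsD fs (ctends_cst k%:R)).
exact: (ctendsM (ctendsM p1 p2) (ctendsM h1 h2)).
Qed.

Lemma weyl_codiv_real n : (weyl_codiv n n%:R)^* = weyl_codiv n n%:R.
Proof.
have nc k : (k%:R : R[i])^* = k%:R by rewrite rmorph_nat.
have r1 k : (- n%:R + k%:R : R[i])^* = - n%:R + k%:R.
  by rewrite rmorphD rmorphN /= !nc.
have r2 k : (n%:R + 1 - s + k%:R : R[i])^* = n%:R + 1 - s + k%:R.
  by rewrite /s !rmorphD rmorphN rmorphD rmorph1 /= !real_conj !nc.
rewrite /weyl_codiv; apply: mul_real; apply: mul_real.
- by rewrite rmorph_prod; apply: eq_bigr => k _; rewrite /= r1.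
- by rewrite rmorph_prod; apply: eq_bigr => k _; rewrite /= r2.
- by rewrite -rgam_conj r1.
- by rewrite -rgam_conj r2.
Qed.

Lemma M0_limit_eigval n : exists rho c : R, [/\ rho != 0, c != 0,
  c4 al be n%:R = c%:C &
  forall i j, ctends 0^'+ (fun e => e%:C * M0 Minf (eigval al be n +i* e) i j)
    ('i%C * rho%:C * mx22 c^-1%:C 1 1 c%:C i j)].
Proof.
have z0x := esym (eigvalE n); set x := eigval al be n in z0x *; set z0 : R[i] := n%:R in z0x *.
have [f [fx fz]] := root_path z0x.
have E0 := weyl_codiv_neq0 n; have Er := weyl_codiv_real n.
(* The right side of [c14E] vanishes with [weyl_den], and [kap] is nonzero. *)
have c14 : c1 al be z0 * c4 al be z0 = 1.
  have := c14E z0; rewrite (weyl_den_div n) z0x subrr oppr0 mul0r mulr0.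
  by move/eqP; rewrite mulf_eq0 (negPf kap_neq0) orbF subr_eq0 => /eqP.
have r4 := real_of_conj (real_at z0x c4_conj c4_refl).
have c40 : re (c4 al be z0) != 0.
  apply/eqP => h; move: c14; rewrite r4 h mulr0 => /eqP; rewrite eq_sym oner_eq0 //.
have c10 : c1 al be z0 = (re (c4 al be z0))^-1%:C.
  by rewrite fmorphV /= -r4; apply: (mulIf (x := c4 al be z0));
     rewrite ?c14 ?mulVf // r4 eq_complex /= eqxx andbT.
have rr : (kap / weyl_codiv n z0)^* = kap / weyl_codiv n z0.
  by rewrite rmorphM fmorphV /= kap_real Er.
exists (re (kap / weyl_codiv n z0)), (re (c4 al be z0)); split; [|exact: c40|exact: r4|].
  have : kap / weyl_codiv n z0 != 0 by rewrite mulf_neq0 ?kap_neq0 ?invr_eq0.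
  by rewrite (real_of_conj rr) eq_complex /= eqxx andbT.
move=> i j; rewrite -(real_of_conj rr).
have -> : mx22 (re (c4 al be z0))^-1%:C 1 1 (re (c4 al be z0))%:C = cm z0.
  by rewrite /cm -r4 c10.
pose proof (ctendsM (ctendsM (ctends_cst 'i%C) (ctendsM (ctends_cst kap)
  (ctendsV E0 (ctends_weyl_codiv (n := n) fz)))) (cm_path (i := i) (j := j) fz)) as h.
apply: (ctends_near _ h); near=> e.
have e0 : 0 < e by [].
have scaleE (a : R[i]) (A : 'M[R[i]]_2) : (a *: A) i j = a * A i j by rewrite mxE.
rewrite -(fx e e0) M0E ?fx //= ?gt_eqF // scaleE (weyl_den_div n) fx // -/x.
(* The factor e / (- i e) left by [weyl_den_div] is i, whence the i in the limit. *)
have -> : x +i* e - x%:C = 'i%C * e%:C.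
  by apply/eqP; rewrite eq_complex /= subrr subr0; apply/andP; split; apply/eqP; ring.
have i2 : ('i%C * 'i%C : R[i]) = -1 by rewrite -expr2 sqr_i.
have i0 : 'i%C != 0 :> R[i] by rewrite eq_complex /= oner_eq0 andbF.
have eC : e%:C != 0 :> R[i] by rewrite eq_complex /= eqxx andbT gt_eqF.
have iV : ('i%C)^-1 = - 'i%C :> R[i].
  by apply: (mulIf i0); rewrite mulVf // mulNr i2 opprK.
have aux (k w E m : R[i]) : w != 0 ->
    'i%C * (k * E^-1) * m = w * (k / (- ('i%C * w) * E) * m).
  by move=> w0; rewrite invfM invrN invfM iV; move: (E^-1) => u; field.
exact: aux.
Unshelve. all: by end_near. Qed.

End WeylLimits.

(** * Stieltjes inversion *)

Section PoissonKernel.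
Context {R : realType}.
Variable nu : {measure set (measurableTypeR R) -> \bar R}.
Hypothesis nu_fin : (\int[nu]_x ((1 + x ^+ 2)^-1)%:E < +oo)%E.
Implicit Types (x e w : R).

Definition cauchy_weight w : R := (1 + w ^+ 2)^-1.

Lemma oneDsqr_gt0 w : 0 < 1 + w ^+ 2.
Proof. by rewrite ltr_pwDl // sqr_ge0. Qed.

Lemma cauchy_weight_gt0 w : 0 < cauchy_weight w.
Proof. by rewrite invr_gt0 oneDsqr_gt0. Qed.

Lemma measurable_inv_pos (f : R -> R) : (forall w, 0 < f w) ->
  measurable_fun setT f -> measurable_fun setT (fun w => (f w)^-1).
Proof.
move=> f0 mf; have -> : (fun w => (f w)^-1) = (fun w => powR (f w) (-1)).
  by apply/funext => w; rewrite powR_inv1 // ltW.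
exact: measurableT_comp (measurable_powR _) mf.
Qed.

Lemma measurable_cauchy_weight : measurable_fun setT cauchy_weight.
Proof.
apply: measurable_inv_pos oneDsqr_gt0 _.
apply: measurable_funD => //; exact: measurable_funX.
Qed.

Lemma integrable_cauchy_weight : nu.-integrable setT (EFin \o cauchy_weight).
Proof.
apply/integrableP; split; first by apply/measurable_EFinP; exact: measurable_cauchy_weight.
apply: le_lt_trans nu_fin; rewrite le_eqVlt; apply/orP; left; apply/eqP.
by apply: eq_integral => w _ /=; rewrite ger0_norm // ltW // cauchy_weight_gt0.
Qed.

Lemma dom_integrable (f : R -> R) (K : R) : measurable_fun setT f ->
  (forall w, `|f w| <= K * cauchy_weight w) -> nu.-integrable setT (EFin \o f).
Proof.
move=> mf fK.
apply: (@le_integrable _ _ _ nu setT _ _ (fun w => (K * cauchy_weight w)%:E)) => //.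
- exact/measurable_EFinP.
- by move=> w _; rewrite /= lee_fin (le_trans (fK w)) // ler_norm.
have := integrableZl measurableT K integrable_cauchy_weight.
by apply: eq_integrable.
Qed.

Definition poisson x e w : R := e / ((w - x) ^+ 2 + e ^+ 2).

Lemma poisson_den_gt0 x e w : 0 < e -> 0 < (w - x) ^+ 2 + e ^+ 2.
Proof. by move=> e0; rewrite ltr_wpDl ?sqr_ge0 // exprn_gt0. Qed.

Lemma poisson_ge0 x e w : 0 < e -> 0 <= poisson x e w.
Proof. by move=> e0; rewrite divr_ge0 ?ltW // poisson_den_gt0. Qed.

Lemma measurable_sqr_sub x (c : R) : measurable_fun setT (fun w : R => (w - x) ^+ 2 + c).
Proof.
apply: measurable_funD => //; apply: measurable_funX.
exact: measurable_funB.
Qed.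

Lemma measurable_poisson x e : 0 < e -> measurable_fun setT (poisson x e).
Proof.
move=> e0; apply: measurable_funM => //.
apply: measurable_inv_pos; first by move=> w; exact: poisson_den_gt0.
exact: measurable_sqr_sub.
Qed.

(* Since 1 + w^2 <= 2 (w - x)^2 + (1 + 2 x^2). *)
Lemma weight_cmp x (c w : R) : 0 < c -> c <= (w - x) ^+ 2 ->
  ((w - x) ^+ 2)^-1 <= (2 + (1 + 2 * x ^+ 2) / c) * cauchy_weight w.
Proof.
move=> c0 cw; have s0 := lt_le_trans c0 cw.
rewrite /cauchy_weight ler_pdivlMr ?oneDsqr_gt0 // mulrC ler_pdivrMr //.
have h : 1 + 2 * x ^+ 2 <= (1 + 2 * x ^+ 2) / c * (w - x) ^+ 2.
  rewrite mulrAC ler_pdivlMr // ler_wpM2l //.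
  by rewrite addr_ge0 // mulr_ge0 // sqr_ge0.
have := sqr_ge0 (w - 2 * x); lra.
Qed.

Lemma poisson_cmp x e w : 0 < e ->
  ((w - x) ^+ 2 + e ^+ 2)^-1 <= (2 + (1 + 2 * x ^+ 2) / e ^+ 2) * cauchy_weight w.
Proof.
move=> e0; have s0 := poisson_den_gt0 x w e0.
have e20 : 0 < e ^+ 2 by rewrite exprn_gt0.
rewrite /cauchy_weight ler_pdivlMr ?oneDsqr_gt0 // mulrC ler_pdivrMr //.
have h : 1 + 2 * x ^+ 2 <= (1 + 2 * x ^+ 2) / e ^+ 2 * ((w - x) ^+ 2 + e ^+ 2).
  rewrite mulrAC ler_pdivlMr // ler_wpM2l //; last by rewrite lerDr sqr_ge0.
  by rewrite addr_ge0 // mulr_ge0 // sqr_ge0.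
have := sqr_ge0 (w - 2 * x); have := sqr_ge0 e; lra.
Qed.

(* Real part of (w - l)^-1 - w / (1 + w^2) for l = x + i e; its imaginary part is poisson x e w. *)
Definition conj_poisson x e w : R := (w - x) / ((w - x) ^+ 2 + e ^+ 2) - w / (1 + w ^+ 2).

Lemma measurable_conj_poisson x e : 0 < e -> measurable_fun setT (conj_poisson x e).
Proof.
move=> e0; apply: measurable_funB.
  apply: measurable_funM; first exact: measurable_funB.
  apply: measurable_inv_pos; first by move=> w; exact: poisson_den_gt0.
  exact: measurable_sqr_sub.
apply: measurable_funM => //; exact: measurable_cauchy_weight.
Qed.

(** The first summand dominates [conj_poisson], the second [poisson]; one constant then serves
    both. *)
Definition kernel_bound x e : R :=
  (2 + x ^+ 2 + e ^+ 2 + `|x|) * (2 + (1 + 2 * x ^+ 2) / e ^+ 2) + e * (2 + (1 + 2 * x ^+ 2) / e ^+ 2).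

Lemma kernel_bounds x e w : 0 < e ->
  `|poisson x e w| <= kernel_bound x e * cauchy_weight w /\
  `|conj_poisson x e w| <= kernel_bound x e * cauchy_weight w.
Proof.
move=> e0; have s0 := poisson_den_gt0 x w e0; have o0 := oneDsqr_gt0 w.
have cmp := poisson_cmp x w e0; have c0 := cauchy_weight_gt0 w.
have x20 := sqr_ge0 x; have e20 : 0 < e ^+ 2 by rewrite exprn_gt0.
rewrite /kernel_bound.
set G := 2 + (1 + 2 * x ^+ 2) / e ^+ 2 in cmp *.
have G0 : 0 <= G by rewrite addr_ge0 // divr_ge0 ?(ltW e20) // addr_ge0 // mulr_ge0.
set A := 2 + x ^+ 2 + e ^+ 2 + `|x|.
have A0 : 0 <= A by rewrite !addr_ge0 // ltW.
have AG : 0 <= A * G * cauchy_weight w by rewrite !mulr_ge0 // ltW.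
have eG : 0 <= e * G * cauchy_weight w by rewrite !mulr_ge0 // ltW.
split.
  rewrite ger0_norm ?poisson_ge0 // /poisson.
  have : e * ((w - x) ^+ 2 + e ^+ 2)^-1 <= e * (G * cauchy_weight w) by rewrite ler_wpM2l // ltW.
  lra.
(* Subtracting w / (1 + w^2) cancels the cubic terms: degree 2 over degree 4 remains, which is
   comparable with [cauchy_weight]. *)
have -> : conj_poisson x e w =
    (w * (1 - x ^+ 2 - e ^+ 2) + x * w ^+ 2 - x) * cauchy_weight w / ((w - x) ^+ 2 + e ^+ 2).
  rewrite /conj_poisson /cauchy_weight; field.
  by rewrite !gt_eqF //; move: s0 o0; rewrite ?expr2; lra.
rewrite normrM [X in X * _]normrM (ger0_norm (ltW c0)) normfV (ger0_norm (ltW s0)).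
have nb : `|w * (1 - x ^+ 2 - e ^+ 2) + x * w ^+ 2 - x| <= A * (1 + w ^+ 2).
  have w1 : `|w| <= 1 + w ^+ 2.
    have := sqr_ge0 (`|w| - 1); rewrite sqrrB real_normK ?num_real //.
    have := normr_ge0 w; have := sqr_ge0 w; lra.
  have h1 : `|w * (1 - x ^+ 2 - e ^+ 2)| <= (1 + w ^+ 2) * (1 + x ^+ 2 + e ^+ 2).
    rewrite normrM ler_pM // (le_trans (ler_normB _ _)) // lerD //.
      by rewrite (le_trans (ler_normB _ _)) // normr1 lerD2l ger0_norm.
    by rewrite ger0_norm // ltW.
  have h2 : `|x * w ^+ 2| = `|x| * w ^+ 2 by rewrite normrM (ger0_norm (sqr_ge0 w)).
  apply: le_trans (ler_normB _ _) _.
  have := ler_normD (w * (1 - x ^+ 2 - e ^+ 2)) (x * w ^+ 2); rewrite h2.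
  rewrite /A; have := sqr_ge0 w; lra.
have h3 : `|w * (1 - x ^+ 2 - e ^+ 2) + x * w ^+ 2 - x| * cauchy_weight w <= A.
  by rewrite /cauchy_weight ler_pdivrMr.
apply: le_trans (_ : A * (G * cauchy_weight w) <= _); last lra.
rewrite ler_pM // ?mulr_ge0 ?invr_ge0 // ltW //.
Qed.

Lemma im_kernel x e w : 0 < e ->
  (w%:C - (x +i* e))^-1 - (w / (1 + w ^+ 2))%:C = conj_poisson x e w +i* poisson x e w.
Proof.
move=> e0; have s0 := poisson_den_gt0 x w e0.
rewrite -[X in X^-1]/((w - x) +i* (0 - e)) sub0r.
apply/eqP; rewrite eq_complex /=; apply/andP; split; apply/eqP.
  by rewrite /conj_poisson sqrrN.
by rewrite /poisson sqrrN subr0 mulNr opprK.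
Qed.

End PoissonKernel.

(** * Positive semidefinite 2 x 2 matrices *)

Section PsdMatrices.
Local Open Scope sesquilinear_scope.
Context {R : realType}.
Implicit Types (A : 'M[R[i]]_2) (u v : 'cV[R[i]]_2) (p q : R[i]).

Lemma formE A u v : (u^t* *m A *m v) 0 0 =
  (u 0 0)^* * A 0 0 * v 0 0 + (u 0 0)^* * A 0 1 * v 1 0 +
  (u 1 0)^* * A 1 0 * v 0 0 + (u 1 0)^* * A 1 1 * v 1 0.
Proof.
rewrite !mxE !big_ord_recl !big_ord0 !mxE !big_ord_recl !big_ord0 !mxE.
have -> : lift ord0 ord0 = 1 :> 'I_2 by apply: val_inj.
rewrite /= !addr0; ring.
Qed.

(** In [R[i]] nonnegativity includes vanishing of the imaginary part; at the vectors (1, 0), (0, 1),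
    (1, 1) and (1, i) this yields Hermitian symmetry. *)
Lemma psd2P A : psd A -> [/\ im (A 0 0) = 0, im (A 1 1) = 0, A 1 0 = (A 0 1)^* &
  forall p q, 0 <= normsq p * re (A 0 0) + normsq q * re (A 1 1) + 2 * re (p^* * A 0 1 * q)].
Proof.
move=> psdA.
have H p q : 0 <= p^* * A 0 0 * p + p^* * A 0 1 * q + q^* * A 1 0 * p + q^* * A 1 1 * q.
  have := psdA (\col_i if i == 0 then p else q); rewrite formE !mxE /=.
  exact.
move: H; case: (A 0 0) => a a'; case: (A 1 1) => d d'; case: (A 0 1) => b b'.
case: (A 1 0) => c c' H.
have HH (x y u v : R) :
   [/\ (x ^+ 2 + y ^+ 2) * a' + (u ^+ 2 + v ^+ 2) * d'
    + (x * u + y * v) * (b' + c') + (x * v - y * u) * (b - c) = 0 &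
   0 <= (x ^+ 2 + y ^+ 2) * a + (u ^+ 2 + v ^+ 2) * d
    + (x * u + y * v) * (b + c) - (x * v - y * u) * (b' - c')].
  have := H (x +i* y) (u +i* v); rewrite lecE => /andP[/eqP h1 h2].
  by rewrite /= in h1 h2; split; lra.
have [h1 _] := HH 1 0 0 0; have [h2 _] := HH 0 0 1 0.
have [h3 _] := HH 1 0 1 0; have [h4 _] := HH 1 0 0 1.
have a0 : a' = 0 by lra.
have d0 : d' = 0 by lra.
have bc : c' = - b' by lra.
have cb : c = b by lra.
split => //=.
  by rewrite bc cb.
case=> x y; case=> u v; have [_] := HH x y u v; rewrite bc cb => h.
apply: le_trans h _; rewrite /normsq /= le_eqVlt; apply/orP; left; apply/eqP; ring.
Qed.

Lemma psd2_bounds A : psd A -> [/\ 0 <= re (A 0 0), 0 <= re (A 1 1),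
  2 * `|re (A 0 1)| <= re (A 0 0) + re (A 1 1) &
  2 * `|im (A 0 1)| <= re (A 0 0) + re (A 1 1)].
Proof.
move=> /psd2P[_ _ _]; case: (A 0 1) => b b' H.
have h1 := H 1 0; have h2 := H 0 1; have h3 := H 1 1; have h4 := H 1 (-1).
have h5 := H 1 'i%C; have h6 := H 1 (- 'i%C).
rewrite /normsq /= in h1 h2 h3 h4 h5 h6.
split; [lra|lra| |].
  have : `|b| <= (re (A 0 0) + re (A 1 1)) / 2 by rewrite ler_norml; lra.
  by rewrite /=; lra.
have : `|b'| <= (re (A 0 0) + re (A 1 1)) / 2 by rewrite ler_norml; lra.
by rewrite /=; lra.
Qed.

(* The last inequality says that A annihilates (c, -1), which determines A. *)
Lemma psd2_rank1 A (c : R) : psd A -> re (A 0 0) + re (A 1 1) = 1 ->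
  c ^+ 2 * re (A 0 0) - 2 * c * re (A 0 1) + re (A 1 1) <= 0 ->
  [/\ A 0 0 = ((1 + c ^+ 2)^-1)%:C, A 0 1 = (c / (1 + c ^+ 2))%:C,
      A 1 0 = (c / (1 + c ^+ 2))%:C & A 1 1 = (c ^+ 2 / (1 + c ^+ 2))%:C].
Proof.
move=> /psd2P[i0 i1 -> H]; move: i0 i1 H.
case: (A 0 0) => a a'; case: (A 1 1) => d d'; case: (A 0 1) => b b' /= -> -> H ad q0.
(* A quadratic that is minimal at 0 has no linear term. Testing at -k / (1 + r) rather than -k / r
   also covers r = 0. *)
have quad (k r : R) : (forall y, 0 <= 2 * y * k + y ^+ 2 * r) -> k = 0.
  move=> h.
  have r0 : 0 <= r by have := h 1; have := h (-1); lra.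
  have := h (- k / (1 + r)).
  have -> : 2 * (- k / (1 + r)) * k + (- k / (1 + r)) ^+ 2 * r =
    - (k ^+ 2 * ((2 + r) / (1 + r) ^+ 2)) by field; lra.
  rewrite oppr_ge0 => h2; apply/eqP; rewrite -sqrf_eq0 eq_le sqr_ge0 andbT.
  by move: h2; rewrite pmulr_lle0 // divr_gt0 ?exprn_gt0 //; lra.
(* The form attains its minimum at (c, -1). Its first variations there in the real directions of
   both coordinates and in the imaginary direction of the first determine the matrix up to scale. *)
have h1 : c * a - b = 0.
  apply: (quad _ a) => y; have := H (c + y)%:C (-1); rewrite /normsq /=; lra.
have h2 : c * b - d = 0.
  apply: (quad _ d) => y; have := H c%:C (-1 + y)%:C; rewrite /normsq /=; lra.
have h3 : b' = 0.
  suff : - b' = 0 by lra.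
  apply: (quad _ a) => y; have := H (c +i* y) (-1); rewrite /normsq /=.
  lra.
have c0 := sqr_ge0 c.
have h4 : c * (c * a - b) = 0 by rewrite h1 mulr0.
have aE : a = (1 + c ^+ 2)^-1.
  have o : 1 + c ^+ 2 != 0 by rewrite gt_eqF // ltr_pwDl.
  by apply: (mulIf o); rewrite mulVf //; lra.
have bE : b = c / (1 + c ^+ 2) by rewrite -aE; lra.
have dE : d = c ^+ 2 / (1 + c ^+ 2) by rewrite -aE; lra.
rewrite h3 aE bE dE; split=> //.
by apply/eqP; rewrite eq_complex /= oppr0 !eqxx.
Qed.

End PsdMatrices.

(** * Poisson integrals of the density *)

Section HerglotzInversion.
Context {R : realType}.
Variables (mu : @matrix_measure R) (P : trace_density mu) (M : R[i] -> 'M[R[i]]_2).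
Hypothesis hM : herglotz_representation P M.
Notation nu := (td_tr P).
Notation W := (td_W P).
Implicit Types (x e w u v : R).

Lemma nu_fin : (\int[nu]_x ((1 + x ^+ 2)^-1)%:E < +oo)%E.
Proof. by case: hM. Qed.

Definition W_form u v w : R :=
  u ^+ 2 * re (W w 0 0) + 2 * u * v * re (W w 0 1) + v ^+ 2 * re (W w 1 1).

(** The imaginary part of the bilinear form of M(l) at the real vector (u, v). *)
Definition im_form u v (l : R[i]) : R :=
  u ^+ 2 * im (M l 0 0) + u * v * (im (M l 0 1) + im (M l 1 0)) + v ^+ 2 * im (M l 1 1).

Lemma W_trace w : re (W w 0 0) + re (W w 1 1) = 1.
Proof.
have := td_W_tr P w; rewrite /mxtrace !big_ord_recl big_ord0 addr0.
have -> : lift ord0 ord0 = 1 :> 'I_2 by apply: val_inj.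
by move=> /(congr1 re); case: (W w _ _) => ? ?; case: (W w _ _).
Qed.

Lemma psd_form_ge0 (A : 'M[R[i]]_2) u v : psd A ->
  0 <= u ^+ 2 * re (A 0 0) + 2 * u * v * re (A 0 1) + v ^+ 2 * re (A 1 1).
Proof.
move=> /psd2P[_ _ _ /(_ u%:C v%:C)]; rewrite /normsq.
by case: (A 0 1) => b b' /=; lra.
Qed.

Lemma W_form_ge0 u v w : 0 <= W_form u v w.
Proof. exact: psd_form_ge0 (td_W_psd P w). Qed.

Lemma W_bounds w i j : `|re (W w i j)| <= 1 /\ `|im (W w i j)| <= 1.
Proof.
have [h1 h2 h3 h4] := psd2_bounds (td_W_psd P w).
have [i0 i1 i10 _] := psd2P (td_W_psd P w).
have tr := W_trace w.
have ord2 (k : 'I_2) : k = 0 \/ k = 1.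
  by case: k => [[|[|//]] ?]; [left|right]; apply: val_inj.
have conj_re z : re z^* = re z :> R by case: z.
have conj_im z : im z^* = - im z :> R by case: z.
have [->|->] := ord2 i; have [->|->] := ord2 j.
- by rewrite i0 normr0 ger0_norm //; split => //; lra.
- by split; lra.
- by rewrite i10 conj_re conj_im normrN; split; lra.
- by rewrite i1 normr0 ger0_norm //; split => //; lra.
Qed.

Lemma measurable_reW i j : measurable_fun setT (fun w => re (W w i j)).
Proof. by have [] := td_W_meas P i j. Qed.

Lemma measurable_imW i j : measurable_fun setT (fun w => im (W w i j)).
Proof. by have [] := td_W_meas P i j. Qed.

Lemma integrable_kernel (f g : R -> R) (K : R) : 0 <= K ->
  measurable_fun setT f -> measurable_fun setT g ->
  (forall w, `|f w| <= K * cauchy_weight w) -> (forall w, `|g w| <= 1) ->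
  nu.-integrable setT (EFin \o (fun w => f w * g w)).
Proof.
move=> K0 mf mg fK g1; apply: (dom_integrable nu_fin (K := K)).
  exact: measurable_funM.
move=> w; rewrite normrM -[leRHS]mulr1 ler_pM //.
Qed.

Lemma kernel_bound_ge0 x e : 0 < e -> 0 <= kernel_bound x e.
Proof.
move=> e0; have [h _] := kernel_bounds x 0 e0.
by have := le_trans (normr_ge0 _) h; rewrite pmulr_lge0 // cauchy_weight_gt0.
Qed.

Lemma integrable_poissonM x e (g : R -> R) : 0 < e -> measurable_fun setT g ->
  (forall w, `|g w| <= 1) -> nu.-integrable setT (EFin \o (fun w => poisson x e w * g w)).
Proof.
move=> e0 mg g1; apply: (integrable_kernel (kernel_bound_ge0 x e0)) => //.
  exact: measurable_poisson.
by move=> w; have [] := kernel_bounds x w e0.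
Qed.

Lemma integrable_conj_poissonM x e (g : R -> R) : 0 < e -> measurable_fun setT g ->
  (forall w, `|g w| <= 1) -> nu.-integrable setT (EFin \o (fun w => conj_poisson x e w * g w)).
Proof.
move=> e0 mg g1; apply: (integrable_kernel (kernel_bound_ge0 x e0)) => //.
  exact: measurable_conj_poisson.
by move=> w; have [] := kernel_bounds x w e0.
Qed.

Lemma integrable_poisson x e : 0 < e -> nu.-integrable setT (EFin \o poisson x e).
Proof.
move=> e0; have := @integrable_poissonM x e (fun=> 1) e0 (measurable_cst _).
rewrite normr1 => /(_ (fun=> lexx _)); apply: eq_integrable => // w _.
by rewrite /= mulr1.
Qed.

Local Notation Rint f := (Rintegral nu setT f).

(* Taking imaginary parts in the Herglotz representation leaves the Poisson
   integral of the quadratic form of the density. *)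
Lemma im_form_poisson : exists d : R -> R -> R, forall u v, 0 <= d u v /\
  forall x e, 0 < e -> im_form u v (x +i* e) =
    d u v * e + Rint (fun w => poisson x e w * W_form u v w).
Proof.
have [_ [C [D [CH psdD MCD]]]] := hM.
pose d u v := u ^+ 2 * re (D 0 0) + 2 * u * v * re (D 0 1) + v ^+ 2 * re (D 1 1).
exists d => u v; split; first exact: psd_form_ge0.
move=> x e e0.
have le0 : im (x +i* e) != 0 by rewrite /= gt_eqF.
have CE i j : (C j i)^* = C i j by have := congr1 (fun A : 'M[R[i]]_2 => A i j) CH; rewrite !mxE.
have c00 : im (C 0 0) = 0 by have := CE 0 0; case: (C 0 0) => a b [] /=; lra.
have c11 : im (C 1 1) = 0 by have := CE 1 1; case: (C 1 1) => a b [] /=; lra.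
have c01 : im (C 0 1) + im (C 1 0) = 0.
  by rewrite -(CE 1 0); case: (C 0 1) => a b /=; rewrite addrN.
have [d00 d11 d10 _] := psd2P psdD.
have E i j : im (M (x +i* e) i j) = im (C i j) + (re (D i j) * e + im (D i j) * x) +
    (Rint (fun w => conj_poisson x e w * im (W w i j)) +
     Rint (fun w => poisson x e w * re (W w i j))).
  rewrite (MCD _ le0).
  have imD (a b : R[i]) : im (a + b) = im a + im b by case: a; case: b.
  have imM (a b : R[i]) : im (a * b) = re a * im b + im a * re b by case: a; case: b.
  rewrite !imD imM; congr (_ + _ + _); rewrite /cintegral.
  rewrite -RintegralD //; last 2 first.
  - by apply: integrable_conj_poissonM => // [|w]; [exact: measurable_imW|have [] := W_bounds w i j].
  - by apply: integrable_poissonM => // [|w]; [exact: measurable_reW|have [] := W_bounds w i j].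
  by apply: eq_Rintegral => w _; rewrite im_kernel // imM.
(* The conjugate kernel drops out of the form, since the imaginary part of [W] is zero on the
   diagonal and antisymmetric off it. *)
have i00 : Rint (fun w => conj_poisson x e w * im (W w 0 0)) = 0.
  have -> : (fun w => conj_poisson x e w * im (W w 0 0)) = fun=> 0.
    by apply/funext => w; have [-> _ _ _] := psd2P (td_W_psd P w); rewrite mulr0.
  by rewrite Rintegral_cst // mul0r.
have i11 : Rint (fun w => conj_poisson x e w * im (W w 1 1)) = 0.
  have -> : (fun w => conj_poisson x e w * im (W w 1 1)) = fun=> 0.
    by apply/funext => w; have [_ -> _ _] := psd2P (td_W_psd P w); rewrite mulr0.
  by rewrite Rintegral_cst // mul0r.
have iW w : im (W w 1 0) = - im (W w 0 1).
  by have [_ _ -> _] := psd2P (td_W_psd P w); case: (W w 0 1).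
have rW w : re (W w 1 0) = re (W w 0 1).
  by have [_ _ -> _] := psd2P (td_W_psd P w); case: (W w 0 1).
have ip i j : nu.-integrable setT (EFin \o (fun w => poisson x e w * re (W w i j))).
  by apply: integrable_poissonM => // [|w]; [exact: measurable_reW|have [] := W_bounds w i j].
have ic i j : nu.-integrable setT (EFin \o (fun w => conj_poisson x e w * im (W w i j))).
  by apply: integrable_conj_poissonM => // [|w]; [exact: measurable_imW|have [] := W_bounds w i j].
have i10 : Rint (fun w => conj_poisson x e w * im (W w 1 0)) =
    - Rint (fun w => conj_poisson x e w * im (W w 0 1)).
  rewrite -[RHS]mulN1r -RintegralZl //.
  by apply: eq_Rintegral => w _; rewrite iW; ring.
have r10 : Rint (fun w => poisson x e w * re (W w 1 0)) =
    Rint (fun w => poisson x e w * re (W w 0 1)).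
  by apply: eq_Rintegral => w _; rewrite rW.
have RE : Rint (fun w => poisson x e w * W_form u v w) =
    u ^+ 2 * Rint (fun w => poisson x e w * re (W w 0 0)) +
    2 * u * v * Rint (fun w => poisson x e w * re (W w 0 1)) +
    v ^+ 2 * Rint (fun w => poisson x e w * re (W w 1 1)).
  have iz (k : R) i j : nu.-integrable setT
      (EFin \o (fun w => k * (poisson x e w * re (W w i j)))).
    by apply: eq_integrable (integrableZl measurableT k (ip i j)).
  rewrite -!RintegralZl // -RintegralD // -RintegralD //; last first.
    by apply: eq_integrable (integrableD measurableT (iz (u ^+ 2) 0 0) (iz (2 * u * v) 0 1)).
  by apply: eq_Rintegral => w _; rewrite /W_form; ring.
have d10' : im (D 1 0) = - im (D 0 1) by rewrite d10; case: (D 0 1).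
have d10'' : re (D 1 0) = re (D 0 1) by rewrite d10; case: (D 0 1).
rewrite /im_form !E i00 i11 i10 r10 RE c00 c11 d00 d11 d10' d10'' /d.
have -> : im (C 0 1) = - im (C 1 0) by lra.
ring.
Qed.

End HerglotzInversion.

(** * Sets on which a measure has zero density *)

Section NullSets.
Context {R : realType}.
Variable nu : {measure set (measurableTypeR R) -> \bar R}.
Implicit Types (a b c d x e : R).

Definition cball x e : set R := `[x - e, x + e]%classic.
Definition oc a b : set R := `]a, b]%classic.
Definition oo a b : set R := `]a, b[%classic.

Lemma measurable_oc a b : measurable (oc a b : set (measurableTypeR R)).
Proof. exact: measurable_itv. Qed.

Lemma measurable_cball x e : measurable (cball x e : set (measurableTypeR R)).
Proof. exact: measurable_itv. Qed.

(* Continuous induction along [c, d]. *)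
Lemma small_density_le c d (eta : R) : 0 < eta -> c <= d ->
  (forall x, c <= x <= d -> exists2 e0 : R, 0 < e0 &
     forall e, 0 < e < e0 -> (nu (cball x e) <= (eta * e)%:E)%E) ->
  (nu (oc c d) <= (eta * (d - c + 1))%:E)%E.
Proof.
move=> eta0 cd H.
pose S := [set t : R | c <= t <= d /\ (nu (oc c t) <= (eta * (t - c))%:E)%E].
have Sc : S c by split; rewrite ?lexx //= /oc set_itvoc0 measure0 subrr mulr0.
have ubS : ubound S d by move=> t [/andP[]].
have supS : has_sup S by split; [exists c|exists d].
set s := sup S.
have cs : c <= s by apply: sup_upper_bound.
have sd : s <= d by apply: sup_le_ub => //; exists c.
have [e0 e00 He0] := H s ltac:(by rewrite cs sd).
have step e : 0 < e < e0 -> exists2 t, S t & (s - e < t <= s) /\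
    (nu (oc c (s + e)) <= (eta * (t - c + e))%:E)%E.
  move=> he; have /andP[e1 e2] := he.
  have [t St ts] := sup_adherent e1 supS.
  have ts' : t <= s by apply: sup_upper_bound.
  exists t => //; split; first by rewrite ts.
  have [_ nut] := St.
  have sub : oc c (s + e) `<=` oc c t `|` cball s e.
    move=> y /=; rewrite /oc /cball /=; rewrite !in_itv /= => /andP[cy ye].
    have [yt|ty] := leP y t; [left|right]; first by rewrite cy.
    by rewrite ye andbT ltW // (lt_trans ts).
  have mo := measurable_oc; have mc := measurable_cball.
  apply: le_trans (_ : nu (oc c t `|` cball s e) <= _)%E.
    by apply: le_measure; rewrite ?inE //; exact: measurableU.
  apply: le_trans (measureU2 nu (mo _ _) (mc _ _)) _.
  by rewrite mulrDr EFinD leeD // He0.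
have [sltd|dles] := ltP s d.
  (* The second bound keeps s + e below [d], so s + e would belong to [S]. *)
  pose e := Num.min (e0 / 2) ((d - s) / 2).
  have e1 : 0 < e by rewrite lt_min !divr_gt0 // subr_gt0.
  have e2 : e <= e0 / 2 by rewrite ge_min lexx.
  have e3 : e <= (d - s) / 2 by rewrite ge_min lexx orbT.
  have [t St [/andP[_ ts] nue]] := step e ltac:(by rewrite e1 /=; lra).
  have : S (s + e).
    split; first by apply/andP; split; lra.
    by apply: le_trans nue _; rewrite lee_fin (ler_wpM2l (ltW eta0)) //; lra.
  move=> Se; have : s + e <= s := sup_upper_bound supS Se.
  by rewrite gerDl leNgt e1.
have sE : s = d by apply/eqP; rewrite eq_le sd dles.
(* At s = d the ball overshoots [d] by at most 1, which the [+ 1] of the bound absorbs. *)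
pose e := Num.min (e0 / 2) 1.
have e1 : 0 < e by rewrite lt_min divr_gt0 /=.
have e2 : e <= e0 / 2 by rewrite ge_min lexx.
have e3 : e <= 1 by rewrite ge_min lexx orbT.
have [t St [/andP[_ ts] nue]] := step e ltac:(by rewrite e1 /=; lra).
apply: le_trans (_ : nu (oc c (s + e)) <= _)%E.
  apply: le_measure; rewrite ?inE; [exact: measurable_oc|exact: measurable_oc|].
  move=> y /=; rewrite /oc /= !in_itv /= => /andP[cy yd]; rewrite cy /= (le_trans yd) // sE lerDl ltW //.
apply: le_trans nue _; rewrite lee_fin (ler_wpM2l (ltW eta0)) //; lra.
Qed.

Definition small_density x := forall eta : R, 0 < eta -> exists2 e0 : R, 0 < e0 &
  forall e, 0 < e < e0 -> (nu (cball x e) <= (eta * e)%:E)%E.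

Lemma small_density_null a b : (forall x, a < x < b -> small_density x) ->
  nu (oo a b) = 0%E.
Proof.
move=> H.
have H1 c d : a < c -> d < b -> nu (oc c d) = 0%E.
  move=> ac db; have [cd|dc] := leP c d; last by rewrite /oc set_itv_ge ?measure0 // bnd_simp -leNgt ltW.
  apply/eqP; rewrite eq_le measure_ge0 andbT; apply/lee_addgt0Pr => e e0.
  have K0 : 0 < d - c + 1 by lra.
  rewrite add0e; have -> : e = e / (d - c + 1) * (d - c + 1) by field; lra.
  apply: small_density_le => //; first by rewrite divr_gt0.
  move=> x /andP[cx xd]; apply: H; last by rewrite divr_gt0.
  by apply/andP; split; lra.
have sub : oo a b `<=` \bigcup_n oc (a + n.+1%:R^-1) (b - n.+1%:R^-1).
  move=> x /=; rewrite /oo /= in_itv /= => /andP[ax xb].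
  have m0 : 0 < Num.min (x - a) (b - x) by rewrite lt_min !subr_gt0 ax xb.
  have /cvgrPdist_lt /(_ _ m0) [N _ HN] := @cvg_harmonic R.
  have : N.+1%:R^-1 < Num.min (x - a) (b - x).
    by have := HN N (leqnn N); rewrite sub0r normrN ger0_norm ?invr_ge0.
  rewrite lt_min => /andP[h1 h2].
  exists N => //; rewrite /oc /= in_itv /=; move: h1 h2; move: (N.+1%:R^-1) => v h1 h2.
  by apply/andP; split; lra.
apply: measure_negligible; first exact: measurable_itv.
apply: negligibleS; first exact: sub.
apply: negligible_bigcup => n; apply/negligibleP; first exact: measurable_itv.
by apply: H1; rewrite ?ltrDl ?ltrBlDr ?ltrDl invr_gt0 ltr0n.
Qed.

End NullSets.

(** * Mass estimates from the imaginary part of M *)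

Section Atoms.
Context {R : realType}.
Variables (mu : @matrix_measure R) (P : trace_density mu) (M : R[i] -> 'M[R[i]]_2).
Hypothesis hM : herglotz_representation P M.
Notation nu := (td_tr P).
Notation W := (td_W P).
Implicit Types (a b x e w u v : R) (B : set (measurableTypeR R)).
Local Notation Rint f := (Rintegral nu setT f).

Lemma nu_bounded_lty B : measurable B -> bounded_set (B : set R) -> (nu B < +oo)%E.
Proof. by move=> mB bB; rewrite (td_trE P mB bB) ltry. Qed.

Lemma bounded_cball x e : bounded_set (cball x e).
Proof.
exists (`|x| + `|e|); split; first by rewrite num_real.
move=> K KM y; rewrite /cball /= in_itv /= => /andP[h1 h2].
apply: ltW; apply: le_lt_trans KM; rewrite ler_norml.
have := ler_norm x; have := ler_norm e; have := ler_norm (- x); rewrite normrN.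
by move=> *; apply/andP; split; lra.
Qed.

Lemma cball0 x : cball x 0 = [set x].
Proof. by rewrite /cball subr0 addr0 set_itv1. Qed.

Lemma nu_set1_lty x : (nu [set x] < +oo)%E.
Proof. by rewrite -cball0 nu_bounded_lty //; [exact: measurable_cball|exact: bounded_cball]. Qed.

Lemma im_form_trace : exists2 d : R, 0 <= d & forall x e, 0 < e ->
  im_form M 1 0 (x +i* e) + im_form M 0 1 (x +i* e) = d * e + Rint (poisson x e).
Proof.
have [d Hd] := im_form_poisson hM.
have [d1 H1] := Hd 1 0; have [d2 H2] := Hd 0 1.
exists (d 1 0 + d 0 1) => [|x e e0]; first exact: addr_ge0.
rewrite H1 // H2 // mulrDl addrACA; congr (_ + _).
have ig u v : (forall w, W_form P u v w <= 1) -> measurable_fun setT (W_form P u v) ->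
    nu.-integrable setT (EFin \o (fun w => poisson x e w * W_form P u v w)).
  move=> h1 mw; apply: (integrable_poissonM hM) => // w.
  by rewrite ger0_norm // W_form_ge0.
have w1 w : W_form P 1 0 w = re (W w 0 0) by rewrite /W_form; ring.
have w2 w : W_form P 0 1 w = re (W w 1 1) by rewrite /W_form; ring.
rewrite -RintegralD //.
- by apply: eq_Rintegral => w _; rewrite w1 w2 -mulrDr W_trace mulr1.
- apply: ig => [w|]; last by rewrite (funext w1); exact: measurable_reW.
  by rewrite w1; have [h _] := W_bounds P w 0 0; exact: le_trans (ler_norm _) h.
- apply: ig => [w|]; last by rewrite (funext w2); exact: measurable_reW.
  by rewrite w2; have [h _] := W_bounds P w 1 1; exact: le_trans (ler_norm _) h.
Qed.

Lemma Rint_indic B : measurable B -> Rint (\1_B : R -> R) = fine (nu B).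
Proof. by move=> mB; rewrite /Rintegral integral_indic // setIT. Qed.

Lemma integrable_indicZ B (k : R) : measurable B -> (nu B < +oo)%E ->
  nu.-integrable setT (EFin \o (fun w => k * \1_B w)).
Proof.
move=> mB fB.
have i1 : nu.-integrable setT (EFin \o (\1_B : R -> R)).
  apply/integrableP; split; first exact/measurable_EFinP.
  rewrite [ltLHS](_ : _ = nu B) // -[X in nu X](setIT B) -(integral_indic nu measurableT mB).
  by apply: eq_integral => w _ /=; rewrite ger0_norm // indicE; case: (_ \in _).
by apply: eq_integrable (integrableZl measurableT k i1).
Qed.

(** On [x - e, x + e] the Poisson kernel is at least 1 / (2 e). *)
Lemma nu_cball_le x e : 0 < e ->
  (nu (cball x e) <= (2 * e * (im_form M 1 0 (x +i* e) + im_form M 0 1 (x +i* e)))%:E)%E.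
Proof.
move=> e0; have [d d0 ->] := im_form_trace => //.
have mB := measurable_cball x e.
have fB := nu_bounded_lty mB (bounded_cball x e).
rewrite -[leLHS]fineK ?ge0_fin_numE // lee_fin -Rint_indic //.
have iP := integrable_poisson hM x e0.
apply: le_trans (_ : 2 * e * Rint (poisson x e) <= _); last first.
  have de : 0 <= d * e by rewrite mulr_ge0 // ltW.
  by rewrite ler_wpM2l ?lerDr //; lra.
rewrite -RintegralZl //; apply: le_Rintegral => //.
- by apply: eq_integrable (integrable_indicZ 1 mB fB) => // w _ /=; rewrite mul1r.
- by apply: eq_integrable (integrableZl measurableT (2 * e) iP).
move=> w _; rewrite -/(poisson x e w); case: (boolP (w \in cball x e)) => [|_]; last first.
  by rewrite mulr_ge0 ?poisson_ge0 // mulr_ge0 // ltW.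
rewrite inE /cball /= in_itv /= => /andP[h1 h2].
rewrite /poisson mulrA ler_pdivlMr ?poisson_den_gt0 // mul1r.
have : 0 <= (e - (w - x)) * (e + (w - x)) by rewrite mulr_ge0; lra.
lra.
Qed.

(** Keeps only the contribution of the point x, where e times the Poisson kernel equals 1. *)
Lemma nu_atom_le u v x e : 0 < e ->
  W_form P u v x * fine (nu [set x]) <= e * im_form M u v (x +i* e).
Proof.
move=> e0; have [d Hd] := im_form_poisson hM.
have [d0 ->] := Hd u v => //.
have mB : measurable ([set x] : set (measurableTypeR R)) by exact: measurable_set1.
have fB := nu_set1_lty x.
have iPW : nu.-integrable setT (EFin \o (fun w => poisson x e w * W_form P u v w)).
  pose K := u ^+ 2 + `|2 * u * v| + v ^+ 2.
  have K0 : 0 <= K by rewrite !addr_ge0 ?sqr_ge0.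
  have mW : measurable_fun setT (W_form P u v).
    apply: measurable_funD; first apply: measurable_funD.
    - by apply: measurable_funM => //; exact: measurable_reW.
    - by apply: measurable_funM => //; exact: measurable_reW.
    - by apply: measurable_funM => //; exact: measurable_reW.
  apply: (dom_integrable (nu_fin hM) (K := kernel_bound x e * K)).
    by apply: measurable_funM => //; exact: measurable_poisson.
  move=> w; rewrite normrM mulrAC ler_pM //; first by have [] := kernel_bounds x w e0.
  have [h1 _] := W_bounds P w 0 0; have [h2 _] := W_bounds P w 0 1; have [h3 _] := W_bounds P w 1 1.
  rewrite (le_trans (ler_normD _ _)) // lerD //; last first.
    by rewrite normrM ger0_norm ?sqr_ge0 // ler_piMr ?sqr_ge0.
  rewrite (le_trans (ler_normD _ _)) // lerD //.
    by rewrite normrM ger0_norm ?sqr_ge0 // ler_piMr ?sqr_ge0.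
  by rewrite normrM ler_piMr.
apply: le_trans (_ : e * Rint (fun w => poisson x e w * W_form P u v w) <= _); last first.
  have de : 0 <= d u v * e by rewrite mulr_ge0 // ltW.
  by rewrite (ler_wpM2l (ltW e0)) // lerDr.
rewrite -Rint_indic // -!RintegralZl //; last first.
  by apply: eq_integrable (integrable_indicZ 1 mB fB) => // w _ /=; rewrite mul1r.
apply: le_Rintegral => //.
- exact: integrable_indicZ.
- by apply: eq_integrable (integrableZl measurableT e iPW).
move=> w _; rewrite -/(poisson x e w) -/(W_form P u v w) -/(W_form P u v x); case: (boolP (w \in [set x])) => [|_]; last first.
  rewrite mulr0; apply: mulr_ge0; first exact: ltW.
  by apply: mulr_ge0; [exact: poisson_ge0|exact: W_form_ge0].
rewrite inE /= => ->; rewrite mulr1 mulrA -[leLHS]mul1r ler_wpM2r ?W_form_ge0 //.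
by rewrite /poisson subrr expr0n add0r mulrA -expr2 mulfV // sqrf_eq0 gt_eqF.
Qed.

(** Outside the gap the Poisson kernel is at most e / (w - x)^2, hence at most a multiple of e times
    [cauchy_weight], uniformly in e. *)
Lemma nu_gap_le a b x : a < x < b -> nu (oo a b) = 0%E -> exists K : R, forall e, 0 < e ->
  0 <= im_form M 1 0 (x +i* e) + im_form M 0 1 (x +i* e) <= K * e.
Proof.
move=> /andP[ax xb] nu0; have [d d0 Hd] := im_form_trace.
pose del := Num.min (x - a) (b - x).
have del0 : 0 < del by rewrite lt_min !subr_gt0 ax xb.
have d2 : 0 < del ^+ 2 by rewrite exprn_gt0.
pose G := 2 + (1 + 2 * x ^+ 2) / del ^+ 2.
have G0 : 0 <= G by rewrite addr_ge0 // divr_ge0 ?(ltW d2) // addr_ge0 // mulr_ge0 // sqr_ge0.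
exists (d + G * Rint cauchy_weight) => e e0.
have iP := integrable_poisson hM x e0.
have icw := integrable_cauchy_weight (nu_fin hM).
have mB : measurable (oo a b : set (measurableTypeR R)) by exact: measurable_itv.
have fB : (nu (oo a b) < +oo)%E by rewrite nu0.
rewrite Hd //; apply/andP; split.
  rewrite addr_ge0 ?mulr_ge0 // ?(ltW e0) //.
  by apply: Rintegral_ge0 => // w _; exact: poisson_ge0.
rewrite mulrDl lerD2l.
(* On the null interval the crude bound 1 / e suffices; adding it there changes nothing in the
   integral and gives a pointwise majorant everywhere. *)
have -> : G * Rint cauchy_weight * e =
    Rint (fun w => G * e * cauchy_weight w + e^-1 * \1_(oo a b) w).
  rewrite RintegralD //; last 2 first.
  - by apply: eq_integrable (integrableZl measurableT (G * e) icw).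
  - exact: integrable_indicZ.
  rewrite RintegralZl // RintegralZl //; last first.
    by apply: eq_integrable (integrable_indicZ 1 mB fB) => // w _ /=; rewrite mul1r.
  by rewrite Rint_indic // nu0 /= mulr0 addr0 mulrAC.
apply: le_Rintegral => //.
  have i1 : nu.-integrable setT (EFin \o (fun w => G * e * cauchy_weight w)).
    by apply: eq_integrable (integrableZl measurableT (G * e) icw).
  by apply: eq_integrable (integrableD measurableT i1 (integrable_indicZ e^-1 mB fB)).
move=> w _; rewrite ?indicE -?/(poisson x e w); case: (boolP (w \in oo a b)) => [_|].
  rewrite mulr1 -[leLHS]add0r lerD //.
    by rewrite !mulr_ge0 // ltW // cauchy_weight_gt0.
  have eE : e^-1 * e ^+ 2 = e by rewrite expr2 mulKf // gt_eqF.
  rewrite /poisson ler_pdivrMr ?poisson_den_gt0 // -[leLHS]eE.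
  by rewrite ler_wpM2l ?invr_ge0 ?(ltW e0) // lerDr sqr_ge0.
rewrite mulr0 addr0 notin_setE /oo /= in_itv /= => hw.
have cw : del ^+ 2 <= (w - x) ^+ 2.
  have : del <= `|w - x|.
    rewrite leNgt; apply/negP; rewrite lt_min ltr_norml => /andP[].
    rewrite ltr_norml => /andP[h1 h2] /andP[h3 h4]; apply: hw.
    by apply/andP; split; lra.
  move=> dw; rewrite -(@real_normK _ (w - x)) ?num_real // ler_pXn2r ?nnegrE //.
  exact: ltW.
have s0 := lt_le_trans d2 cw.
apply: le_trans (_ : e * ((w - x) ^+ 2)^-1 <= _).
  rewrite /poisson ler_wpM2l ?(ltW e0) // lef_pV2 ?posrE ?poisson_den_gt0 //.
  by rewrite lerDl sqr_ge0.
rewrite (mulrC G) -mulrA ler_wpM2l ?(ltW e0) //; exact: weight_cmp.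
Qed.

End Atoms.

(** * The atoms and the density of mu *)

Section DiscreteMeasure.
Context {R : realType}.
Variables (mu : @matrix_measure R) (P : trace_density mu) (M : R[i] -> 'M[R[i]]_2).
Hypothesis hM : herglotz_representation P M.
Variable lamb : nat -> R.
Hypothesis lamb_incr : forall n, lamb n < lamb n.+1.
Hypothesis lamb_unbounded : forall x, exists n, x < lamb n.
Hypothesis M_regular : forall x i, (forall n, x <> lamb n) ->
  exists l : R, ctends 0^'+ (fun e => M (x +i* e) i i) l%:C.
Variable wt : nat -> R.
Hypothesis M_pole : forall n, exists rho : R, [/\ rho != 0, wt n != 0 &
  forall i j, ctends 0^'+ (fun e => e%:C * M (lamb n +i* e) i j)
    ('i%C * rho%:C * mx22 (wt n)^-1%:C 1 1 (wt n)%:C i j)].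
Notation nu := (td_tr P).
Notation W := (td_W P).
Implicit Types (a b x e w : R).

Lemma lamb_mono m n : (m <= n)%N -> lamb m <= lamb n.
Proof.
elim: n => [|n IH]; first by rewrite leqn0 => /eqP ->.
rewrite leq_eqVlt => /predU1P[-> //|]; rewrite ltnS => /IH h.
by rewrite (le_trans h) // ltW.
Qed.

Lemma lamb_gap x : (forall n, x <> lamb n) ->
  x < lamb 0 \/ exists n, lamb n < x < lamb n.+1.
Proof.
move=> xn; have [n] := lamb_unbounded x; elim: n => [|n IH]; first by left.
have [xl _|lx xl] := ltP x (lamb n); first exact: IH.
by right; exists n; rewrite xl andbT lt_neqAle lx andbT eq_sym; apply/eqP.
Qed.

Lemma regular_between n x : lamb n < x < lamb n.+1 -> forall m, x <> lamb m.
Proof.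
move=> /andP[h1 h2] m xm; have [mn|nm] := leqP m n.
  by have := lamb_mono mn; rewrite -xm leNgt h1.
by have := lamb_mono nm; rewrite -xm leNgt h2.
Qed.

Lemma regular_below x : x < lamb 0 -> forall m, x <> lamb m.
Proof. by move=> h m xm; have := lamb_mono (leq0n m); rewrite -xm leNgt h. Qed.

Lemma im_form_10 (l : R[i]) : im_form M 1 0 l = im (M l 0 0).
Proof. by rewrite /im_form; ring. Qed.

Lemma im_form_01 (l : R[i]) : im_form M 0 1 l = im (M l 1 1).
Proof. by rewrite /im_form; ring. Qed.

Lemma near_right0 (Q : R -> Prop) : (\forall e \near 0^'+, Q e) ->
  exists2 e0 : R, 0 < e0 & forall e, 0 < e < e0 -> Q e.
Proof.
move=> [d /= d0 H]; exists d => // e /andP[e0 ed]; apply: H => //=.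
by rewrite sub0r normrN gtr0_norm.
Qed.

(** Real boundary values mean that both diagonal imaginary parts tend to 0. The 1 / 4 splits eta
    over the two entries and the factor 2 of [nu_cball_le]. *)
Lemma regular_small_density x : (forall n, x <> lamb n) -> small_density nu x.
Proof.
move=> hx eta eta0.
have e40 : 0 < eta / 4 by rewrite divr_gt0.
have [l0 /ctends_im /cvgrPdist_le /(_ _ e40) h0] := M_regular 0 hx.
have [l1 /ctends_im /cvgrPdist_le /(_ _ e40) h1] := M_regular 1 hx.
have [e0 e00 H] := near_right0 (filterI h0 h1).
exists e0 => // e he; have /andP[ep _] := he.
apply: le_trans (nu_cball_le hM x ep) _; rewrite lee_fin im_form_10 im_form_01.
have [] := H e he; rewrite /= !sub0r !normrN => k0 k1.
have : im (M (x +i* e) 0 0) + im (M (x +i* e) 1 1) <= eta / 2.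
  by have := le_trans (ler_norm _) k0; have := le_trans (ler_norm _) k1; lra.
have -> : eta * e = 2 * e * (eta / 2) by field.
by rewrite ler_pM2l // mulr_gt0.
Qed.

Lemma nu_between n : nu (oo (lamb n) (lamb n.+1)) = 0%E.
Proof.
by apply: small_density_null => x /regular_between; exact: regular_small_density.
Qed.

Lemma nu_below a : nu (oo a (lamb 0)) = 0%E.
Proof.
apply: small_density_null => x /andP[_ /regular_below]; exact: regular_small_density.
Qed.

Definition atoms : set (measurableTypeR R) := [set x | exists n, x = lamb n].

Lemma nu_negligible_oo a b : nu (oo a b) = 0%E -> nu.-negligible (oo a b).
Proof. by move=> h; apply/negligibleP => //; exact: measurable_itv. Qed.

Lemma nu_negligible_compl : nu.-negligible (~` atoms).
Proof.
have sub : ~` atoms `<=` (\bigcup_k oo (lamb 0 - k%:R) (lamb 0)) `|`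
    (\bigcup_n oo (lamb n) (lamb n.+1)).
  move=> x /= hx; have [n xn|x0|[n hn]] := @lamb_gap x; first by apply: hx; exists n.
    left; have [k hk] : exists k : nat, lamb 0 - x < k%:R.
      by exists (Num.bound (lamb 0 - x)); apply: archi_boundP; lra.
    by exists k => //; rewrite /oo /= in_itv /= x0 andbT; lra.
  by right; exists n => //; rewrite /oo /= in_itv.
apply: negligibleS; first exact: sub.
apply: negligibleU; apply: negligible_bigcup => n; apply: nu_negligible_oo.
  exact: nu_below.
exact: nu_between.
Qed.

Lemma nu_around n : exists a b, a < lamb n < b /\
  (nu [set lamb n] = 0%E -> nu (oo a b) = 0%E).
Proof.
have [a an nua] : exists2 a, a < lamb n & nu (oo a (lamb n)) = 0%E.
  case: n => [|n]; last by exists (lamb n) => //; exact: nu_between.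
  by exists (lamb 0 - 1); [rewrite ltrBlDr ltrDl|exact: nu_below].
exists a, (lamb n.+1); split; first by rewrite an lamb_incr.
move=> nu0.
have sub : oo a (lamb n.+1) `<=` oo a (lamb n) `|` ([set lamb n] `|` oo (lamb n) (lamb n.+1)).
  move=> x; rewrite /oo /= !in_itv /= => /andP[h1 h2].
  by have [xn|nx|->] := ltgtP x (lamb n); [left; rewrite h1|right; right|right; left].
apply: measure_negligible; first exact: measurable_itv.
apply: negligibleS; first exact: sub.
apply: negligibleU; first exact: nu_negligible_oo.
apply: negligibleU; last by apply: nu_negligible_oo; exact: nu_between.
by apply/negligibleP => //; exact: measurable_set1.
Qed.

Lemma im_scale e (z : R[i]) : im (e%:C * z) = e * im z.
Proof. by case: z => z1 z2 /=; ring. Qed.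

Lemma pole_im n (rho c : R) i j :
  ctends 0^'+ (fun e => e%:C * M (lamb n +i* e) i j)
    ('i%C * rho%:C * mx22 c^-1%:C 1 1 c%:C i j) ->
  e * im (M (lamb n +i* e) i j) @[e --> 0^'+] -->
    rho * (if i == 0 then (if j == 0 then c^-1 else 1) else (if j == 0 then 1 else c)).
Proof.
move=> /ctends_im h.
have -> : rho * (if i == 0 then (if j == 0 then c^-1 else 1) else (if j == 0 then 1 else c)) =
   im ('i%C * rho%:C * mx22 c^-1%:C 1 1 c%:C i j).
  by rewrite mxE; case: (i == 0); case: (j == 0) => /=; ring.
apply: cvg_trans h; apply: near_eq_cvg; near=> e; by rewrite im_scale.
Unshelve. all: by end_near. Qed.

Lemma cvg_id_right0 : (fun e : R => e) @ 0^'+ --> (0 : R).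
Proof. by apply: cvg_within_filter; exact: cvg_id. Qed.

(** Were it 0, a neighbourhood would be null and e Im tr M would tend to 0 by [nu_gap_le]; but it
    tends to rho (1 / c + c), nonzero because 1 + c^2 > 0. *)
Lemma nu_atom_gt0 n : 0 < fine (nu [set lamb n]).
Proof.
have [rho [rho0 c0 H]] := M_pole n; set c := wt n in c0 H.
have f0 : 0 <= fine (nu [set lamb n]) by rewrite fine_ge0.
rewrite lt_neqAle f0 andbT eq_sym; apply/eqP => nu0.
have {}nu0 : nu [set lamb n] = 0%E.
  by rewrite -[LHS]fineK ?nu0 // ge0_fin_numE // nu_set1_lty.
have [a [b [ab /(_ nu0) nuab]]] := nu_around n.
have [K HK] := nu_gap_le hM ab nuab.
have h0 := pole_im (H 0 0); have h1 := pole_im (H 1 1); rewrite /= in h0 h1.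
have h : e * im (M (lamb n +i* e) 0 0) + e * im (M (lamb n +i* e) 1 1) @[e --> 0^'+]
   --> rho * c^-1 + rho * c by exact: cvgD h0 h1.
have z : e * im (M (lamb n +i* e) 0 0) + e * im (M (lamb n +i* e) 1 1) @[e --> 0^'+] --> (0 : R).
  apply: (@squeeze_cvgr _ _ _ _ (fun=> 0) (fun e => K * (e * e))).
  - near=> e; have e0 : 0 < e by [].
    have := HK e e0; rewrite im_form_10 im_form_01 -mulrDr => /andP[k1 k2].
    rewrite mulr_ge0 ?(ltW e0) //=.
    by rewrite mulrA (mulrC K) -mulrA mulrC (mulrC e) ler_wpM2r // ltW.
  - exact: cvg_cst.
  - rewrite -[0 in X in _ --> X](mulr0 K) -[0 in X in _ --> X](mulr0 (0:R)).
    exact: (cvgM (cvg_cst _) (cvgM cvg_id_right0 cvg_id_right0)).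
have /eqP : rho * c^-1 + rho * c = 0 by exact: (cvg_unique (@Rhausdorff R) h z).
rewrite -mulrDr mulf_eq0 (negPf rho0) /= => /eqP cc.
have : c * (c^-1 + c) = 0 by rewrite cc mulr0.
rewrite mulrDr mulfV //; have := sqr_ge0 c; rewrite expr2; lra.
Unshelve. all: by end_near. Qed.

Lemma W_atom n : let c := wt n in
  [/\ W (lamb n) 0 0 = ((1 + c ^+ 2)^-1)%:C, W (lamb n) 0 1 = (c / (1 + c ^+ 2))%:C,
      W (lamb n) 1 0 = (c / (1 + c ^+ 2))%:C & W (lamb n) 1 1 = (c ^+ 2 / (1 + c ^+ 2))%:C].
Proof.
have [rho [rho0 c0 H]] := M_pole n; set c := wt n in c0 H *.
apply: psd2_rank1; [exact: td_W_psd|exact: W_trace|].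
have h00 := pole_im (H 0 0); have h01 := pole_im (H 0 1).
have h10 := pole_im (H 1 0); have h11 := pole_im (H 1 1).
rewrite /= in h00 h01 h10 h11.
have h : c ^+ 2 * (e * im (M (lamb n +i* e) 0 0)) +
   (- c) * (e * im (M (lamb n +i* e) 0 1) + e * im (M (lamb n +i* e) 1 0)) +
   e * im (M (lamb n +i* e) 1 1) @[e --> 0^'+]
   --> c ^+ 2 * (rho * c^-1) + (- c) * (rho * 1 + rho * 1) + rho * c.
  apply: cvgD; last exact: h11.
  apply: cvgD; first exact: (cvgM (cvg_cst _) h00).
  exact: (cvgM (cvg_cst _) (cvgD h01 h10)).
have z : c ^+ 2 * (rho * c^-1) + (- c) * (rho * 1 + rho * 1) + rho * c = 0 by field.
rewrite z in h.
(* The bound of [nu_atom_le] tends to rho (c^2 / c - 2 c + c) = 0; the positive mass is then divided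
   out. *)
have : W_form P c (-1) (lamb n) * fine (nu [set lamb n]) <= 0.
  apply: (cvgr_to_ge h); near=> e; have e0 : 0 < e by [].
  apply: le_trans (nu_atom_le hM c (-1) (lamb n) e0) _.
  by rewrite /im_form le_eqVlt; apply/orP; left; apply/eqP; ring.
rewrite pmulr_lle0 ?nu_atom_gt0 // /W_form.
by apply: le_trans; rewrite le_eqVlt; apply/orP; left; apply/eqP; ring.
Unshelve. all: by end_near. Qed.

End DiscreteMeasure.

(** * L^2 of a purely atomic rank one matrix measure *)

Section ComplexMeasurable.
Context {R : realType}.
Implicit Types f g : R -> R[i].

Lemma cmeasurable_cst (c : R[i]) : cmeasurable setT (fun=> c : R[i]).
Proof. by split; exact: measurable_cst. Qed.

Lemma cmeasurableD f g : cmeasurable setT f -> cmeasurable setT g ->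
  cmeasurable setT (fun x => f x + g x).
Proof.
move=> [rf jf] [rg jg]; split.
  have -> : (fun x => re (f x + g x)) = (fun x => re (f x) + re (g x)).
    by apply/funext => x; case: (f x) => ? ?; case: (g x).
  exact: measurable_funD.
have -> : (fun x => im (f x + g x)) = (fun x => im (f x) + im (g x)).
  by apply/funext => x; case: (f x) => ? ?; case: (g x).
exact: measurable_funD.
Qed.

Lemma cmeasurableM f g : cmeasurable setT f -> cmeasurable setT g ->
  cmeasurable setT (fun x => f x * g x).
Proof.
move=> [rf jf] [rg jg]; split.
  have -> : (fun x => re (f x * g x)) = (fun x => re (f x) * re (g x) - im (f x) * im (g x)).
    by apply/funext => x; case: (f x) => ? ?; case: (g x).
  by apply: measurable_funB; exact: measurable_funM.
have -> : (fun x => im (f x * g x)) = (fun x => re (f x) * im (g x) + im (f x) * re (g x)).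
  by apply/funext => x; case: (f x) => ? ?; case: (g x).
by apply: measurable_funD; exact: measurable_funM.
Qed.

Lemma cmeasurable_conj f : cmeasurable setT f -> cmeasurable setT (fun x => (f x)^*).
Proof.
move=> [rf jf]; split.
  by have -> : (fun x => re (f x)^*) = (fun x => re (f x)) by
    apply/funext => x; case: (f x).
have -> : (fun x => im (f x)^*) = (fun x => - im (f x)) by apply/funext => x; case: (f x).
exact: measurableT_comp.
Qed.

Lemma cmeasurable_real (h : R -> R) : measurable_fun setT h ->
  cmeasurable setT (fun x => (h x)%:C).
Proof. by move=> mh; split => //=; exact: measurable_cst. Qed.

Definition mvec (phi : R -> 'cV[R[i]]_2) := forall i, cmeasurable setT (fun x => phi x i 0).

Lemma mvecZ (h : R -> R[i]) phi : cmeasurable setT h -> mvec phi ->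
  mvec (fun x => h x *: phi x).
Proof.
move=> mh mphi i; have -> : (fun x => (h x *: phi x) i 0) = (fun x => h x * phi x i 0).
  by apply/funext => x; rewrite mxE.
exact: cmeasurableM.
Qed.

Lemma mvecD phi psi : mvec phi -> mvec psi -> mvec (fun x => phi x + psi x).
Proof.
move=> mphi mpsi i; have -> : (fun x => (phi x + psi x) i 0) =
    (fun x => phi x i 0 + psi x i 0) by apply/funext => x; rewrite mxE.
exact: cmeasurableD.
Qed.

Lemma mvecB phi psi : mvec phi -> mvec psi -> mvec (fun x => phi x - psi x).
Proof.
move=> mphi mpsi.
have -> : (fun x => phi x - psi x) = (fun x => phi x + (-1) *: psi x).
  by apply/funext => x; rewrite scaleN1r.
by apply: mvecD => //; apply: mvecZ => //; exact: cmeasurable_cst.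
Qed.

Lemma mvec_sum N (phi : 'I_N -> R -> 'cV[R[i]]_2) : (forall k, mvec (phi k)) ->
  mvec (fun x => \sum_(k < N) phi k x).
Proof.
elim: N phi => [|N IH] phi H.
  move=> i; have -> : (fun x => (\sum_(k < 0) phi k x) i 0) = fun=> 0.
    by apply/funext => x; rewrite big_ord0 mxE.
  exact: cmeasurable_cst.
have -> : (fun x => \sum_(k < N.+1) phi k x) =
    (fun x => \sum_(k < N) phi (widen_ord (leqnSn N) k) x + phi ord_max x).
  by apply/funext => x; rewrite big_ord_recr.
by apply: mvecD => //; apply: IH.
Qed.

End ComplexMeasurable.

Section AtomicL2.
Local Open Scope sesquilinear_scope.
Context {R : realType}.
Variables (mu : @matrix_measure R) (P : trace_density mu).
Notation nu := (td_tr P).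
Notation W := (td_W P).
Variables (lamb wt : nat -> R).
Hypothesis lamb_inj : injective lamb.
Hypothesis nu_compl : nu.-negligible (~` atoms lamb).
Hypothesis nu_pos : forall n, 0 < fine (nu [set lamb n]).
Hypothesis W_wt : forall n, let c := wt n in
  [/\ W (lamb n) 0 0 = ((1 + c ^+ 2)^-1)%:C, W (lamb n) 0 1 = (c / (1 + c ^+ 2))%:C,
      W (lamb n) 1 0 = (c / (1 + c ^+ 2))%:C & W (lamb n) 1 1 = (c ^+ 2 / (1 + c ^+ 2))%:C].
Implicit Types (phi psi : R -> 'cV[R[i]]_2) (n m : nat).

(** The density at [lamb n] is v v^T / (1 + wt^2) with v = (1, wt), so this pairing with v is all
    that L^2(mu) sees of phi at that point. *)
Definition amp n phi : R[i] := phi (lamb n) 0 0 + (wt n)%:C * phi (lamb n) 1 0.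

Definition mass n : R := fine (nu [set lamb n]) / (1 + wt n ^+ 2).

Definition dens phi w : R := re (ip_density P phi phi w).

Lemma oneD_wt n : 0 < 1 + wt n ^+ 2.
Proof. by rewrite ltr_pwDl // sqr_ge0. Qed.

Lemma mass_gt0 n : 0 < mass n.
Proof. by rewrite divr_gt0 // oneD_wt. Qed.

Lemma dens_ge0 phi w : 0 <= dens phi w.
Proof.
have := td_W_psd P w (phi w); rewrite /dens /ip_density; case: (_ 0 0) => a b.
by rewrite lecE => /andP[].
Qed.

Lemma measurable_dens phi : mvec phi -> measurable_fun setT (dens phi).
Proof.
move=> mphi.
have mW i j : cmeasurable setT (fun x => W x i j) by exact: td_W_meas.
suff [] : cmeasurable setT (ip_density P phi phi) by [].
have -> : ip_density P phi phi = (fun x =>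
  (phi x 0 0)^* * W x 0 0 * phi x 0 0 + (phi x 0 0)^* * W x 0 1 * phi x 1 0 +
  (phi x 1 0)^* * W x 1 0 * phi x 0 0 + (phi x 1 0)^* * W x 1 1 * phi x 1 0).
  by apply/funext => x; rewrite /ip_density formE.
have mt i j : cmeasurable setT (fun x => (phi x i 0)^* * W x i j * phi x j 0).
  apply: cmeasurableM => //; apply: cmeasurableM => //; exact: cmeasurable_conj.
exact: (cmeasurableD (cmeasurableD (cmeasurableD (mt 0 0) (mt 0 1)) (mt 1 0)) (mt 1 1)).
Qed.

Lemma dens_atom phi n : dens phi (lamb n) = normsq (amp n phi) / (1 + wt n ^+ 2).
Proof.
rewrite /dens /ip_density formE; have [-> -> -> ->] := W_wt n; rewrite /amp.
case: (phi _ 0 0) => a b; case: (phi _ 1 0) => u v; rewrite /normsq /=.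
move: (wt n) => c; set k := (1 + c ^+ 2)^-1; clearbody k; ring.
Qed.

Lemma measurable_atoms : measurable (atoms lamb).
Proof.
have -> : atoms lamb = \bigcup_n [set lamb n].
  by apply/seteqP; split => x; [move=> [n ->]; exists n|move=> [n _ ->]; exists n].
by apply: bigcup_measurable => n _; exact: measurable_set1.
Qed.

Lemma nu_set1_fin n : nu [set lamb n] = (fine (nu [set lamb n]))%:E.
Proof. by rewrite fineK // ge0_fin_numE // nu_set1_lty. Qed.

Lemma integral_atom phi n :
  (\int[nu]_(x in [set lamb n]) (dens phi x)%:E = (mass n * normsq (amp n phi))%:E)%E.
Proof.
transitivity (\int[nu]_(x in [set lamb n]) (cst (dens phi (lamb n))%:E x))%E.
  by apply: eq_integral => x; rewrite inE /= => ->.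
rewrite integral_cst; last exact: measurable_set1.
by rewrite nu_set1_fin -EFinM dens_atom /mass; congr (_%:E); ring.
Qed.

Lemma normsqL2E phi : mvec phi ->
  (normsqL2 P phi = \sum_(0 <= n <oo) (mass n * normsq (amp n phi))%:E)%E.
Proof.
move=> mphi; have md := measurable_dens mphi.
have mE : measurable_fun setT (fun x => (dens phi x)%:E) by exact/measurable_EFinP.
have mC : measurable (~` atoms lamb) by apply: measurableC; exact: measurable_atoms.
rewrite /normsqL2 -/(dens phi) (ge0_negligible_integral mC measurableT mE) //; last first.
- exact: measure_negligible.
- by move=> x _; rewrite lee_fin dens_ge0.
have -> : setT `\` ~` atoms lamb = \bigcup_n [set lamb n].
  rewrite setTD setCK; apply/seteqP; split => x; first by move=> [n ->]; exists n.
  by move=> [n _ ->]; exists n.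
rewrite ge0_integral_bigcup //.
- by apply: eq_eseriesr => n _; exact: integral_atom.
- exact: measurable_funS mE.
- by move=> x _; rewrite lee_fin dens_ge0.
by move=> i j _ _ [x [/= -> /lamb_inj]].
Qed.

Lemma atom_le phi n : mvec phi -> ((mass n * normsq (amp n phi))%:E <= normsqL2 P phi)%E.
Proof.
move=> mphi; rewrite -integral_atom; apply: ge0_subset_integral => //.
- by apply/measurable_EFinP; exact: measurable_dens.
- by move=> x _; rewrite lee_fin dens_ge0.
Qed.

Lemma normsq_ge0 (z : R[i]) : 0 <= normsq z.
Proof. by rewrite addr_ge0 // sqr_ge0. Qed.

Lemma normsq_eq0 (z : R[i]) : (normsq z == 0) = (z == 0).
Proof.
by case: z => a b; rewrite /normsq /= paddr_eq0 ?sqr_ge0 // !sqrf_eq0 eq_complex.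
Qed.

Lemma normsqL2_eq0 phi : mvec phi -> normsqL2 P phi = 0%E <-> forall n, amp n phi = 0.
Proof.
move=> mphi; split=> [h n|h].
  apply/eqP; rewrite -normsq_eq0 eq_le normsq_ge0 andbT.
  by have := atom_le n mphi; rewrite h lee_fin pmulr_rle0 // mass_gt0.
rewrite normsqL2E //; apply: eseries0 => n _ _.
by rewrite h /normsq /= expr0n addr0 mulr0.
Qed.

Lemma ampB n phi psi : amp n (fun x => phi x - psi x) = amp n phi - amp n psi.
Proof. by rewrite /amp !mxE; ring. Qed.

Lemma ampZ n (h : R -> R[i]) phi : amp n (fun x => h x *: phi x) = h (lamb n) * amp n phi.
Proof. by rewrite /amp !mxE; ring. Qed.

Lemma amp0 n : amp n (fun=> 0) = 0.
Proof. by rewrite /amp !mxE mulr0 addr0. Qed.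

Lemma amp_sum n N (phi : 'I_N -> R -> 'cV[R[i]]_2) :
  amp n (fun x => \sum_(k < N) phi k x) = \sum_(k < N) amp n (phi k).
Proof. by rewrite /amp !summxE mulr_sumr -big_split. Qed.

Lemma eqL2P phi psi : mvec phi -> mvec psi ->
  eqL2 P phi psi <-> forall n, amp n phi = amp n psi.
Proof.
move=> mphi mpsi; rewrite /eqL2 normsqL2_eq0; last exact: mvecB.
by split=> h n; [apply/eqP; rewrite -subr_eq0 -ampB h|rewrite ampB h subrr].
Qed.

Lemma mvec0 : mvec (fun=> 0 : 'cV[R[i]]_2).
Proof.
move=> i; have -> : (fun x : R => (0 : 'cV[R[i]]_2) i 0) = fun=> 0.
  by apply/funext => x; rewrite mxE.
exact: cmeasurable_cst.
Qed.

Lemma inL2Z (l : R[i]) phi : inL2 P phi -> inL2 P (fun x => l *: phi x).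
Proof.
move=> [mphi fphi]; split; first by apply: mvecZ => //; exact: cmeasurable_cst.
have -> : normsqL2 P (fun x => l *: phi x) = ((normsq l)%:E * normsqL2 P phi)%E.
  rewrite /normsqL2 -ge0_integralZl //.
  - apply: eq_integral => x _; rewrite -EFinM; congr (_%:E).
    rewrite /ip_density !formE !mxE !rmorphM /=.
    have -> : forall a b c d e f g : R[i],
       l^* * a * b * (l * c) + l^* * a * d * (l * e) + l^* * f * g * (l * c) +
       l^* * f * W x 1 1 * (l * e) =
       (l^* * l) * (a * b * c + a * d * e + f * g * c + f * W x 1 1 * e).
      by move=> *; ring.
    by case: (l) => p q; case: (X in _ * X) => a b; rewrite /normsq /=; ring.
  - by apply/measurable_EFinP; exact: measurable_dens.
  - by move=> x _; rewrite lee_fin; exact: dens_ge0.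
  - by rewrite lee_fin normsq_ge0.
by rewrite lte_mul_pinfty // ?lee_fin ?normsq_ge0.
Qed.

Definition atom_vec n x : 'cV[R[i]]_2 :=
  if x == lamb n then \col_i (if i == 0 then 1 else (wt n)%:C) else 0.

Lemma atom_vecE n : atom_vec n =
  fun x => (\1_[set lamb n] x)%:C *: \col_i (if i == 0 then 1 else (wt n)%:C).
Proof.
apply/funext => x; rewrite /atom_vec indicE.
have [->|xn] := eqVneq x (lamb n); first by rewrite mem_set // scale1r.
by rewrite memNset ?scale0r //=; apply/eqP.
Qed.

Lemma mvec_atom n : mvec (atom_vec n).
Proof.
rewrite atom_vecE; apply: mvecZ.
  by apply: cmeasurable_real; exact: measurable_indic (measurable_set1 _).
by move=> i; exact: cmeasurable_cst.
Qed.

Lemma amp_atom m n : amp m (atom_vec n) = if m == n then (1 + wt n ^+ 2)%:C else 0.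
Proof.
rewrite /amp /atom_vec (inj_eq lamb_inj); case: eqP => [->|_]; rewrite !mxE /=.
  by rewrite rmorphD rmorph1 rmorphXn expr2.
by rewrite mulr0 addr0.
Qed.

Lemma nneseries_one (a : nat -> \bar R) n : (forall k, 0 <= a k)%E ->
  (forall k, k != n -> a k = 0%E) -> (\sum_(0 <= k <oo) a k = a n)%E.
Proof.
move=> a0 an; rewrite (nneseries_split 0 n.+1) // add0n big_nat_recr //=.
rewrite big1_seq ?add0e; last first.
  by move=> k; rewrite mem_index_iota => /andP[_ kn]; rewrite an // ltn_eqF.
by rewrite eseries0 ?adde0 // => k nk _; rewrite an // gtn_eqF.
Qed.

Lemma inL2_atom n : inL2 P (atom_vec n).
Proof.
split; first exact: mvec_atom.
rewrite (normsqL2E (mvec_atom n)) (@nneseries_one _ n) ?ltry //.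
  by move=> k; rewrite lee_fin mulr_ge0 ?normsq_ge0 // ltW // mass_gt0.
by move=> k kn; rewrite amp_atom (negPf kn) /normsq /= expr0n addr0 mulr0.
Qed.

(** In the coordinates [amp] multiplication by x is diagonal with distinct entries, so an
    eigenvector has exactly one nonzero coordinate. *)
Lemma mulx_eigenvectorP n phi : inL2 P phi ->
  mulx_eigenvector P (lamb n) phi <->
  exists2 c : R[i], c != 0 & eqL2 P phi (fun x => c *: atom_vec n x).
Proof.
move=> Lphi; have [mphi _] := Lphi.
have mid : cmeasurable setT (fun x : R => x%:C) by apply: cmeasurable_real; exact: measurable_id.
have mc (c : R[i]) : cmeasurable setT (fun=> c : R[i]) by exact: cmeasurable_cst.
have ma c : mvec (fun x => c *: atom_vec n x) by apply: mvecZ => //; exact: mvec_atom.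
have m1 := mvecZ (mc (lamb n)%:C) mphi; have m2 := mvecZ mid mphi.
have w0 := oneD_wt n; have w0' : (1 + wt n ^+ 2)%:C != 0 :> R[i].
  by rewrite eq_complex /= eqxx andbT gt_eqF.
split.
  move=> [_ nz [_ _ /(eqL2P m1 m2) H]].
  have H0 m : m != n -> amp m phi = 0.
    move=> mn; have := H m; rewrite !ampZ => /eqP.
    rewrite -subr_eq0 -mulrBl mulf_eq0 subr_eq0 => /orP[/eqP/complexI/lamb_inj nm|/eqP //].
    by rewrite nm eqxx in mn.
  (* The divisor is the n-th amplitude of [atom_vec n] itself. *)
  exists (amp n phi / (1 + wt n ^+ 2)%:C).
    rewrite mulf_neq0 ?invr_eq0 //; apply/eqP => an0; apply: nz.
    apply/(eqL2P mphi mvec0) => m; rewrite amp0.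
    by have [->|/H0] := eqVneq m n.
  apply/(eqL2P mphi (ma _)) => m; rewrite ampZ amp_atom.
  by have [->|/H0 ->] := eqVneq m n; [rewrite divfK|rewrite mulr0].
move=> [c c0 /(eqL2P mphi (ma _)) H].
have H0 m : m != n -> amp m phi = 0.
  by move=> mn; rewrite H ampZ amp_atom (negPf mn) mulr0.
split; first exact: Lphi.
  move=> /(eqL2P mphi mvec0) /(_ n); rewrite amp0 H ampZ amp_atom eqxx => /eqP.
  by rewrite mulf_eq0 (negPf c0) (negPf w0').
split; [exact: Lphi|exact: inL2Z|].
apply/(eqL2P m1 m2) => m; rewrite !ampZ.
by have [->//|/H0 ->] := eqVneq m n; rewrite !mulr0.
Qed.

(** The chosen combination cancels the first N amplitudes exactly, so the error is the tail of the
    convergent series for the norm. *)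
Lemma atom_vec_dense phi (e : R) : inL2 P phi -> 0 < e ->
  exists N (a : 'I_N -> R[i]),
    (normsqL2 P (fun x => (phi x - \sum_(k < N) a k *: atom_vec k x)%R) < e%:E)%E.
Proof.
move=> [mphi fphi] e0.
pose g n := ((mass n * normsq (amp n phi))%:E)%E.
have g0 n : (0 <= g n)%E by rewrite lee_fin mulr_ge0 ?normsq_ge0 // ltW // mass_gt0.
have gfin : (\sum_(0 <= n <oo) g n < +oo)%E by rewrite -normsqL2E.
have tail := nneseries_tail_cvg gfin (fun n _ => g0 n).
have [N HN] : exists N, (\sum_(N <= n <oo) g n < e%:E)%E.
  have e0' : (0 < e%:E)%E by rewrite lte_fin.
  have /filter_ex [N HN] : \forall N \near \oo, (\sum_(N <= n <oo) g n < e%:E)%E.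
    apply: (tail [set y | (y < e%:E)%E]).
    by apply: open_nbhs_nbhs; split => //; exact: open_ereal_lt_ereal.
  by exists N.
exists N, (fun k => amp k phi / (1 + wt k ^+ 2)%:C).
set psi := fun x => _ - _.
have mpsi : mvec psi.
  apply: mvecB => //; apply: mvec_sum => k; apply: mvecZ; first exact: cmeasurable_cst.
  exact: mvec_atom.
have apsi n : amp n psi = if (n < N)%N then 0 else amp n phi.
  rewrite /psi ampB amp_sum.
  have wn (k : nat) : (1 + wt k ^+ 2)%:C != 0 :> R[i].
    by rewrite eq_complex /= eqxx andbT gt_eqF // oneD_wt.
  case: ltnP => [nN|Nn].
    rewrite (bigD1 (Ordinal nN)) //= ampZ amp_atom eqxx divfK // big1 ?addr0 ?subrr //.
    move=> k kn; rewrite ampZ amp_atom; case: eqP => [nk|_]; last by rewrite mulr0.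
    by move: kn; rewrite -val_eqE /= nk eqxx.
  rewrite big1 ?subr0 // => k _; rewrite ampZ amp_atom.
  case: eqP => [nk|_]; last by rewrite mulr0.
  by have := ltn_ord k; rewrite -nk ltnNge Nn.
rewrite normsqL2E // (nneseries_split 0 N); last first.
  by move=> k _; rewrite lee_fin mulr_ge0 ?normsq_ge0 // ltW // mass_gt0.
rewrite add0n big1_seq ?add0e; last first.
  move=> k; rewrite mem_index_iota => /andP[_ /andP[_ kN]].
  by rewrite apsi kN /normsq /= expr0n addr0 mulr0.
rewrite (_ : (\sum_(N <= n <oo) _)%E = (\sum_(N <= n <oo) g n)%E) //.
congr (limn _); apply/funext => n; rewrite !big_nat; apply: eq_bigr => k /andP[Nk _].
by rewrite apsi ltnNge Nk.
Qed.

End AtomicL2.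

(** * The weighted L^2 space on (-1, 1) *)

Section JacobiSpace.
Context {R : realType}.
Variables al be : R.
Implicit Types (f g : R -> R[i]).

Lemma measurable_jac_I : measurable (jac_I : set (measurableTypeR R)).
Proof. exact: measurable_itv. Qed.

Lemma jac_w_gt0 (x : R) : jac_I x -> 0 < jac_w al be x.
Proof.
by rewrite /jac_I /= in_itv /= => /andP[h1 h2]; rewrite mulr_gt0 // powR_gt0 //; lra.
Qed.

Lemma measurable_jac_w : measurable_fun jac_I (jac_w al be).
Proof.
apply: measurable_funM.
  apply: measurableT_comp (measurable_powR _) _; exact: measurable_funB.
apply: measurableT_comp (measurable_powR _) _; exact: measurable_funD.
Qed.

Definition densH f x : R := jac_w al be x * normsq (f x).

Lemma densH_ge0 f x : 0 <= densH f x.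
Proof. by rewrite mulr_ge0 ?normsq_ge0 // mulr_ge0 // powR_ge0. Qed.

Lemma measurable_densH f : cmeasurable jac_I f -> measurable_fun jac_I (densH f).
Proof.
move=> [mr mi]; apply: measurable_funM; first exact: measurable_jac_w.
by apply: measurable_funD; exact: measurable_funX.
Qed.

Definition normsqH f : \bar R := (\int[lebesgue_measure]_(x in jac_I) (densH f x)%:E)%E.

Lemma inH0 : inH al be (fun=> 0).
Proof.
split; first by split; exact: measurable_cst.
under eq_integral do rewrite /normsq /= expr0n addr0 mulr0.
by rewrite integral0 ltry.
Qed.

Lemma inHZ (l : R) f : inH al be f -> inH al be (fun x => l%:C * f x).
Proof.
move=> [mf ff]; have [mr mi] := mf; split.
  split.
    have -> : (fun x => re (l%:C * f x)) = (fun x => l * re (f x)).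
      by apply/funext => x; case: (f x) => ? ? /=; ring.
    exact: measurable_funM.
  have -> : (fun x => im (l%:C * f x)) = (fun x => l * im (f x)).
    by apply/funext => x; case: (f x) => ? ? /=; ring.
  exact: measurable_funM.
have -> : (\int[lebesgue_measure]_(x in jac_I) (jac_w al be x * normsq (l%:C * f x))%:E
    = (l ^+ 2)%:E * normsqH f)%E.
  rewrite /normsqH -ge0_integralZl //.
  - apply: eq_integral => x _; rewrite -EFinM /densH; congr (_%:E).
    by case: (f x) => ? ?; rewrite /normsq /=; ring.
  - exact: measurable_jac_I.
  - by apply/measurable_EFinP; exact: measurable_densH.
  - by move=> x _; rewrite lee_fin densH_ge0.
  - by rewrite lee_fin sqr_ge0.
by rewrite lte_mul_pinfty // lee_fin sqr_ge0.
Qed.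

Lemma eqH0P f : inH al be f -> eqH f (fun=> 0) <-> normsqH f = 0%E.
Proof.
move=> [mf _].
have mE : measurable_fun jac_I (fun x => (densH f x)%:E).
  by apply/measurable_EFinP; exact: measurable_densH.
have -> : normsqH f = (\int[lebesgue_measure]_(x in jac_I) `|(densH f x)%:E|)%E.
  by apply: eq_integral => x _; rewrite gee0_abs // lee_fin densH_ge0.
rewrite (ae_eq_integral_abs lebesgue_measure measurable_jac_I mE).
have key x : jac_I x -> f x = 0 <-> (densH f x)%:E = 0%E.
  move=> Ix; have w0 := jac_w_gt0 Ix; split=> [fx|[/eqP]].
    by rewrite /densH fx /normsq /= expr0n addr0 mulr0.
  by rewrite mulf_eq0 gt_eqF //= normsq_eq0 => /eqP.
by split=> -[N [mN N0 sub]]; exists N; split => // x /= hx; apply: sub => /= hx';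
  apply: hx => Ix; apply/(key x Ix); exact: hx'.
Qed.

Lemma re_ipH f : re (ipH al be f f) = fine (normsqH f).
Proof.
rewrite /ipH /cintegral /Rintegral /normsqH /=; congr fine.
apply: eq_integral => x _; congr (_%:E); rewrite /densH.
by case: (f x) => a b; rewrite /normsq /=; ring.
Qed.

End JacobiSpace.

(** * Transport of eigenvectors by a unitary map *)

Section Transfer.
Context {R : realType}.
Variables (al be : R) (mu : @matrix_measure R) (P : trace_density mu).
Notation nu := (td_tr P).
Notation W := (td_W P).
Variables (lamb wt : nat -> R).
Hypothesis lamb_inj : injective lamb.
Hypothesis nu_compl : nu.-negligible (~` atoms lamb).
Hypothesis nu_pos : forall n, 0 < fine (nu [set lamb n]).
Hypothesis W_wt : forall n, let c := wt n in
  [/\ W (lamb n) 0 0 = ((1 + c ^+ 2)^-1)%:C, W (lamb n) 0 1 = (c / (1 + c ^+ 2))%:C,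
      W (lamb n) 1 0 = (c / (1 + c ^+ 2))%:C & W (lamb n) 1 1 = (c ^+ 2 / (1 + c ^+ 2))%:C].
Variable U : (R -> R[i]) -> (R -> 'cV[R[i]]_2).
Hypothesis hU : spectral_representation al be P U.
Implicit Types f : R -> R[i].

Let eqP2 := eqL2P lamb_inj nu_compl nu_pos W_wt.

Lemma mvecU f : inH al be f -> mvec (U f).
Proof. by case: hU => h _ _ _ _ /h []. Qed.

Lemma unitary_eq0 f : inH al be f -> eqH f (fun=> 0) <-> eqL2 P (U f) (fun=> 0).
Proof.
move=> Hf; have [U1 _ U3 _ _] := hU.
have [_ ffin] := Hf; have [_ Ufin] := U1 f Hf.
rewrite (eqH0P Hf) /eqL2.
have -> : (fun x => U f x - 0) = U f by apply/funext => x; rewrite subr0.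
(* Inner products are real-valued integrals, which would send an infinite norm to 0; finiteness of
   both norms recovers equality of the extended values. *)
have e : fine (normsqL2 P (U f)) = fine (normsqH al be f).
  by rewrite -re_ipH -(U3 f f Hf Hf).
have p1 : (0 <= normsqL2 P (U f))%E.
  by apply: integral_ge0 => x _; rewrite lee_fin; exact: dens_ge0.
have p2 : (0 <= normsqH al be f)%E by apply: integral_ge0 => x _; rewrite lee_fin densH_ge0.
have k1 : normsqL2 P (U f) = (fine (normsqL2 P (U f)))%:E by rewrite fineK // ge0_fin_numE.
have k2 : normsqH al be f = (fine (normsqH al be f))%:E by rewrite fineK // ge0_fin_numE.
by rewrite k1 k2 e.
Qed.

Lemma unitary_scale (l : R) f n : inH al be f ->
  amp lamb wt n (U (fun x => l%:C * f x)) = l%:C * amp lamb wt n (U f).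
Proof.
move=> Hf; have [U1 U2 _ _ _] := hU.
have H0 := inH0 al be.
(* Linearity is available only for a f + g; taking g = 0 requires first that the image of 0 be null,
   which follows from isometry. *)
have z : amp lamb wt n (U (fun=> 0)) = 0.
  have : eqH (fun=> 0 : R[i]) (fun=> 0 : R[i]) by apply: aeW.
  by move=> /(unitary_eq0 H0) /(eqP2 (mvecU H0) mvec0) ->; rewrite amp0.
have lin := U2 l%:C f (fun=> 0) Hf H0.
have fE : (fun x => l%:C * f x + 0) = (fun x => l%:C * f x) by apply/funext => x; rewrite addr0.
rewrite fE in lin.
have mZ : mvec (fun x => l%:C *: U f x).
  by apply: mvecZ; [exact: cmeasurable_cst|exact: mvecU].
move: lin => /(eqP2 (mvecU (inHZ l Hf)) (mvecD mZ (mvecU H0))) ->.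
transitivity (l%:C * amp lamb wt n (U f) + amp lamb wt n (U (fun=> 0))).
  by rewrite /amp !mxE; ring.
by rewrite z addr0.
Qed.

Lemma eigenvector_transfer (l : R) f : inH al be f ->
  A0_eigenvector al be l f <-> mulx_eigenvector P l (U f).
Proof.
move=> Hf; have [U1 _ _ _ U5] := hU.
have Hlf := inHZ l Hf.
have L1 := U1 _ Hf; have L2 := U1 _ Hlf; have L3 := inL2Z l%:C L1.
have mx : mvec (fun x => x%:C *: U f x).
  by apply: mvecZ; [apply: cmeasurable_real; exact: measurable_id|exact: mvecU].
(* The two second arguments need not coincide as functions, only in all amplitudes, which suffices
   for the equality in L^2(mu) inside [mulx]. *)
have key : mulx P (U f) (U (fun x => l%:C * f x)) <-> mulx P (U f) (fun x => l%:C *: U f x).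
  have ml : mvec (fun x => l%:C *: U f x) by case: L3.
  split=> -[_ _ h]; [split; [exact: L1|exact: L3|]|split; [exact: L1|exact: L2|]].
    apply/(eqP2 ml mx) => n; rewrite -(eqP2 (mvecU Hlf) mx).1 // unitary_scale //.
    by rewrite (@ampZ _ lamb wt n (fun=> l%:C)).
  apply/(eqP2 (mvecU Hlf) mx) => n; rewrite -((eqP2 ml mx).1 h) unitary_scale //.
  by rewrite (@ampZ _ lamb wt n (fun=> l%:C)).
split=> -[_ nz].
  move=> k; have h := key.1 ((U5 _ _ Hf Hlf).1 k); split; [exact: L1| |exact: h].
  by move=> /(unitary_eq0 Hf); exact: nz.
move=> k; have h := (U5 _ _ Hf Hlf).2 (key.2 k); split; [exact: Hf| |exact: h].
by move=> /(unitary_eq0 Hf); exact: nz.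
Qed.

End Transfer.

(** * Growth of the eigenvalues *)

Section Eigenvalues.
Context {R : realType}.
Variables al be : R.
Hypotheses (al1 : al < 1) (be1 : be < 1).

(** Consecutive eigenvalues differ by 2 n + 2 - alpha - beta. *)
Lemma eigval_incr n : eigval al be n < eigval al be n.+1.
Proof.
rewrite /eigval -(natr1 n).
have : (0 : R) <= n%:R by [].
move: (n%:R : R) => q q0; have h1 := al1; have h2 := be1; lra.
Qed.

Lemma eigval_unbounded x : exists n, x < eigval al be n.
Proof.
have x0 : 0 <= `|x| + 3 by rewrite addr_ge0.
(* The margin 3 makes n - alpha - beta at least 1, so the eigenvalue is at least n + 1. *)
exists (Num.bound (`|x| + 3)); have := archi_boundP x0.
move: (Num.bound _) => n; rewrite /eigval; move: (n%:R : R) => q qx.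
have h1 := al1; have h2 := be1; have := ler_norm x; have := normr_ge0 x => h3 h4.
have : 1 * (q + 1) <= (q - al - be) * (q + 1) by rewrite ler_wpM2r; lra.
lra.
Qed.

End Eigenvalues.

Theorem corollary4p11 (R : realType) (al be : R)
    (hal0 : 0 < al) (hal1 : al < 1) (hbe0 : 0 < be) (hbe1 : be < 1)
    (Minf : R[i] -> 'M[R[i]]_2) (hMinf : is_Minfty al be Minf)
    (mu : matrix_measure) (P : trace_density mu)
    (hmu : herglotz_representation P (M0 Minf)) :
  [/\ forall n : nat, inL2 P (fvec al be n),
      forall (n : nat) (phi : R -> 'cV[R[i]]_2), inL2 P phi ->
        (mulx_eigenvector P (eigval al be n) phi <->
         exists2 c : R[i], c != 0 &
           eqL2 P phi (fun x => c *: fvec al be n x)),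
      forall U : (R -> R[i]) -> (R -> 'cV[R[i]]_2),
        spectral_representation al be P U ->
        forall (n : nat) (f : R -> R[i]), inH al be f ->
          (A0_eigenvector al be (eigval al be n) f <->
           exists2 c : R[i], c != 0 &
             eqL2 P (U f) (fun x => c *: fvec al be n x)) &
      forall phi : R -> 'cV[R[i]]_2, inL2 P phi ->
        forall e : R, 0 < e ->
          exists (N : nat) (a : 'I_N -> R[i]),
            (normsqL2 P (fun x => (phi x - \sum_(k < N) a k *: fvec al be k x)%R)
             < e%:E)%E].
Proof.
pose lamb := eigval al be.
(* c4(n) is real by [M0_limit_eigval], so no information is lost and the atomic model can work with
   real weights. *)
pose wt n := re (c4 al be n%:R).
have incr : forall n, lamb n < lamb n.+1 := eigval_incr hal1 hbe1.
have unb : forall x, exists n, x < lamb n := eigval_unbounded hal1 hbe1.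
have reg x i : (forall n, x <> lamb n) ->
    exists l : R, ctends 0^'+ (fun e => M0 Minf (x +i* e) i i) l%:C.
  exact: (M0_limit_regular hal0 hal1 hbe0 hbe1 hMinf).
have pole n : exists rho : R, [/\ rho != 0, wt n != 0 &
    forall i j, ctends 0^'+ (fun e => e%:C * M0 Minf (lamb n +i* e) i j)
      ('i%C * rho%:C * mx22 (wt n)^-1%:C 1 1 (wt n)%:C i j)].
  have [rho [c [rho0 c0 c4c H]]] := M0_limit_eigval hal0 hal1 hbe0 hbe1 hMinf n.
  have -> : wt n = c by rewrite /wt c4c.
  by exists rho.
have c4w n : c4 al be n%:R = (wt n)%:C.
  have [rho [c [_ _ c4c _]]] := M0_limit_eigval hal0 hal1 hbe0 hbe1 hMinf n.
  by rewrite /wt c4c.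
have fvecE n : fvec al be n = atom_vec lamb wt n.
  by apply/funext => x; rewrite /fvec /atom_vec c4w.
have linj : injective lamb.
  move=> m n mn; apply/eqP; rewrite eqn_leq; apply/andP; split; rewrite leqNgt; apply/negP => h.
    by have := lt_le_trans (incr n) (lamb_mono incr h); rewrite mn ltxx.
  by have := lt_le_trans (incr m) (lamb_mono incr h); rewrite mn ltxx.
have ncompl := nu_negligible_compl hmu incr unb reg.
have npos := nu_atom_gt0 hmu incr reg pole.
have Wwt := W_atom hmu incr reg pole.
have eigP := mulx_eigenvectorP linj ncompl npos Wwt.
split.
- by move=> n; rewrite fvecE; exact: (inL2_atom linj ncompl npos Wwt).
- by move=> n phi Lphi; rewrite fvecE; exact: eigP.
- move=> U hU n f Hf; rewrite fvecE.
  rewrite (eigenvector_transfer linj ncompl npos Wwt hU _ Hf).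
  by apply: eigP; case: hU => U1 _ _ _ _; exact: U1.
- move=> phi Lphi e e0.
  have -> : fvec al be = atom_vec lamb wt by apply/funext => n; exact: fvecE.
  exact: (atom_vec_dense linj ncompl npos Wwt Lphi e0).
Qed.
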